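(* Let $L$ be a finite-dimensional semisimple Lie algebra over a field of characteristic zero, and suppose that every minimal parabolic subalgebra of $L$ is $\phi$-free. Then $L$ is an $A$-algebra, and hence $L$ is elementary.
   Context: The Frattini ideal $\phi(B)$ of a Lie algebra $B$ is the largest ideal of $B$ contained in every maximal subalgebra of $B$; $B$ is $\phi$-free if $\phi(B)=0$. $L$ is elementary if $\phi(B)=0$ for every subalgebra $B$ of $L$; $L$ is an $A$-algebra if every nilpotent subalgebra of $L$ is abelian. With $\overline{F}$ the algebraic closure of the ground field $F$ and $\overline{S}=S\otimes_F\overline F$, a subalgebra $P$ of $L$ is parabolic if $\overline{P}$ contains a Borel subalgebra (maximal solvable subalgebra) of $\overline{L}$; minimal parabolic means minimal under inclusion among parabolic subalgebras. *)

(* Defs.v *)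
(* Finite-dimensional Lie algebras over a field, given by
   structure constants with respect to a basis e_0..e_(n-1); subspaces and
   subalgebras are represented as row spaces of n x n matrices (mxalgebra). *)
From HB Require Import structures.
From mathcomp Require Import all_boot all_order all_algebra.
Set Implicit Arguments. Unset Strict Implicit. Unset Printing Implicit Defensive.
Import GRing.Theory.
Local Open Scope ring_scope.

Section Lie.
Variables (R : fieldType) (n : nat).

Definition lie_bracket (c : 'I_n -> 'I_n -> 'rV[R]_n) (u v : 'rV[R]_n) : 'rV[R]_n :=
  \sum_(i < n) \sum_(j < n) (u 0 i * v 0 j) *: c i j.

Definition is_lie (c : 'I_n -> 'I_n -> 'rV[R]_n) : Prop :=
  (forall x, lie_bracket c x x = 0) /\
  (forall x y z, lie_bracket c x (lie_bracket c y z)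
                 + lie_bracket c y (lie_bracket c z x)
                 + lie_bracket c z (lie_bracket c x y) = 0).

Variable c : 'I_n -> 'I_n -> 'rV[R]_n.

Definition subalg (S : 'M[R]_n) : Prop :=
  forall x y, (x <= S)%MS -> (y <= S)%MS -> (lie_bracket c x y <= S)%MS.

Definition ideal_of (B I : 'M[R]_n) : Prop :=
  (I <= B)%MS /\ forall x y, (x <= B)%MS -> (y <= I)%MS -> (lie_bracket c x y <= I)%MS.

Definition max_subalg (B M : 'M[R]_n) : Prop :=
  subalg M /\ (M < B)%MS /\
  forall S, subalg S -> (M <= S)%MS -> (S <= B)%MS -> (S == M)%MS \/ (S == B)%MS.

(* phi(B) = 0 : the largest ideal of B contained in every maximal subalgebra
   of B is zero, i.e. every such ideal is zero *)
Definition phi_free (B : 'M[R]_n) : Prop :=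
  forall I, ideal_of B I -> (forall M, max_subalg B M -> (I <= M)%MS) -> (\rank I == 0)%N.

Definition brmx (A B : 'M[R]_n) : 'M[R]_n :=
  (\sum_(i < n) \sum_(j < n) <<lie_bracket c (row i A) (row j B)>>)%MS.

Definition nilpotent_sub (B : 'M[R]_n) : Prop :=
  exists k, (\rank (iter k (brmx B) B) == 0)%N.

Definition solvable_sub (B : 'M[R]_n) : Prop :=
  exists k, (\rank (iter k (fun I => brmx I I) B) == 0)%N.

Definition abelian_sub (B : 'M[R]_n) : Prop :=
  forall x y, (x <= B)%MS -> (y <= B)%MS -> lie_bracket c x y = 0.

Definition semisimple : Prop :=
  forall I, ideal_of 1%:M I -> solvable_sub I -> (\rank I == 0)%N.

Definition elementary : Prop :=
  forall B, subalg B -> (B <= 1%:M)%MS -> phi_free B.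

Definition A_algebra : Prop :=
  forall B, subalg B -> nilpotent_sub B -> abelian_sub B.

Definition borel (B : 'M[R]_n) : Prop :=
  subalg B /\ solvable_sub B /\
  forall S, subalg S -> solvable_sub S -> (B <= S)%MS -> (S <= B)%MS.

End Lie.

Definition alg_closure (F : fieldType) (K : closedFieldType)
  (iota : {rmorphism F -> K}) : Prop :=
  forall x : K, exists p : {poly F}, p != 0 /\ root (map_poly iota p) x.

Section Parabolic.
Variables (F : fieldType) (K : closedFieldType) (iota : {rmorphism F -> K}) (n : nat).
Variable c : 'I_n -> 'I_n -> 'rV[F]_n.

(* structure constants of L (x) K *)
Definition ext_consts : 'I_n -> 'I_n -> 'rV[K]_n := fun i j => map_mx iota (c i j).

Definition parabolic (P : 'M[F]_n) : Prop :=
  subalg c P /\ exists Bo, borel ext_consts Bo /\ (Bo <= map_mx iota P)%MS.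

Definition min_parabolic (P : 'M[F]_n) : Prop :=
  parabolic P /\ forall Q, parabolic Q -> (Q <= P)%MS -> (P <= Q)%MS.

End Parabolic.

(* Main.v *)
(* Over a field of characteristic zero call a subalgebra nil when its elements
   are ad-nilpotent. If U is a maximal nil subalgebra of L and q its
   normalizer, then the orthogonal of q for the Killing form is U: elements of
   q orthogonal to q are nilpotent because the replicas of their adjoint maps
   are inner and come from q (over the algebraic closure), and Engel's theorem
   on q^perp / U does the rest. The same argument shows that each Borel
   subalgebra b of the algebraic closure is the normalizer of b^perp, a nil
   ideal, and it follows that q is a minimal parabolic. If q is phi-free then U
   is abelian, since [U, U] lies in every maximal subalgebra of q. So all nil
   subalgebras are abelian. A nonabelian nilpotent subalgebra contains x, y with
   [x, y] nonzero and central in it; the nilpotent parts of x and y then span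
   with [x, y] a nonabelian nil subalgebra. Hence L is an A-algebra.

   Let now I be an ideal of a subalgebra B lying in every maximal subalgebra of
   B. Then I is nil, so it lies in an abelian nil subalgebra N normalized by B
   with N(N)^perp = N. On N the elements of B act semisimply (their nilpotent
   parts centralize N), so Weyl's theorem gives a B-equivariant projection of N
   onto I, and duality of N with L / N(N) gives h in L acting as the identity on
   N with [h, N(N)] in N. The composite of ad h with the projection is a
   derivation of B into I that is the identity on I; its kernel is a subalgebra
   complementing I, whence I = 0. *)
Require Import Defs.
From HB Require Import structures.
From mathcomp Require Import all_boot all_order all_algebra all_field.
From mathcomp Require Import boolp classical_sets.
From mathcomp Require Import ring.
Set Implicit Arguments. Unset Strict Implicit. Unset Printing Implicit Defensive.
Import Order.TTheory GRing.Theory.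
Local Open Scope ring_scope.

(** * Replicas of a matrix *)

(** For an additive map [f], the [f]-replica of a matrix acts on each generalized eigenspace as the
    scalar [f a]. Two features make it useful: it is a polynomial in the matrix, so it preserves
    every subspace the matrix preserves; and, [f] being additive, a replica of a derivation is a
    derivation, hence inner once the Killing form is nondegenerate. Rational-valued [f] detect
    nilpotency; [f = id] gives the semisimple part. This one mechanism does the work of Lie's
    theorem, Cartan subalgebras and root spaces. Eigenvalues live in [K] while the subalgebras of
    interest live over [F], so orthogonals and normalizers are written as kernels, which commute
    with extension of scalars, and semisimple parts come from polynomials over [F]. *)

Lemma coprimep_prod_exp_XsubC (K : fieldType) (a : K) (s : seq K) k (m : K -> nat) :
  a \notin s -> coprimep (('X - a%:P) ^+ k) (\prod_(b <- s) ('X - b%:P) ^+ m b).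
Proof.
elim: s => [|b s IH]; first by rewrite big_nil coprimep1.
rewrite inE negb_or => /andP [ab a_s]; rewrite big_cons coprimepMr IH // andbT.
by rewrite coprimep_expl // coprimep_expr // coprimep_XsubC root_XsubC eq_sym.
Qed.

Lemma interpolation_poly (K : fieldType) (f : K -> K) (rs : seq K) (m : nat) :
  uniq rs ->
  exists p : {poly K}, forall a, a \in rs -> ('X - a%:P) ^+ m %| p - (f a)%:P.
Proof.
elim: rs => [|a rs IH] /=; first by exists 0.
case/andP=> a_rs /IH [p Hp].
pose Q := \prod_(b <- rs) ('X - b%:P) ^+ m.
have coQ : coprimep (('X - a%:P) ^+ m) Q by exact: (@coprimep_prod_exp_XsubC _ _ _ m (fun=> m)).
have /Bezout_eq1_coprimepP [[u v] /= uv] := coQ.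
(* [v * Q] is 1 modulo the new modulus and 0 modulo the earlier ones, so the correction settles [a]
   and disturbs no other congruence. *)
exists (p + ((f a)%:P - p) * (v * Q)) => b; rewrite inE => /orP [/eqP -> | brs].
  have -> : p + ((f a)%:P - p) * (v * Q) - (f a)%:P = (p - (f a)%:P) * (u * ('X - a%:P) ^+ m).
    by rewrite -[u * _](addrK (v * Q)) uv mulrBr mulr1 -[(f a)%:P - p]opprB mulNr addrAC.
  by rewrite mulrA dvdp_mull.
rewrite addrAC dvdp_add ?Hp // mulrA dvdp_mull // /Q (big_rem b) //= dvdp_mulr //.
Qed.

(** Newton's iteration started at ['X], a root of [q] modulo [q]. It stays over the base field and
    names no eigenvalue, which is what makes semisimple parts rational. *)
Lemma hensel_poly (F : fieldType) (q : {poly F}) (m : nat) :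
  coprimep q q^`() -> exists s : {poly F}, q ^+ m %| q \Po s /\ q %| s - 'X.
Proof.
move=> /Bezout_eq1_coprimepP [[u v] /= uv].
suff H k : exists s : {poly F}, q ^+ k.+1 %| q \Po s /\ q %| s - 'X.
  case: m => [|m]; last exact: H.
  by have [s [_ ?]] := H 0; exists s; rewrite expr0 dvd1p.
elim: k => [|k [s [Hs sX]]].
  by exists 'X; rewrite comp_polyXr subrr dvdp0 dvdpp.
(* The Newton step: [v] inverts the derivative of [q] modulo [q], and substituting [s] for ['X]
   changes nothing modulo [q]. *)
exists (s - (q \Po s) * v); split; last first.
  rewrite addrAC dvdp_sub // dvdp_mulr // (dvdp_trans _ Hs) //.
  exact: (dvdp_exp2l q (isT : 1 <= k.+1)%N).
have dvd_comp (p : {poly F}) : q %| p \Po s - p.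
  elim/poly_ind: p => [|p c IH]; first by rewrite comp_poly0 subr0.
  rewrite comp_polyD comp_polyM comp_polyX comp_polyC opprD addrACA subrr addr0.
  have -> : (p \Po s) * s - p * 'X = (p \Po s - p) * s + p * (s - 'X).
    by rewrite mulrBl mulrBr addrA subrK.
  by rewrite dvdp_add // ?(dvdp_mulr _ IH) ?(dvdp_mull _ sX).
set t := (q \Po s) * v.
have taylor (p : {poly F}) : exists r, p \Po (s - t) = p \Po s - (p^`() \Po s) * t + r * t ^+ 2.
  elim/poly_ind: p => [|p c [r IH]]; first by exists 0; rewrite deriv0 !comp_poly0 !mul0r subr0 addr0.
  exists (r * (s - t) + (p^`() \Po s)).
  rewrite derivD derivC addr0 derivM derivX mulr1 !comp_polyD !comp_polyM !comp_polyX !comp_polyC IH.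
  ring.
have [r ->] := taylor q.
rewrite dvdp_add //.
  have -> : q \Po s - (q^`() \Po s) * t = (q \Po s) * (1 - v * (q^`() \Po s)).
    by rewrite /t; ring.
  rewrite exprSr dvdp_mul //.
  have -> : 1 - v * (q^`() \Po s) = u * q - v * ((q^`() \Po s) - q^`()).
    by rewrite mulrBr opprB addrA uv.
  by rewrite dvdp_sub ?(dvdp_mull _ (dvd_comp _)) ?dvdp_mull.
rewrite dvdp_mull // /t exprMn dvdp_mulr // expr2.
rewrite (dvdp_trans _ (dvdp_mul Hs Hs)) // -exprD dvdp_exp2l // addSn ltnS leq_addl //.
Qed.

(* [horner_mx] only makes sense for nonempty matrices. *)
Definition polymx (R : comNzRingType) n (A : 'M[R]_n) (p : {poly R}) : 'M[R]_n :=
  (if n is n'.+1 then horner_mx^~ p : 'M_n'.+1 -> 'M_n'.+1 else id) A.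

Section PolyMx.
Variables (R : comNzRingType) (n : nat) (A : 'M[R]_n).
Implicit Types p q : {poly R}.

Lemma polymxC a : polymx A a%:P = a%:M.
Proof. by case: n A => [|m] B; [exact: etrans (flatmx0 _) (esym (flatmx0 _)) | rewrite /polymx horner_mx_C]. Qed.

Lemma polymxX : polymx A 'X = A.
Proof. by case: n A => [|m] B //; rewrite /polymx horner_mx_X. Qed.

Lemma polymxD p q : polymx A (p + q) = polymx A p + polymx A q.
Proof. by case: n A => [|m] B; [exact: etrans (flatmx0 _) (esym (flatmx0 _)) | rewrite /polymx rmorphD]. Qed.

Lemma polymxM p q : polymx A (p * q) = polymx A p *m polymx A q.
Proof. by case: n A => [|m] B; [exact: etrans (flatmx0 _) (esym (flatmx0 _)) | rewrite /polymx rmorphM]. Qed.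

Lemma polymxB p q : polymx A (p - q) = polymx A p - polymx A q.
Proof. by case: n A => [|m] B; [exact: etrans (flatmx0 _) (esym (flatmx0 _)) | rewrite /polymx rmorphB]. Qed.

Lemma polymxXn p k : polymx A (p ^+ k) = polymx A p ^+ k.
Proof. by case: n A => [|m] B; [exact: etrans (flatmx0 _) (esym (flatmx0 _)) | rewrite /polymx rmorphXn]. Qed.

Lemma polymx0 : polymx A 0 = 0.
Proof. by rewrite -[0]/(0%:P) polymxC raddf0. Qed.

Lemma polymx_char : polymx A (char_poly A) = 0.
Proof. by case: n A => [|m] B; [exact: etrans (flatmx0 _) (esym (flatmx0 _)) | exact: Cayley_Hamilton]. Qed.

Lemma polymx_comm p q : polymx A p *m polymx A q = polymx A q *m polymx A p.
Proof. by rewrite -!polymxM mulrC. Qed.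

End PolyMx.

Lemma polymx_stable (K : fieldType) n (A : 'M[K]_n) m (V : 'M[K]_(m, n)) p :
  stablemx V A -> stablemx V (polymx A p).
Proof.
move=> VA; elim/poly_ind: p => [|p c IH]; first by rewrite polymx0 stablemx0.
by rewrite polymxD polymxM polymxX polymxC stablemxD ?stablemxM ?stablemxC.
Qed.

Lemma map_polymx (F K : fieldType) (f : {rmorphism F -> K}) n (A : 'M[F]_n) p :
  map_mx f (polymx A p) = polymx (map_mx f A) (map_poly f p).
Proof. by case: n A => [|m] A; [exact: etrans (flatmx0 _) (esym (flatmx0 _)) | rewrite /polymx map_horner_mx]. Qed.

Definition gen_eig (K : fieldType) n (A : 'M[K]_n) (a : K) (v : 'rV[K]_n) : Prop :=
  exists k, v *m (A - a%:M) ^+ k = 0.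

Section GenEig.
Variables (K : closedFieldType) (n : nat) (A : 'M[K]_n).

Lemma gen_eig_polymx (P p : {poly K}) (f : K -> K) :
  P != 0 -> polymx A P = 0 ->
  (forall a, root P a -> ('X - a%:P) ^+ size P %| p - (f a)%:P) ->
  forall a v, gen_eig A a v -> v *m polymx A p = f a *: v.
Proof.
move=> P0 PA Hp a v [k vk].
have kX : v *m polymx A (('X - a%:P) ^+ k) = 0.
  by rewrite polymxXn polymxB polymxX polymxC.
set g := gcdp (('X - a%:P) ^+ k) P.
have vg : v *m polymx A g = 0.
  have [[u w] /= /eqpP [[c1 c2] /= /andP [c10 c20] E]] := Bezoutp (('X - a%:P) ^+ k) P.
  have E2 : g = c2^-1%:P * (c1%:P * (u * ('X - a%:P) ^+ k + w * P)).
    by rewrite !mul_polyC E scalerA mulVf // scale1r.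
  rewrite E2 !mulrDr !mulrA polymxD !polymxM PA !mulmx0 addr0 -!polymxM.
  by rewrite [X in v *m X]polymxM polymx_comm mulmxA kX mul0mx.
have : g %| p - (f a)%:P.
  have /dvdp_exp_XsubCP [j jk gj] : g %| ('X - a%:P) ^+ k by exact: dvdp_gcdl.
  rewrite (eqp_dvdl _ gj); case: j {jk} gj => [|j] gj; first by rewrite expr0 dvd1p.
  have gP : ('X - a%:P) ^+ j.+1 %| P by rewrite -(eqp_dvdl _ gj) dvdp_gcdr.
  have ra : root P a by rewrite root_factor_theorem (dvdp_trans _ gP) // exprS dvdp_mulIl.
  rewrite (dvdp_trans _ (Hp a ra)) // dvdp_exp2l //.
  by have := dvdp_leq P0 gP; rewrite size_exp_XsubC => /ltnW.
case/dvdpP => w /(canRL (subrK _)) ->.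
by rewrite polymxD mulmxDr polymxC mul_mx_scalar polymxM polymx_comm mulmxA vg mul0mx add0r.
Qed.

(** The space is the sum of the generalized eigenspaces. Each round splits off one primary factor of
    the characteristic polynomial by Bezout. *)
Lemma gen_eig_span (Q : 'rV[K]_n -> Prop) :
  Q 0 -> (forall u v, Q u -> Q v -> Q (u + v)) ->
  (forall a v, gen_eig A a v -> Q v) -> forall v, Q v.
Proof.
move=> Q0 QD Qg v.
have [rs Ers] := closed_field_poly_normal (char_poly A).
have lc : lead_coef (char_poly A) = 1 by apply/eqP; exact: char_poly_monic.
rewrite lc scale1r -prodr_undup_exp_count in Ers.
suff H s (m : K -> nat) w : uniq s ->
    w *m polymx A (\prod_(i <- s) ('X - i%:P) ^+ m i) = 0 -> Q w.
  apply: (H (undup rs) (fun i => count_mem i rs)); first exact: undup_uniq.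
  by rewrite -Ers polymx_char mulmx0.
elim: s w => [|r s IH] w.
  by rewrite big_nil (polymxC A 1) mulmx1 => _ ->.
case/andP=> rs' us; rewrite big_cons.
set X := _ ^+ _; set Y := \prod_(i <- s) _.
have coXY : coprimep X Y by exact: coprimep_prod_exp_XsubC.
have /Bezout_eq1_coprimepP [[u1 u2] /= uw] := coXY.
move=> XY0.
have -> : w = w *m polymx A (u1 * X) + w *m polymx A (u2 * Y).
  by rewrite -mulmxDr -polymxD uw (polymxC A 1) mulmx1.
apply: QD.
  apply: IH => //; rewrite -mulmxA -polymxM -mulrA polymxM polymx_comm mulmxA.
  by rewrite XY0 mul0mx.
apply: (Qg r); exists (m r).
have -> : (A - r%:M) ^+ m r = polymx A X.
  by rewrite polymxXn polymxB polymxX polymxC.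
rewrite -mulmxA -polymxM -mulrA [Y * _]mulrC polymxM polymx_comm mulmxA.
by rewrite XY0 mul0mx.
Qed.

End GenEig.

Lemma trig_similar (K : closedFieldType) n (A : 'M[K]_n) :
  exists2 P, P \in unitmx & is_trig_mx (P *m A *m invmx P).
Proof.
elim: n A => [|n IH] A.
  by exists 1%:M; [exact: unitmx1 | apply/is_trig_mxP => -[]].
have [a ra] : exists a, root (char_poly A) a by apply/closed_rootP; rewrite size_char_poly.
have /eigenvalueP [v vA v0] : eigenvalue A a by rewrite eigenvalue_root_char.
(* Completes the eigenvector to a basis: the first row of [row_ebase v] is proportional to [v]. *)
pose P0 : 'M_(1 + n) := row_ebase v.
have uP0 : P0 \in unitmx by exact: row_ebase_unit.
have rP : row 0 P0 *m A = a *: row 0 P0.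
  have rv : \rank v = 1%N by rewrite rank_rV v0.
  have := mulmx_ebase v; rewrite rv => ev.
  have ev2 : v = (col_ebase v 0 0) *: row 0 P0.
    rewrite -[LHS]ev -mul_scalar_mx -mx11_scalar -mulmxA; congr (_ *m _).
    by rewrite rowE; congr (_ *m _); apply/rowP => j; rewrite !mxE andbT eqxx eq_sym.
  have c0 : col_ebase v 0 0 != 0.
    by apply: contra_neq v0 => c0; rewrite ev2 c0 scale0r.
  apply: (scalerI c0); rewrite scalemxAl -ev2 vA {1}ev2 !scalerA mulrC //.
pose B : 'M_(1 + n) := P0 *m A *m invmx P0.
have rB : row 0 B = a *: delta_mx 0 0.
  rewrite /B !row_mul rP -scalemxAl -row_mul mulmxV // row1 //.
have [P1 uP1 tP1] := IH (drsubmx B).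
pose Q := block_mx 1%:M 0 0 P1 : 'M_(1 + n).
have uQ : Q \in unitmx.
  by rewrite unitmxE det_ublock det1 mul1r -unitmxE.
have iQ : invmx Q = block_mx 1%:M 0 0 (invmx P1).
  rewrite -[RHS]mul1mx -(mulVmx uQ) -mulmxA mulmx_block.
  by rewrite !mulmx1 !mul0mx !mulmx0 !addr0 add0r mulmxV // -scalar_mx_block mulmx1.
exists (Q *m P0); first by rewrite unitmx_mul uQ uP0.
have -> : Q *m P0 *m A *m invmx (Q *m P0) = Q *m B *m invmx Q.
  by rewrite [invmx _](invrM uQ uP0) /B !mulmxA.
have ur : ursubmx B = 0.
  have rB0 j : B 0 (rshift 1 j) = 0.
    by move/rowP: rB => /(_ (rshift 1 j)); rewrite mxE => ->; rewrite !mxE /= mulr0.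
  apply/rowP => j; rewrite [RHS]mxE -(rB0 j) /ursubmx mxE mxE.
  by congr (fun_of_matrix _ _ _); apply/val_inj.
rewrite iQ -[B]submxK ur !mulmx_block.
rewrite !(mul1mx, mulmx1, mul0mx, mulmx0, addr0, add0r).
apply/is_trig_mxP => i j.
case: (@split_ordP 1 n i) => i1 ->; case: (@split_ordP 1 n j) => j1 ->.
- by rewrite !ord1.
- by move=> _; rewrite (@block_mxEur _ 1 n 1 n) mxE.
- by rewrite /= ord1.
- by rewrite (@block_mxEdr _ 1 n 1 n) /= ltn_add2l; exact: (is_trig_mxP tP1).
Qed.

Lemma trig_mxM (R : comNzRingType) n (A B : 'M[R]_n) :
  is_trig_mx A -> is_trig_mx B ->
  is_trig_mx (A *m B) /\ forall i, (A *m B) i i = A i i * B i i.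
Proof.
move=> /is_trig_mxP tA /is_trig_mxP tB; split.
  apply/is_trig_mxP => i j ij; rewrite mxE big1 // => k _.
  case: (ltnP i k) => [ik|ki]; first by rewrite tA ?mul0r.
  by rewrite tB ?mulr0 // (leq_ltn_trans ki ij).
move=> i; rewrite mxE (bigD1 i) //= big1 ?addr0 // => k ki.
case: (ltngtP i k) => [ik|ik|/val_inj E]; first by rewrite tA ?mul0r.
  by rewrite tB ?mulr0.
by rewrite E eqxx in ki.
Qed.

Lemma trig_polymx (R : comNzRingType) n (A : 'M[R]_n) p :
  is_trig_mx A ->
  is_trig_mx (polymx A p) /\ forall i, polymx A p i i = p.[A i i].
Proof.
move=> tA; elim/poly_ind: p => [|p c [IHt IHd]].
  by rewrite polymx0; split=> [|i]; [apply/is_trig_mxP => i j _; rewrite mxE | rewrite mxE horner0].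
rewrite polymxD polymxM polymxX polymxC.
have [tM dM] := trig_mxM IHt tA; split.
  apply/is_trig_mxP => i j ij; rewrite mxE (is_trig_mxP tM) // add0r mxE.
  by rewrite -val_eqE (ltn_eqF ij).
by move=> i; rewrite mxE dM IHd [_%:M i i]mxE eqxx !hornerE.
Qed.

Lemma polymx_conj (F : fieldType) n (P A : 'M[F]_n) p :
  P \in unitmx -> polymx (P *m A *m invmx P) p = P *m polymx A p *m invmx P.
Proof.
move=> uP; elim/poly_ind: p => [|p c IH]; first by rewrite !polymx0 mulmx0 mul0mx.
rewrite !polymxD !polymxM !polymxX !polymxC IH mulmxDr mulmxDl !mulmxA mulmxKV //.
by rewrite mul_mx_scalar -scalemxAl mulmxV // scalemx1.
Qed.

(** The list [rs] is the spectrum with multiplicity, read off the diagonal of a triangular form. *)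
Lemma trace_polymx (K : closedFieldType) n (A : 'M[K]_n) :
  exists rs : seq K,
  [/\ forall r, r \in rs -> root (char_poly A) r,
      forall p, \tr (polymx A p) = \sum_(r <- rs) p.[r]
    & (forall r, r \in rs -> r = 0) -> A ^+ n = 0].
Proof.
have [P uP tP] := trig_similar A; set T := P *m A *m invmx P in tP.
exists [seq T i i | i <- enum 'I_n]; split.
- move=> r /mapP [i _ ->]; rewrite -eigenvalue_root_char.
  have /eigenvalueP [v vT v0] : eigenvalue T (T i i).
    by rewrite eigenvalue_root_char char_poly_trig // (bigD1 i) //= rootM root_XsubC eqxx.
  apply/eigenvalueP; exists (v *m P).
    have TP : T *m P = P *m A by rewrite /T mulmxKV.
    by rewrite -mulmxA -TP mulmxA vT -scalemxAl.
  by apply: contra_neq v0 => vP; rewrite -[v](mulmxK uP) vP mul0mx.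
- move=> p; have [_ dp] := trig_polymx p tP.
  rewrite big_map big_enum /= -(eq_bigr _ (fun i _ => dp i)).
  by rewrite -[RHS]/(\tr _) polymx_conj // mxtrace_mulC mulmxA mulVmx // mul1mx.
- move=> r0; have := polymx_char T; rewrite char_poly_trig //.
  have -> : \prod_(i < n) ('X - (T i i)%:P) = 'X ^+ n.
    transitivity (\prod_(i < n) ('X : {poly K})); last by rewrite prodr_const card_ord.
    apply: eq_bigr => i _; have -> : T i i = 0; last by rewrite subr0.
    by apply: r0; apply/mapP; exists i; rewrite ?mem_enum.
  rewrite polymx_conj // polymxXn polymxX => E.
  have := congr1 (fun M => invmx P *m M *m P) E; rewrite mulmx0 mul0mx.
  by rewrite !mulmxA mulVmx // mul1mx mulmxKV.
Qed.

(** * Rational linear functionals in characteristic zero *)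

Section RatFunctional.
Variable K : fieldType.
Hypothesis charK : [pchar K] =i pred0.

Lemma pchar0_intr_inj (z : int) : z%:~R = 0 :> K -> z = 0.
Proof.
have /pcharf0P H := charK.
case: z => k /eqP; first by rewrite H => /eqP ->.
by rewrite NegzE mulrNz oppr_eq0 H.
Qed.

(* [ratr] is a ring morphism for [numFieldType] in the library; only
   characteristic zero is needed. *)
Lemma ratr_frac (q : rat) (d n : int) :
  d != 0 -> q * d%:~R = n%:~R -> ratr q * d%:~R = n%:~R :> K.
Proof.
move=> d0 E.
have dq0 : (denq q)%:~R != 0 :> K.
  by apply/eqP => /pchar0_intr_inj /eqP; rewrite (negPf (denq_neq0 q)).
have E2 : numq q * d = n * denq q.
  apply: (intr_inj (R := rat)); rewrite !rmorphM /= -E numqE mulrAC //.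
rewrite /ratr mulrAC -rmorphM E2 rmorphM /= mulfK //.
Qed.

Lemma ratrDK (x y : rat) : ratr (x + y) = ratr x + ratr y :> K.
Proof.
have Hd z : (denq z)%:~R != 0 :> K.
  by apply/eqP => /pchar0_intr_inj /eqP; rewrite (negPf (denq_neq0 z)).
have E z : ratr z * (denq z)%:~R = (numq z)%:~R :> K by apply: ratr_frac; rewrite ?denq_neq0 // numqE.
apply: (mulIf (mulf_neq0 (Hd x) (Hd y))).
rewrite -rmorphM /= (@ratr_frac _ _ (numq x * denq y + numq y * denq x)).
- by rewrite rmorphD !rmorphM /= -!E; ring.
- by rewrite mulf_neq0 ?denq_neq0.
- by rewrite rmorphD !rmorphM /= !numqE; ring.
Qed.

Lemma ratrMK (x y : rat) : ratr (x * y) = ratr x * ratr y :> K.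
Proof.
have Hd z : (denq z)%:~R != 0 :> K.
  by apply/eqP => /pchar0_intr_inj /eqP; rewrite (negPf (denq_neq0 z)).
have E z : ratr z * (denq z)%:~R = (numq z)%:~R :> K by apply: ratr_frac; rewrite ?denq_neq0 // numqE.
apply: (mulIf (mulf_neq0 (Hd x) (Hd y))).
rewrite -rmorphM /= (@ratr_frac _ _ (numq x * numq y)).
- by rewrite !rmorphM /= -!E; ring.
- by rewrite mulf_neq0 ?denq_neq0.
- by rewrite !rmorphM /= !numqE; ring.
Qed.

Lemma ratr1K : ratr 1 = 1 :> K.
Proof. by rewrite -[LHS]mulr1 (@ratr_frac 1 1 1). Qed.

Lemma ratr0K : ratr 0 = 0 :> K.
Proof. by apply: (@addIr _ (ratr 0)); rewrite -ratrDK !add0r. Qed.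

Lemma ratrNK x : ratr (- x) = - ratr x :> K.
Proof. by apply: (@addIr _ (ratr x)); rewrite -ratrDK !addNr ratr0K. Qed.

(** A rational subspace [H] maximal among those avoiding [a] is a hyperplane, and [f x] is the
    coefficient of [a] in [x] modulo [H]. *)
Lemma rat_functional (a : K) : a != 0 ->
  exists f : K -> rat,
  [/\ forall x y, f (x + y) = f x + f y,
      forall q x, f (ratr q * x) = q * f x & f a = 1].
Proof.
move=> a0.
pose P (H : set K) := (forall x y q, H x -> H y -> H (x + ratr q * y)) /\ ~ H a.
have [H [[HD Ha] Hmax]] : exists A, P A /\ forall B, (A `<` B)%classic -> ~ P B.
  apply: Zorn_bigcup => F FP tF; split; last by case=> A FA; case: (FP A FA).
  move=> x y q [A FA Ax] [B FB By].
  have [AB|BA] := tF _ _ FA FB.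
    by exists B => //; case: (FP B FB) => h _; apply: h => //; exact: AB.
  by exists A => //; case: (FP A FA) => h _; apply: h => //; exact: BA.
(* The empty set satisfies [P] as well, so [0] has to come from maximality. *)
have H0 : H 0.
  have [[x Hx]|nH] := pselect (exists x, H x).
    by have := HD x x (-1) Hx Hx; rewrite ratrNK ratr1K mulN1r subrr.
  exfalso; apply: (Hmax [set 0]%classic); first by split=> [x Hx|/(_ 0 erefl) h]; exfalso; apply: nH; [exists x | exists 0].
  by split=> [x y q -> ->|/= E]; [rewrite mulr0 addr0 | move: a0; rewrite E eqxx].
have HZ q x : H x -> H (ratr q * x) by move=> Hx; rewrite -[_ * _]add0r; exact: HD.
have HDD x y : H x -> H y -> H (x + y) by move=> Hx Hy; rewrite -[y]mul1r -ratr1K; exact: HD.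
have ex x : exists q : rat, H (x - ratr q * a).
  have [Hx|nHx] := pselect (H x); first by exists 0; rewrite ratr0K mul0r subr0.
  (* Adjoining [x] to [H] must capture [a] by maximality; the resulting equation is solved for
     [x]. *)
  pose B := [set y | exists h q, H h /\ y = h + ratr q * x]%classic.
  have AB : (H `<` B)%classic.
    split=> [y Hy|BH]; first by exists y, 0; rewrite ratr0K mul0r addr0.
    by apply: nHx; apply: BH; exists 0, 1; rewrite ratr1K mul1r add0r.
  have BD : forall y z q, B y -> B z -> B (y + ratr q * z).
    move=> _ _ q [h [r [Hh ->]]] [h' [r' [Hh' ->]]].
    exists (h + ratr q * h'), (r + q * r'); split; first exact: HD.
    by rewrite ratrDK ratrMK; ring.
  have [[h [q [Hh ea]]]|nBa] := pselect (B a); last by case: (Hmax _ AB).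
  have q0 : q != 0.
    by apply/eqP => q0; apply: Ha; rewrite ea q0 ratr0K mul0r addr0.
  exists q^-1.
  have -> : x - ratr q^-1 * a = ratr (- q^-1) * h.
    by rewrite ea mulrDr mulrA -ratrMK mulVf // ratr1K mul1r ratrNK; ring.
  exact: HZ.
have un x q r : H (x - ratr q * a) -> H (x - ratr r * a) -> q = r.
  move=> H1 H2; apply/eqP; apply: contrapT => /negP qr; apply: Ha.
  have : H (ratr (q - r) * a).
    have := HD _ _ (-1) H2 H1; rewrite ratrNK ratr1K mulN1r ratrDK ratrNK.
    by congr (H _); ring.
  move=> /(HZ (q - r)^-1); rewrite mulrA -ratrMK mulVf ?ratr1K ?mul1r //.
  by rewrite subr_eq0.
have [f Hf] := choice ex.
exists f; split.
- move=> x y; apply: (un (x + y)) => //; have := HDD _ _ (Hf x) (Hf y).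
  by rewrite ratrDK; congr (H _); ring.
- move=> q x; apply: (un (ratr q * x)) => //; have := HZ q _ (Hf x).
  by rewrite ratrMK; congr (H _); ring.
- by apply: (un a) => //; rewrite ratr1K mul1r subrr.
Qed.

End RatFunctional.

Definition interpolates (K : fieldType) (f : K -> K) m (P p : {poly K}) : Prop :=
  forall a, root P a -> ('X - a%:P) ^+ m %| p - (f a)%:P.

Lemma interpolates_exists (K : closedFieldType) (f : K -> K) m (P : {poly K}) :
  P != 0 -> exists p, interpolates f m P p.
Proof.
move=> P0; have [rs Ers] := closed_field_poly_normal P.
have [p Hp] := interpolation_poly f m (undup_uniq rs).
exists p => a ra; apply: Hp; rewrite mem_undup.
by move: ra; rewrite Ers rootZ ?lead_coef_eq0 // root_prod_XsubC.
Qed.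

Lemma interpolates_horner (K : fieldType) (f : K -> K) m (P p : {poly K}) a :
  interpolates f m.+1 P p -> root P a -> p.[a] = f a.
Proof.
move=> Hp /Hp; rewrite exprS => /(dvdp_trans (dvdp_mulIl _ _)).
by rewrite -root_factor_theorem rootE !hornerE subr_eq0 => /eqP.
Qed.

Lemma root_char_annul (F : fieldType) n (A : 'M[F]_n) (P : {poly F}) a :
  polymx A P = 0 -> root (char_poly A) a -> root P a.
Proof.
rewrite -eigenvalue_root_char => PA /eigenvalueP [v vA v0].
have E (p : {poly F}) : v *m polymx A p = p.[a] *: v.
  elim/poly_ind: p => [|p c IH]; first by rewrite polymx0 mulmx0 horner0 scale0r.
  rewrite polymxD polymxM polymxX polymxC mulmxDr mulmxA IH -scalemxAl vA scalerA.
  by rewrite mul_mx_scalar -scalerDl !hornerE.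
by have := E P; rewrite PA mulmx0 => /esym/eqP; rewrite scaler_eq0 (negPf v0) orbF.
Qed.

(* The trace argument behind Cartan's criterion: apply [f] with values in the
   prime field to [sum_i a_i f(a_i) = 0] to get [sum_i f(a_i)^2 = 0]. *)
Lemma replica_nilpotent (K : closedFieldType) n (A : 'M[K]_n) (P : {poly K}) m :
  [pchar K] =i pred0 -> polymx A P = 0 ->
  (forall f : K -> K, (forall x y, f (x + y) = f x + f y) ->
   forall p, interpolates f m.+1 P p -> \tr (A *m polymx A p) = 0) ->
  P != 0 -> A ^+ n = 0.
Proof.
move=> cK PA Htr P0; have [rs [rsr rst rsn]] := trace_polymx A.
apply: rsn => r r_rs; apply/eqP; apply: contrapT => /negP r0.
have [f0 [f0D f0Z f0r]] := rat_functional cK r0.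
have [p Hp] := interpolates_exists (fun x => ratr (f0 x)) m.+1 P0.
have := Htr _ (fun x y => etrans (congr1 _ (f0D x y)) (ratrDK cK _ _)) p Hp.
rewrite -{1}(polymxX A) -polymxM rst => /(congr1 f0).
have f00 : f0 0 = 0 by apply: (@addIr _ (f0 0)); rewrite -f0D !add0r.
rewrite (big_morph f0 f0D f00) f00 big_seq.
rewrite (eq_bigr (fun s => f0 s * f0 s)) => [|s s_rs]; last first.
  rewrite hornerM hornerX (interpolates_horner Hp) ?(root_char_annul PA) ?rsr //.
  by rewrite mulrC f0Z.
rewrite -big_seq => /eqP; rewrite Num.Theory.psumr_eq0 => [/allP /(_ r r_rs)|s _].
  by rewrite f0r.
by rewrite -expr2 Num.Theory.sqr_ge0.
Qed.

(** The multiplicity of a root drops by exactly one in the derivative in characteristic zero, so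
    dividing [P] by its gcd with its derivative keeps every root. *)
Lemma separable_radical (F : fieldType) (K : closedFieldType)
    (iota : {rmorphism F -> K}) (P : {poly F}) :
  [pchar F] =i pred0 -> P != 0 ->
  exists q : {poly F}, coprimep q q^`() /\
    forall a, root (map_poly iota P) a -> root (map_poly iota q) a.
Proof.
move=> cF P0; pose g := gcdp P P^`(); exists (P %/ g); split.
  by have := make_separable P0; rewrite unlock.
move=> a ra; apply: contrapT => /negP nra.
have [m [r nr Er]] := multiplicity_XsubC (map_poly iota P) a.
rewrite map_poly_eq0 P0 /= in nr.
have Pg : P = (P %/ g) * g by rewrite divpK // dvdp_gcdl.
have co : coprimep (('X - a%:P) ^+ m) (map_poly iota (P %/ g)).
  by rewrite coprimep_expl // coprimep_sym coprimep_XsubC.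
have : ('X - a%:P) ^+ m %| map_poly iota P^`().
  apply: (@dvdp_trans _ (map_poly iota g)); last by rewrite dvdp_map dvdp_gcdr.
  rewrite -(Gauss_dvdpr _ co) -rmorphM /= -Pg Er dvdp_mulIr //.
rewrite -deriv_map Er derivM dvdp_addr; last by rewrite dvdp_mulIr.
case: m co Er => [|m] co Er.
  by move: ra; rewrite Er expr0 mulr1 (negPf nr).
rewrite deriv_exp derivXsubC mul1r /=.
rewrite -mulr_natl mulrA exprS dvdp_mul2r ?expf_neq0 ?polyXsubC_eq0 //.
rewrite -root_factor_theorem rootM (negPf nr) /= rootE hornerMn hornerC.
have /pcharf0P -> // : [pchar K] =i pred0.
by move=> p; rewrite (fmorph_pchar iota) cF.
Qed.

(** Over [K], write [q] as [r] times ['X - a%:P]. Then [q \Po s] is [r \Po s] times [s - a], and the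
    first factor does not vanish at [a] because the root is simple; so the Hensel divisibility turns
    into the congruence at [a]. *)
Lemma jordan_poly (F : fieldType) (K : closedFieldType)
    (iota : {rmorphism F -> K}) m (P : {poly F}) :
  [pchar F] =i pred0 -> P != 0 ->
  exists s : {poly F}, interpolates id m (map_poly iota P) (map_poly iota s).
Proof.
move=> cF P0; have [q [sq rq]] := separable_radical iota cF P0.
have [s [qs sX]] := hensel_poly m sq; exists s => a /rq ra.
have [r Er] : exists r, map_poly iota q = r * ('X - a%:P).
  by apply/dvdpP; rewrite -root_factor_theorem.
have ra0 : ~~ root r a.
  have : separable_poly (map_poly iota q) by rewrite separable_map unlock.
  by rewrite Er separable_root => /andP [].
have sa : (map_poly iota s).[a] = a.
  have : root (map_poly iota (s - 'X)) a.
    by apply: (root_dvdp (p := map_poly iota q)); rewrite ?dvdp_map.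
  by rewrite rmorphB /= map_polyX rootE !hornerE subr_eq0 => /eqP.
have : ('X - a%:P) ^+ m %| map_poly iota (q \Po s).
  apply: (@dvdp_trans _ (map_poly iota (q ^+ m))); last by rewrite dvdp_map.
  by rewrite rmorphXn /= dvdp_exp2r // -root_factor_theorem.
rewrite map_comp_poly Er comp_polyM comp_polyB comp_polyX comp_polyC.
rewrite Gauss_dvdpr // coprimep_expl // coprimep_sym coprimep_XsubC rootE horner_comp sa.
exact: ra0.
Qed.

Definition replica (K : fieldType) (f : K -> K) n (A R : 'M[K]_n) : Prop :=
  forall a v, gen_eig A a v -> v *m R = f a *: v.

Lemma replica_polymx (K : closedFieldType) (f : K -> K) n (A : 'M[K]_n) m (P p : {poly K}) :
  P != 0 -> polymx A P = 0 -> (size P <= m)%N -> interpolates f m P p ->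
  replica f A (polymx A p).
Proof.
move=> P0 PA Pm Hp a v; apply: (gen_eig_polymx P0 PA) => b /Hp.
by apply: dvdp_trans; rewrite dvdp_exp2l.
Qed.

(** * Replicas and bilinear products *)

Section Leibniz.
Variables (K : closedFieldType) (n1 n2 n3 : nat).
Variable B : 'rV[K]_n1 -> 'rV[K]_n2 -> 'rV[K]_n3.
Hypothesis BDl : forall u u' v, B (u + u') v = B u v + B u' v.
Hypothesis BDr : forall u v v', B u (v + v') = B u v + B u v'.
Hypothesis BZl : forall a u v, B (a *: u) v = a *: B u v.
Hypothesis BZr : forall a u v, B u (a *: v) = a *: B u v.
Variables (T1 : 'M[K]_n1) (T2 : 'M[K]_n2) (T3 : 'M[K]_n3).
Hypothesis BT : forall u v, B u v *m T3 = B (u *m T1) v + B u (v *m T2).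

Let B0l v : B 0 v = 0. Proof. by rewrite -(scale0r 0) BZl scale0r. Qed.
Let B0r u : B u 0 = 0. Proof. by rewrite -(scale0r 0) BZr scale0r. Qed.

(** The operator shifted by [a + b] acts on the product by the Leibniz rule with shifts [a] and [b],
    whence an induction on [k + l]. *)
Lemma gen_eig_leibniz a b u v :
  gen_eig T1 a u -> gen_eig T2 b v -> gen_eig T3 (a + b) (B u v).
Proof.
move=> [k uk] [l vl]; exists (k + l)%N.
have [N] := ubnP (k + l); elim: N => // N IH in k l u v uk vl *; rewrite ltnS => klN.
case: k uk klN => [|k] uk klN.
  by move: uk; rewrite expr0 mulmx1 => ->; rewrite B0l mul0mx.
case: l vl klN => [|l] vl klN.
  by move: vl; rewrite expr0 mulmx1 => ->; rewrite B0r mul0mx.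
rewrite addnS exprS -mulmxE mulmxA.
have -> : B u v *m (T3 - (a + b)%:M) = B (u *m (T1 - a%:M)) v + B u (v *m (T2 - b%:M)).
  rewrite !mulmxBr !mul_mx_scalar BT -!scaleNr BDl BDr BZl BZr !scaleNr scalerDl opprD.
  by rewrite addrACA.
rewrite mulmxDl -[in X in _ = X](addr0 0); congr (_ + _).
  rewrite addSnnS; apply: IH => //.
  by rewrite -mulmxA mulmxE -exprS.
apply: IH => //; last by rewrite -addnS.
by rewrite -mulmxA mulmxE -exprS.
Qed.

(** Eigenvalues add under [B], and [f] is additive. The product is kept general to cover both the
    bracket and the product of a vector by a matrix. *)
Lemma replica_leibniz (f : K -> K) R1 R2 R3 :
  (forall x y, f (x + y) = f x + f y) ->
  replica f T1 R1 -> replica f T2 R2 -> replica f T3 R3 ->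
  forall u v, B u v *m R3 = B (u *m R1) v + B u (v *m R2).
Proof.
move=> fD H1 H2 H3 u; apply: (gen_eig_span (A := T2)).
- by rewrite mul0mx !B0r mul0mx addr0.
- by move=> v v' E E'; rewrite mulmxDl !BDr mulmxDl E E' addrACA.
move=> b v bv; move: u; apply: (gen_eig_span (A := T1)).
- by rewrite mul0mx !B0l mul0mx addr0.
- by move=> u u' E E'; rewrite mulmxDl !BDl mulmxDl E E' addrACA.
move=> a u au; rewrite (H1 a) // (H2 b) // (H3 (a + b)); last exact: gen_eig_leibniz.
by rewrite BZl BZr fD scalerDl.
Qed.

End Leibniz.

(** * Brackets, Killing form and normalizers *)

Section Bracket.
Variables (F : fieldType) (n : nat) (c : 'I_n -> 'I_n -> 'rV[F]_n).
Local Notation br := (lie_bracket c).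
Implicit Types x y z u v : 'rV[F]_n.

Lemma brDl x y z : br (x + y) z = br x z + br y z.
Proof.
rewrite /br -big_split; apply: eq_bigr => i _; rewrite -big_split; apply: eq_bigr => j _.
by rewrite mxE mulrDl scalerDl.
Qed.

Lemma brDr x y z : br x (y + z) = br x y + br x z.
Proof.
rewrite /br -big_split; apply: eq_bigr => i _; rewrite -big_split; apply: eq_bigr => j _.
by rewrite mxE mulrDr scalerDl.
Qed.

Lemma brZl a x y : br (a *: x) y = a *: br x y.
Proof.
rewrite /br scaler_sumr; apply: eq_bigr => i _; rewrite scaler_sumr; apply: eq_bigr => j _.
by rewrite mxE scalerA mulrA.
Qed.

Lemma brZr a x y : br x (a *: y) = a *: br x y.
Proof.
rewrite /br scaler_sumr; apply: eq_bigr => i _; rewrite scaler_sumr; apply: eq_bigr => j _.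
by rewrite mxE scalerA mulrCA.
Qed.

Lemma br0l y : br 0 y = 0. Proof. by have := brZl 0 0 y; rewrite !scale0r. Qed.
Lemma br0r y : br y 0 = 0. Proof. by have := brZr 0 y 0; rewrite !scale0r. Qed.
Lemma brNl x y : br (- x) y = - br x y. Proof. by rewrite -!scaleN1r brZl. Qed.
Lemma brNr x y : br x (- y) = - br x y. Proof. by rewrite -!scaleN1r brZr. Qed.
Lemma brBl x y z : br (x - y) z = br x z - br y z. Proof. by rewrite brDl brNl. Qed.
Lemma brBr x y z : br x (y - z) = br x y - br x z. Proof. by rewrite brDr brNr. Qed.

Lemma br_sumr (I : Type) (r : seq I) (P : pred I) (f : I -> 'rV[F]_n) x :
  br x (\sum_(i <- r | P i) f i) = \sum_(i <- r | P i) br x (f i).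
Proof. by apply: (big_morph (br x)) => [y z|]; rewrite ?brDr ?br0r. Qed.

Lemma br_suml (I : Type) (r : seq I) (P : pred I) (f : I -> 'rV[F]_n) x :
  br (\sum_(i <- r | P i) f i) x = \sum_(i <- r | P i) br (f i) x.
Proof. by apply: (big_morph (br^~ x)) => [y z|]; rewrite ?brDl ?br0l. Qed.

(* Matrices act on row vectors from the right, which reverses commutators:
   see [adm_br]. *)
Definition adm x : 'M[F]_n := \matrix_(i < n) br x (delta_mx 0 i).

Lemma mul_adm v x : v *m adm x = br x v.
Proof.
rewrite [in RHS](row_sum_delta v) br_sumr mulmx_sum_row.
by apply: eq_bigr => i _; rewrite rowK brZr.
Qed.

Lemma adm_ext x (M : 'M[F]_n) : (forall v, v *m M = br x v) -> M = adm x.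
Proof. by move=> H; apply/row_matrixP => i; rewrite !rowE H mul_adm. Qed.

Lemma admD x y : adm (x + y) = adm x + adm y.
Proof. by apply/esym/adm_ext => v; rewrite mulmxDr !mul_adm brDl. Qed.

Lemma admZ a x : adm (a *: x) = a *: adm x.
Proof. by apply/esym/adm_ext => v; rewrite -scalemxAr !mul_adm brZl. Qed.

Lemma admN x : adm (- x) = - adm x.
Proof. by rewrite -!scaleN1r admZ. Qed.

Lemma admB x y : adm (x - y) = adm x - adm y.
Proof. by rewrite admD admN. Qed.

Lemma adm0 : adm 0 = 0.
Proof. by have := admZ 0 0; rewrite !scale0r. Qed.

Lemma adm_sum_delta x : adm x = \sum_i x 0 i *: adm (delta_mx 0 i).
Proof.
rewrite {1}(row_sum_delta x) (big_morph adm admD adm0).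
by apply: eq_bigr => i _; rewrite admZ.
Qed.

Lemma brmx_mem (A B : 'M[F]_n) x y :
  (x <= A)%MS -> (y <= B)%MS -> (br x y <= brmx c A B)%MS.
Proof.
move=> /submxP [a ->] /submxP [b ->].
rewrite (mulmx_sum_row a A) br_suml summx_sub // => i _.
rewrite (mulmx_sum_row b B) br_sumr summx_sub // => j _.
rewrite brZl brZr !scalemx_sub //.
apply: (@submx_trans _ _ _ _ _ _ <<br (row i A) (row j B)>>%MS); first by rewrite genmxE.
by rewrite /brmx (sumsmx_sup i) // (sumsmx_sup j).
Qed.

Lemma brmx_ind (A B : 'M[F]_n) (Q : 'rV[F]_n -> Prop) :
  Q 0 -> (forall u v, Q u -> Q v -> Q (u + v)) -> (forall a u, Q u -> Q (a *: u)) ->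
  (forall x y, (x <= A)%MS -> (y <= B)%MS -> Q (br x y)) ->
  forall z, (z <= brmx c A B)%MS -> Q z.
Proof.
move=> Q0 QD QZ Qb z /sub_sumsmxP [u ->].
apply: (big_ind Q) => // i _.
have /sub_sumsmxP [w ->] := submxMl (u i) (\sum_(j < n) <<br (row i A) (row j B)>>)%MS.
apply: (big_ind Q) => // j _.
have : (w j *m <<br (row i A) (row j B)>> <= br (row i A) (row j B))%MS.
  by rewrite (submx_trans (submxMl _ _)) // genmxE.
by case/sub_rVP => a ->; apply: QZ; apply: Qb; rewrite row_sub.
Qed.

Lemma brmx_subP (A B S : 'M[F]_n) :
  (brmx c A B <= S)%MS <-> (forall x y, (x <= A)%MS -> (y <= B)%MS -> (br x y <= S)%MS).
Proof.
split=> [H x y xA yB | H]; first exact: submx_trans (brmx_mem xA yB) H.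
apply/rV_subP; apply: brmx_ind => //.
- exact: sub0mx.
- by move=> u v; exact: addmx_sub.
- by move=> a u; exact: scalemx_sub.
Qed.

Lemma brmxS (A B A' B' : 'M[F]_n) :
  (A <= A')%MS -> (B <= B')%MS -> (brmx c A B <= brmx c A' B')%MS.
Proof.
move=> AA BB; apply/brmx_subP => x y xA yB.
by rewrite brmx_mem ?(submx_trans xA) ?(submx_trans yB).
Qed.

Definition kf x y := \tr (adm x *m adm y).

Lemma kfC x y : kf x y = kf y x. Proof. exact: mxtrace_mulC. Qed.
Lemma kfDl x y z : kf (x + y) z = kf x z + kf y z.
Proof. by rewrite /kf admD mulmxDl mxtraceD. Qed.
Lemma kfZl a x z : kf (a *: x) z = a * kf x z.
Proof. by rewrite /kf admZ -scalemxAl mxtraceZ. Qed.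
Lemma kfDr x y z : kf x (y + z) = kf x y + kf x z.
Proof. by rewrite kfC kfDl !(kfC x). Qed.
Lemma kfZr a x z : kf x (a *: z) = a * kf x z.
Proof. by rewrite kfC kfZl kfC. Qed.
Lemma kf0l x : kf 0 x = 0. Proof. by have := kfZl 0 0 x; rewrite scale0r mul0r. Qed.
Lemma kf0r x : kf x 0 = 0. Proof. by rewrite kfC kf0l. Qed.
Lemma kfNl x y : kf (- x) y = - kf x y. Proof. by rewrite -scaleN1r kfZl mulN1r. Qed.
Lemma kfNr x y : kf x (- y) = - kf x y. Proof. by rewrite kfC kfNl kfC. Qed.
Lemma kfBl x y z : kf (x - y) z = kf x z - kf y z. Proof. by rewrite kfDl kfNl. Qed.
Lemma kfBr x y z : kf z (x - y) = kf z x - kf z y. Proof. by rewrite kfDr kfNr. Qed.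

Definition kmx : 'M[F]_n := \matrix_(i, j) kf (delta_mx 0 i) (delta_mx 0 j).

Lemma kf_kmx x y : x *m kmx *m y^T = (kf x y)%:M.
Proof.
apply/rowP => i; rewrite !ord1 mxE [RHS]mxE eqxx mulr1n.
rewrite [in RHS](row_sum_delta y) (big_morph (kf x) (kfDr x) (kf0r x)).
apply: eq_bigr => j _; rewrite kfZr mxE mulrC [y^T _ _]mxE; congr (_ * _).
rewrite [in RHS](row_sum_delta x) (big_morph (kf^~ _) (fun a b => kfDl a b _) (kf0l _)).
by apply: eq_bigr => k _; rewrite kfZl mxE.
Qed.

Definition perp m (S : 'M[F]_(m, n)) : 'M[F]_n := kermx (kmx *m S^T).

Lemma perpP m (S : 'M[F]_(m, n)) x :
  reflect (forall y, (y <= S)%MS -> kf x y = 0) (x <= perp S)%MS.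
Proof.
apply: (iffP sub_kermxP) => [H y /submxP [w ->] | H].
  have := kf_kmx x (w *m S); rewrite trmx_mul !mulmxA.
  rewrite mulmxA in H; rewrite H mul0mx => /rowP /(_ 0).
  by rewrite !mxE eqxx mulr1n => <-.
apply/rowP => i; have := kf_kmx x (row i S); rewrite (H _ (row_sub _ _)).
move=> /rowP /(_ 0); rewrite mulmxA !mxE mul0rn => E.
by rewrite -[RHS]E; apply: eq_bigr => j _; rewrite !mxE.
Qed.

Lemma perpS m1 m2 (S : 'M[F]_(m1, n)) (T : 'M[F]_(m2, n)) :
  (S <= T)%MS -> (perp T <= perp S)%MS.
Proof.
move=> ST; apply/rV_subP => x /perpP H; apply/perpP => y yS.
by apply: H; exact: submx_trans yS ST.
Qed.

Lemma sub_perpK m (S : 'M[F]_(m, n)) : (S <= perp (perp S))%MS.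
Proof.
by apply/rV_subP => x xS; apply/perpP => y /perpP /(_ x xS); rewrite kfC.
Qed.

Lemma perpK m (S : 'M[F]_(m, n)) : kmx \in unitmx -> (perp (perp S) :=: S)%MS.
Proof.
move=> uK; have rk m' (T : 'M[F]_(m', n)) : \rank (perp T) = (n - \rank T)%N.
  by rewrite mxrank_ker eqmxMfull ?mxrank_tr // row_full_unit.
apply/eqmxP; rewrite sub_perpK andbT -(geq_leqif (mxrank_leqif_sup (sub_perpK S))).
by rewrite !rk subKn // rank_leq_col.
Qed.

Lemma kf_nondeg x : kmx \in unitmx -> (forall y, kf x y = 0) -> x = 0.
Proof.
move=> uK H; suff : x *m kmx = 0 by move=> E; rewrite -(mulmxK uK x) E mul0mx.
apply/rowP => i; have := kf_kmx x (delta_mx 0 i); rewrite H trmx_delta -colE.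
move=> /rowP /(_ 0) E; rewrite [RHS]mxE.
by rewrite [LHS]mxE [RHS]mxE mul0rn in E.
Qed.

Lemma kf_repr (w : 'cV[F]_n) : kmx \in unitmx -> exists d, forall v, kf d v = (v *m w) 0 0.
Proof.
move=> uK; exists (w^T *m invmx kmx) => v.
have := kf_kmx (w^T *m invmx kmx) v; rewrite mulmxKV // -trmx_mul => /rowP /(_ 0).
by rewrite mxE [RHS]mxE eqxx mulr1n.
Qed.

(** The kernel of the linear map sending [x] to [ad x] restricted to [S] and read modulo [S]; as a
    kernel it commutes with extension of scalars. *)
Definition normalizer (S : 'M[F]_n) : 'M[F]_n :=
  kermx (\matrix_(i < n) mxvec (S *m adm (delta_mx 0 i) *m cokermx S)).

Lemma normalizerP (S : 'M[F]_n) x :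
  reflect (forall y, (y <= S)%MS -> (br x y <= S)%MS) (x <= normalizer S)%MS.
Proof.
have E : x *m (\matrix_(i < n) mxvec (S *m adm (delta_mx 0 i) *m cokermx S)) =
    mxvec (S *m adm x *m cokermx S).
  rewrite mulmx_sum_row (adm_sum_delta x) mulmx_sumr mulmx_suml linear_sum.
  by apply: eq_bigr => i _; rewrite rowK -scalemxAr -scalemxAl linearZ.
have E2 : (x <= normalizer S)%MS = (S *m adm x <= S)%MS.
  rewrite (submxE (S *m adm x)); apply/idP/idP => [/sub_kermxP|/eqP H].
    by rewrite E => /(canRL mxvecK); rewrite linear0 => ->.
  by apply/sub_kermxP; rewrite E H linear0.
rewrite E2; apply: (iffP idP) => [H y /submxP [w ->]|H].
  by rewrite -mul_adm -mulmxA (submx_trans (submxMl _ _)).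
by apply/row_subP => i; rewrite row_mul mul_adm H ?row_sub.
Qed.

End Bracket.

Section LieAlgebra.
Variables (F : fieldType) (n : nat) (c : 'I_n -> 'I_n -> 'rV[F]_n).
Hypothesis Lc : is_lie c.
Local Notation br := (lie_bracket c).
Local Notation adm := (adm c).
Local Notation kf := (kf c).
Implicit Types x y z u v : 'rV[F]_n.

Lemma brxx x : br x x = 0. Proof. by case: Lc. Qed.

Lemma brC x y : br x y = - br y x.
Proof.
apply/eqP; rewrite -addr_eq0; have := brxx (x + y).
by rewrite brDl !brDr !brxx add0r addr0 => ->.
Qed.

Lemma jacobi x y z : br x (br y z) = br (br x y) z + br y (br x z).
Proof.
have [_ J] := Lc; have := J x y z; rewrite (brC z x) brNr (brC z (br x y)).
by rewrite -addrA => /eqP; rewrite addr_eq0 opprD !opprK addrC => /eqP.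
Qed.

Lemma adm_br x y : adm (br x y) = adm y *m adm x - adm x *m adm y.
Proof.
apply/esym/adm_ext => v; rewrite mulmxBr !mulmxA !mul_adm jacobi.
exact: addrK.
Qed.

Lemma kf_inv x y z : kf (br x y) z = kf x (br y z).
Proof.
rewrite /kf !adm_br mulmxBl mulmxBr !raddfB /= !mulmxA; congr (_ - _).
by rewrite [RHS]mxtrace_mulC mulmxA.
Qed.

Definition derivation (Y : 'M[F]_n) : Prop :=
  forall u v, br u v *m Y = br (u *m Y) v + br u (v *m Y).

Lemma adm_derivation x : derivation (adm x).
Proof. by move=> u v; rewrite !mul_adm jacobi. Qed.

Lemma derivation_adm Y v : derivation Y -> adm v *m Y = adm (v *m Y) + Y *m adm v.
Proof.
move=> dY; apply/row_matrixP => i; rewrite !rowE mulmxDr !mulmxA !mul_adm dY //.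
Qed.

(** [d] represents the functional [v |-> tr (Y ad v)] under the Killing form; invariance shows that
    [v Y - [d, v]] is orthogonal to every [w]. *)
Lemma derivation_inner Y : kmx c \in unitmx -> derivation Y -> exists d, adm d = Y.
Proof.
move=> uK dY.
have [d Hd] := kf_repr (\col_i \tr (Y *m adm (delta_mx 0 i))) uK.
have {}Hd v : kf d v = \tr (Y *m adm v).
  rewrite Hd (adm_sum_delta _ v) mulmx_sumr raddf_sum mxE.
  by apply: eq_bigr => i _; rewrite mxE -scalemxAr /= mxtraceZ.
exists d; apply/esym/adm_ext => v; apply/eqP; rewrite -subr_eq0; apply/eqP.
apply: (kf_nondeg uK) => w; rewrite kfBl kf_inv Hd /kf adm_br.
have -> : adm (v *m Y) = adm v *m Y - Y *m adm v.
  by apply/eqP; rewrite eq_sym subr_eq -derivation_adm.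
rewrite mulmxBl mulmxBr !raddfB /= opprK.
have -> : \tr (Y *m (adm w *m adm v)) = \tr (adm v *m Y *m adm w).
  by rewrite mulmxA mxtrace_mulC mulmxA.
by rewrite mulmxA addrACA subrr addNr addr0.
Qed.

Lemma normalizer_subalg S : subalg c (normalizer c S).
Proof.
move=> x y /normalizerP Nx /normalizerP Ny; apply/normalizerP => z zS.
have -> : br (br x y) z = br x (br y z) - br y (br x z) by rewrite [br x (br y z)]jacobi addrK.
by rewrite addmx_sub ?eqmx_opp ?(Nx _ (Ny _ zS)) ?(Ny _ (Nx _ zS)).
Qed.

Lemma sub_normalizer S : subalg c S -> (S <= normalizer c S)%MS.
Proof.
by move=> sS; apply/rV_subP => x xS; apply/normalizerP => y yS; exact: sS.
Qed.

Lemma perp_stable (S : 'M[F]_n) x y :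
  (x <= normalizer c S)%MS -> (y <= perp c S)%MS -> (br x y <= perp c S)%MS.
Proof.
move=> /normalizerP Nx /perpP py; apply/perpP => z zS.
by rewrite brC kfNl kf_inv py ?Nx ?oppr0.
Qed.

End LieAlgebra.

(** * Extension of scalars *)

Section Extension.
Variables (F : fieldType) (K : closedFieldType) (iota : {rmorphism F -> K}) (n : nat).
Variable c : 'I_n -> 'I_n -> 'rV[F]_n.
Local Notation cK := (ext_consts iota c).
Local Notation "A ^f" := (map_mx iota A) : ring_scope.

Lemma map_br x y : (lie_bracket c x y)^f = lie_bracket cK x^f y^f.
Proof.
rewrite /lie_bracket map_mx_sum; apply: eq_bigr => i _.
rewrite map_mx_sum; apply: eq_bigr => j _.
by rewrite map_mxZ rmorphM !mxE.
Qed.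

Lemma map_adm x : (adm c x)^f = adm cK x^f.
Proof.
by apply/row_matrixP => i; rewrite -map_row !rowK map_br map_delta_mx.
Qed.

Lemma map_kf x y : iota (kf c x y) = kf cK x^f y^f.
Proof. by rewrite /kf -trace_map_mx map_mxM !map_adm. Qed.

Lemma map_kmx : (kmx c)^f = kmx cK.
Proof. by apply/matrixP => i j; rewrite !mxE map_kf !map_delta_mx. Qed.

Lemma map_perp m (S : 'M[F]_(m, n)) : (perp c S)^f = perp cK S^f.
Proof. by rewrite /perp map_kermx map_mxM map_kmx map_trmx. Qed.

Lemma map_normalizer (S : 'M[F]_n) : (normalizer c S)^f = normalizer cK S^f.
Proof.
rewrite /normalizer map_kermx; congr (kermx _); apply/row_matrixP => i.
by rewrite -map_row !rowK map_mxvec -map_cokermx 2!map_mxM map_adm map_delta_mx.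
Qed.

Lemma linear_delta0 m (phi : 'rV[K]_n -> 'rV[K]_m) :
  (forall u v, phi (u + v) = phi u + phi v) -> (forall a u, phi (a *: u) = a *: phi u) ->
  (forall i, phi (delta_mx 0 i) = 0) -> forall u, phi u = 0.
Proof.
move=> phiD phiZ phi0 u.
have p0 : phi 0 = 0 by have := phiZ 0 0; rewrite !scale0r.
rewrite (row_sum_delta u) (big_morph phi phiD p0) big1 // => i _.
by rewrite phiZ phi0 scaler0.
Qed.

Let addr3 (V : zmodType) (a1 a2 a3 b1 b2 b3 : V) :
  a1 + b1 + (a2 + b2) + (a3 + b3) = a1 + a2 + a3 + (b1 + b2 + b3).
Proof. by rewrite (addrACA a1 b1) (addrACA (a1 + a2)). Qed.

(** Multilinear identities are checked on basis vectors, which come from [F]. The rule [[x, x] = 0]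
    is not linear in [x], so it is deduced from antisymmetry by dividing by 2. *)
Lemma ext_lie : [pchar F] =i pred0 -> is_lie c -> is_lie cK.
Proof.
move=> cF Lc; have e_map i : delta_mx 0 i = (delta_mx 0 i : 'rV[F]_n)^f by rewrite map_delta_mx.
have bC u v : lie_bracket cK u v + lie_bracket cK v u = 0.
  move: u; apply: linear_delta0 => [u u'|a u|i].
  - by rewrite brDl brDr addrACA.
  - by rewrite brZl brZr scalerDr.
  move: v; apply: linear_delta0 => [u u'|a u|j].
  - by rewrite brDl brDr addrACA.
  - by rewrite brZl brZr scalerDr.
  by rewrite !e_map -!map_br (brC Lc) -map_mxD addNr map_mx0.
split=> [x | x y z].
  have := bC x x; rewrite -mulr2n -scaler_nat => /eqP; rewrite scaler_eq0.
  have /pcharf0P -> : [pchar K] =i pred0 by move=> p; rewrite (fmorph_pchar iota) cF.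
  by move/eqP.
move: x; apply: linear_delta0 => [u u'|a u|i].
- by rewrite !(brDl, brDr) addr3.
- by rewrite !(brZl, brZr) !scalerDr.
move: y; apply: linear_delta0 => [u u'|a u|j].
- by rewrite !(brDl, brDr) addr3.
- by rewrite !(brZl, brZr) !scalerDr.
move: z; apply: linear_delta0 => [u u'|a u|k].
- by rewrite !(brDl, brDr) addr3.
- by rewrite !(brZl, brZr) !scalerDr.
have [_ J] := Lc.
by rewrite !e_map -!map_br -!map_mxD J map_mx0.
Qed.

End Extension.

Lemma map_mx_exp (R S : nzRingType) (f : {rmorphism R -> S}) n (A : 'M[R]_n) k :
  map_mx f (A ^+ k) = map_mx f A ^+ k.
Proof.
by elim: k => [|k IH]; rewrite ?expr0 ?map_mx1 // !exprS -!mulmxE map_mxM IH.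
Qed.

Definition ad_nilpotent (F : fieldType) n (c : 'I_n -> 'I_n -> 'rV[F]_n) (x : 'rV[F]_n) : Prop :=
  exists k, adm c x ^+ k = 0.

Section Replica.
Variables (F : fieldType) (K : closedFieldType) (iota : {rmorphism F -> K}) (n : nat).
Variable c : 'I_n -> 'I_n -> 'rV[F]_n.
Hypothesis charF : [pchar F] =i pred0.
Hypothesis Lc : is_lie c.
Local Notation cK := (ext_consts iota c).
Local Notation "A ^f" := (map_mx iota A) : ring_scope.

Lemma pchar_ext : [pchar K] =i pred0.
Proof. by move=> p; rewrite (fmorph_pchar iota) charF. Qed.

Lemma replica_derivation (f : K -> K) x R :
  (forall a b, f (a + b) = f a + f b) -> replica f (adm cK x) R -> derivation cK R.
Proof.
move=> fD HR u v; have LK := ext_lie iota charF Lc.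
apply: (replica_leibniz (T1 := adm cK x) (T2 := adm cK x) (T3 := adm cK x)
   (B := lie_bracket cK) _ _ _ _ _ fD HR HR HR).
- by move=> *; rewrite brDl.
- by move=> *; rewrite brDr.
- by move=> *; rewrite brZl.
- by move=> *; rewrite brZr.
- exact: adm_derivation.
Qed.

Lemma map_ad_nilpotent x : ad_nilpotent cK x^f -> ad_nilpotent c x.
Proof.
move=> [k]; rewrite -map_adm -map_mx_exp => /eqP; rewrite map_mx_eq0 => /eqP H.
by exists k.
Qed.

(* If [Y] is a replica of [ad x] and [x] is a sum of brackets [y, a], then
   [tr (ad x Y)] is the sum of the [- kf y (a Y)], and [a Y] lies in [N]. *)
Lemma commutator_nilpotent (s A N : 'M[F]_n) x k :
  (x <= brmx c s A)%MS ->
  (forall v, (v <= N)%MS -> (lie_bracket c x v <= N)%MS) ->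
  (A *m adm c x ^+ k <= N)%MS ->
  (forall y v, (y <= s)%MS -> (v <= N)%MS -> kf c y v = 0) ->
  ad_nilpotent c x.
Proof.
move=> xsA xN AN sN; apply: map_ad_nilpotent; exists n.
have LK := ext_lie iota charF Lc.
(* The factor ['X] makes 0 a root of [P]. As [f 0 = 0], a high power of ['X] divides [p], so [Y]
   begins with the [k] applications of [ad x] that carry [A] into [N]. *)
set X := adm cK x^f; pose P := 'X * char_poly X.
have P0 : P != 0 by rewrite mulf_neq0 ?polyX_eq0 // monic_neq0 // char_poly_monic.
have PX : polymx X P = 0 by rewrite polymxM polymx_char mulmx0.
apply: (replica_nilpotent (m := (size P + k)%N) pchar_ext PX) => // f fD p Hp.
have f0 : f 0 = 0 by apply: (@addIr _ (f 0)); rewrite -fD !add0r.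
have dY : derivation cK (polymx X p).
  by apply: replica_derivation fD (replica_polymx P0 PX _ Hp); rewrite ltnW // ltnS leq_addr.
have [q Ep] : exists q, p = 'X^k * q.
  have : root P 0 by rewrite rootM rootX eqxx.
  move=> /Hp; rewrite f0 polyC0 !subr0 => /dvdpP [q ->].
  exists (q * ('X ^+ (size P).+1)); rewrite -addSn exprD. exact: etrans (mulrA _ _ _) (mulrC _ _).
set Y := polymx X p in dY *.
suff : forall z, (z <= brmx c s A)%MS -> \tr (adm cK z^f *m Y) = 0 by move=> /(_ x xsA).
apply: brmx_ind.
- by rewrite map_mx0 adm0 mul0mx mxtrace0.
- by move=> u v Hu Hv; rewrite map_mxD admD mulmxDl mxtraceD Hu Hv addr0.
- by move=> a u Hu; rewrite map_mxZ admZ -scalemxAl mxtraceZ Hu mulr0.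
move=> y a ys aA; rewrite map_br (adm_br LK) mulmxBl.
rewrite raddfB /= -!mulmxA (derivation_adm a^f dY) mulmxDr mxtraceD.
rewrite (mxtrace_mulC (adm cK a^f)) mulmxA opprD addrCA subrr addr0.
apply/eqP; rewrite oppr_eq0; apply/eqP; change (kf cK y^f (a^f *m Y) = 0).
rewrite kfC; have aN : (a^f *m Y <= N^f)%MS.
  rewrite /Y Ep polymxM polymxXn polymxX mulmxA.
  have : (a^f *m X ^+ k <= N^f)%MS.
    rewrite /X -map_adm -map_mx_exp -map_mxM map_submx (submx_trans _ AN) //.
    by rewrite submxMr.
  move/submxP => [w ->]; rewrite -mulmxA.
  have : stablemx N^f X.
    rewrite /X -map_adm -map_mxM map_submx.
    by apply/row_subP => i; rewrite row_mul mul_adm xN ?row_sub.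
  by move=> /(polymx_stable q) st; rewrite (submx_trans (submxMl _ _)).
have : (y^f <= perp cK N^f)%MS.
  by rewrite -map_perp map_submx; apply/perpP => v vN; exact: sN.
by move/perpP => H; rewrite kfC; exact: H.
Qed.

End Replica.

Lemma ex_max_rank (F : fieldType) m n (Q : 'M[F]_(m, n) -> Prop) A :
  Q A -> exists2 B, Q B & forall C, Q C -> (\rank C <= \rank B)%N.
Proof.
move=> QA; have [k] := ubnP (n - \rank A); elim: k A QA => // k IH A QA.
rewrite ltnS => kA; have [H|H] := pselect (exists2 C, Q C & (\rank A < \rank C)%N).
  have [C QC AC] := H; apply: (IH C QC); apply: leq_trans kA.
  by rewrite ltn_sub2l // (leq_trans AC) // rank_leq_col.
exists A => // C QC; rewrite leqNgt; apply/negP => AC; apply: H; by exists C.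
Qed.

Lemma ex_min_rank (F : fieldType) m n (Q : 'M[F]_(m, n) -> Prop) A :
  Q A -> exists2 B, Q B & forall C, Q C -> (\rank B <= \rank C)%N.
Proof.
move=> QA; have [k] := ubnP (\rank A); elim: k A QA => // k IH A QA.
rewrite ltnS => kA; have [H|H] := pselect (exists2 C, Q C & (\rank C < \rank A)%N).
  by have [C QC AC] := H; apply: (IH C QC); apply: leq_trans kA.
exists A => // C QC; rewrite leqNgt; apply/negP => AC; apply: H; by exists C.
Qed.

Lemma rank_sub_eq (F : fieldType) m1 m2 n (A : 'M[F]_(m1, n)) (B : 'M[F]_(m2, n)) :
  (A <= B)%MS -> (\rank B <= \rank A)%N -> (B <= A)%MS.
Proof. by move=> AB; rewrite (geq_leqif (mxrank_leqif_sup AB)). Qed.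

Lemma not_sub_rV (F : fieldType) m1 m2 n (A : 'M[F]_(m1, n)) (B : 'M[F]_(m2, n)) :
  ~ (A <= B)%MS -> exists2 v : 'rV_n, (v <= A)%MS & ~ (v <= B)%MS.
Proof.
move=> H; apply: contrapT => H2; apply: H; apply/rV_subP => v vA.
by apply: contrapT => vB; apply: H2; exists v.
Qed.

(** * Nil subalgebras and the orthogonal of a normalizer *)

Section Engel.
Variables (F : fieldType) (n : nat) (c : 'I_n -> 'I_n -> 'rV[F]_n).
Hypothesis Lc : is_lie c.
Local Notation br := (lie_bracket c).
Implicit Types (U V W H : 'M[F]_n) (x y v : 'rV[F]_n).

Definition stable U V : Prop :=
  forall x v, (x <= U)%MS -> (v <= V)%MS -> (br x v <= V)%MS.

Lemma stable_normalizer U V : stable U V <-> (U <= normalizer c V)%MS.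
Proof.
split=> [H|H x v xU vV]; last by have /normalizerP := submx_trans xU H; apply.
by apply/rV_subP => x xU; apply/normalizerP => v; exact: H.
Qed.

Lemma stableS U U' V : (U <= U')%MS -> stable U' V -> stable U V.
Proof. by move=> UU H x v xU; apply: H; exact: submx_trans xU UU. Qed.

(** The conclusion of Engel's theorem for every subquotient [V / W] of the adjoint module, phrased
    without quotient spaces. *)
Definition engel U : Prop :=
  forall W V, stable U W -> stable U V -> (W <= V)%MS -> ~ (V <= W)%MS ->
  exists v, [/\ (v <= V)%MS, ~ (v <= W)%MS & forall x, (x <= U)%MS -> (br x v <= W)%MS].

Definition nil_sub U : Prop :=
  subalg c U /\ forall x, (x <= U)%MS -> ad_nilpotent c x.

Lemma addsmx_rVP U (x w : 'rV[F]_n) :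
  (w <= U + x)%MS <-> exists u a, (u <= U)%MS /\ w = u + a *: x.
Proof.
split=> [/sub_addsmxP [[u1 u2] /= ->]|[u [a [uU ->]]]].
  exists (u1 *m U), (u2 0 0); rewrite submxMl; split=> //.
  by rewrite {1}(mx11_scalar u2) mul_scalar_mx.
by rewrite addmx_sub ?scalemx_sub ?(submx_trans uU (addsmxSl _ _)) ?addsmxSr.
Qed.

Lemma subalg_add_normalizing H x :
  subalg c H -> (x <= normalizer c H)%MS -> subalg c (H + x)%MS.
Proof.
move=> sH /normalizerP xN _ _ /addsmx_rVP [u [a [uH ->]]] /addsmx_rVP [w [b [wH ->]]].
rewrite brDl !brDr !brZl !brZr (brxx Lc) !scaler0 addr0 (brC Lc u x) scalerN.
have HS := addsmxSl H x.
by rewrite !addmx_sub ?eqmx_opp ?scalemx_sub ?(submx_trans _ HS) ?xN ?sH.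
Qed.

(** Since [x] normalizes [H], the iterates under [ad x] of a vector that [H] sends into [W] are
    again sent into [W]; the last iterate outside [W] is the one wanted. *)
Lemma engel_step H x :
  engel H -> ad_nilpotent c x -> (x <= normalizer c H)%MS -> engel (H + x)%MS.
Proof.
move=> eH [k Xk] /normalizerP xN W V sW sV WV nVW.
have HS := addsmxSl H x; have xS := addsmxSr H x.
have [v [vV vW Hv]] := eH W V (stableS HS sW) (stableS HS sV) WV nVW.
pose w j := v *m adm c x ^+ j.
have wS j : w j.+1 = br x (w j) by rewrite /w exprSr -mulmxE mulmxA mul_adm.
have wV j : (w j <= V)%MS.
  by elim: j => [|j IH]; rewrite ?wS ?sV // /w expr0 mulmx1.
have wH j h : (h <= H)%MS -> (br h (w j) <= W)%MS.
  elim: j h => [|j IH] h hH; first by rewrite /w expr0 mulmx1 Hv.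
  have hx : (br h x <= H)%MS by rewrite (brC Lc) eqmx_opp xN.
  by rewrite wS (jacobi Lc) addmx_sub ?(IH _ hx) ?(sW _ _ xS (IH _ hH)).
have exj : exists j, (w j <= W)%MS by exists k; rewrite /w Xk mulmx0 sub0mx.
case: (ex_minnP exj) => [[|j]] wj jmin.
  by case: vW; move: wj; rewrite /w expr0 mulmx1.
exists (w j); split=> //.
  by move=> /jmin; rewrite ltnn.
move=> _ /addsmx_rVP [u [a [uH ->]]]; rewrite brDl brZl -wS.
by rewrite addmx_sub ?scalemx_sub ?wH.
Qed.

(** For a largest subalgebra [H] of [U] with the property, the property applied to the pair [H], [U]
    yields [x] outside [H] normalizing [H], so [H] could be enlarged. *)
Lemma engel_of_nil U : nil_sub U -> engel U.
Proof.
move=> [sU nU].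
have [|H [[sH eH] HU] Hmax] := @ex_max_rank _ _ _
    (fun H => (subalg c H /\ engel H) /\ (H <= U)%MS) 0.
  split; last exact: sub0mx.
  split=> [x y|W V _ _ _ /not_sub_rV [v vV vW]].
    by rewrite !submx0 => /eqP -> _; rewrite br0l.
  by exists v; split=> // x; rewrite submx0 => /eqP ->; rewrite br0l sub0mx.
have [UH|nUH] := pselect (U <= H)%MS.
  move=> W V sW sV WV nVW; have [v [vV vW Hv]] := eH W V (stableS HU sW) (stableS HU sV) WV nVW.
  by exists v; split=> // x xU; apply: Hv; exact: submx_trans xU UH.
have [x [xU xH Hx]] := eH H U sH (fun x y xH => sU x y (submx_trans xH HU)) HU nUH.
have xN : (x <= normalizer c H)%MS.
  by apply/normalizerP => y yH; rewrite (brC Lc) eqmx_opp Hx.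
case: xH; have HS := addsmxSl H x.
apply: (submx_trans (addsmxSr H x)); apply: (rank_sub_eq HS); apply: Hmax.
split; last by rewrite addsmx_sub HU xU.
by split; [exact: subalg_add_normalizing | apply: engel_step => //; exact: nU].
Qed.

Lemma engel_chain U V : engel U -> stable U V ->
  exists m, (iter m (brmx c U) V <= (0 : 'M[F]_n))%MS.
Proof.
move=> eU sV.
have it0 m : (iter m (brmx c U) 0 <= (0 : 'M[F]_n))%MS.
  elim: m => [|m IH]; first exact: submx_refl.
  apply/brmx_subP => x y _ y0; have := submx_trans y0 IH.
  by rewrite submx0 => /eqP ->; rewrite br0r sub0mx.
have itS m A B : (A <= B)%MS -> (iter m (brmx c U) A <= iter m (brmx c U) B)%MS.
  by move=> AB; elim: m => //= m IH; exact: brmxS.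
have [|W [[sW WV] [m Wm]] Wmax] := @ex_max_rank _ _ _
    (fun W => (stable U W /\ (W <= V)%MS) /\ exists m, (iter m (brmx c U) W <= (0 : 'M[F]_n))%MS) 0.
  split; last by exists 0%N.
  split; last exact: sub0mx.
  by move=> x v _; rewrite submx0 => /eqP ->; rewrite br0r sub0mx.
have [VW|nVW] := pselect (V <= W)%MS.
  by exists m; apply: submx_trans (itS _ _ _ VW) Wm.
have [v [vV vW Hv]] := eU W V sW sV WV nVW.
have bW : forall x w, (x <= U)%MS -> (w <= W + v)%MS -> (br x w <= W)%MS.
  move=> x _ xU /addsmx_rVP [u [a [uW ->]]].
  by rewrite brDr brZr addmx_sub ?scalemx_sub ?Hv ?sW.
case: vW; apply: (submx_trans (addsmxSr W v)).
apply: (rank_sub_eq (addsmxSl W v)); apply: Wmax; split.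
  split; last by rewrite addsmx_sub WV vV.
  by move=> x w xU wW; apply: submx_trans (bW _ _ xU wW) (addsmxSl _ _).
exists m.+1; rewrite iterSr; apply: submx_trans (itS _ _ _ _) Wm.
by apply/brmx_subP.
Qed.

Lemma nil_of_chain U x m :
  (iter m (brmx c U) 1%:M <= (0 : 'M[F]_n))%MS -> (x <= U)%MS -> ad_nilpotent c x.
Proof.
move=> Hm xU; exists m; apply/eqP; rewrite -submx0; apply: submx_trans Hm.
elim: m => [|m IH] /=; first by rewrite expr0.
rewrite exprSr -mulmxE; apply/row_subP => i; rewrite row_mul mul_adm brmx_mem //.
by rewrite (submx_trans (row_sub _ _)).
Qed.

(** This is how sums such as [N + x] are seen to be nil: nilpotency passes through the Engel
    condition, not through the summands. *)
Lemma nil_of_engel U x : engel U -> (x <= U)%MS -> ad_nilpotent c x.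
Proof.
move=> eU; have [|m Hm] := @engel_chain U 1%:M eU; first by move=> *; exact: submx1.
exact: nil_of_chain Hm.
Qed.

End Engel.

Lemma nilpotent_trace_closed (K : closedFieldType) n (A : 'M[K]_n) k : A ^+ k = 0 -> \tr A = 0.
Proof.
move=> Ak; have [rs [rsr rst _]] := trace_polymx A.
rewrite -{1}(polymxX A) rst big_seq big1 // => r /rsr rr; rewrite hornerX.
have : root ('X^k) r by apply: root_char_annul rr; rewrite polymxXn polymxX.
by rewrite rootE hornerXn expf_eq0 => /andP [_ /eqP].
Qed.

Section PerpNormalizer.
Variables (F : fieldType) (K : closedFieldType) (iota : {rmorphism F -> K}) (n : nat).
Variable c : 'I_n -> 'I_n -> 'rV[F]_n.
Hypothesis charF : [pchar F] =i pred0.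
Hypothesis Lc : is_lie c.
Local Notation cK := (ext_consts iota c).
Local Notation "A ^f" := (map_mx iota A) : ring_scope.
Local Notation br := (lie_bracket c).

Lemma nilpotent_trace m (A : 'M[F]_m) k : A ^+ k = 0 -> \tr A = 0.
Proof.
move=> Ak; apply: (fmorph_inj iota); rewrite -trace_map_mx rmorph0.
by apply: (nilpotent_trace_closed (k := k)); rewrite -map_mx_exp Ak map_mx0.
Qed.

(** For [x] in [U] and [y] in the normalizer, [ad x] goes one step down the chain [L], [[U, L]],
    [[U, [U, L]]], ... while [ad y] preserves each term. Their product is nilpotent, hence of trace
    zero. *)
Lemma engel_perp_normalizer U : engel c U -> (U <= perp c (normalizer c U))%MS.
Proof.
move=> eU; apply/rV_subP => x xU; apply/perpP => y yN.
have [|m Hm] := @engel_chain _ _ c U 1%:M eU; first by move=> *; exact: submx1.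
apply: (nilpotent_trace (k := m)); apply/eqP; rewrite -submx0; apply: submx_trans Hm.
have yst j : stablemx (iter j (brmx c U) 1%:M) (adm c y).
  elim: j => [|j IH] /=; first exact: submx1.
  apply/row_subP => i; rewrite row_mul mul_adm.
  have := row_sub i (brmx c U (iter j (brmx c U) 1%:M)); move: (row i _).
  apply: brmx_ind.
  - by rewrite br0r sub0mx.
  - by move=> u v Hu Hv; rewrite brDr addmx_sub.
  - by move=> a u Hu; rewrite brZr scalemx_sub.
  move=> u v uU vZ; rewrite (jacobi Lc) addmx_sub ?brmx_mem //.
    by move/normalizerP: yN; apply.
  by rewrite -mul_adm (submx_trans (submxMr _ vZ)).
elim: m => [|m IH] /=; first by rewrite expr0.
rewrite exprSr -mulmxE mulmxA; apply: submx_trans (yst m.+1); apply: submxMr.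
by apply/row_subP => i; rewrite row_mul mul_adm brmx_mem // (submx_trans (row_sub _ _)).
Qed.

(* The [f]-replicas of [ad x] are inner, come from [normalizer c U], and are
   therefore orthogonal to [x]. *)
Lemma normalizer_radical_nilpotent U x : kmx c \in unitmx ->
  (x <= normalizer c U)%MS -> (x <= perp c (normalizer c U))%MS -> ad_nilpotent c x.
Proof.
move=> uK xN xP; apply: (map_ad_nilpotent (iota := iota)); exists n.
have LK := ext_lie iota charF Lc.
set X := adm cK x^f; pose P := 'X * char_poly X.
have P0 : P != 0 by rewrite mulf_neq0 ?polyX_eq0 // monic_neq0 // char_poly_monic.
have PX : polymx X P = 0 by rewrite polymxM polymx_char mulmx0.
apply: (replica_nilpotent (m := size P) (pchar_ext iota charF) PX) => // f fD p Hp.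
have dY : derivation cK (polymx X p).
  by apply: replica_derivation fD (replica_polymx P0 PX _ Hp).
have uKK : kmx cK \in unitmx by rewrite -map_kmx map_unitmx.
have [d Ed] := derivation_inner LK uKK dY.
rewrite -Ed; change (kf cK x^f d = 0).
have dN : (d <= (normalizer c U)^f)%MS.
  rewrite map_normalizer; apply/normalizerP => v vU; rewrite -mul_adm Ed.
  have st : stablemx U^f X.
    rewrite /X -map_adm -map_mxM map_submx; apply/row_subP => i.
    by rewrite row_mul mul_adm; move/normalizerP: xN; apply; exact: row_sub.
  by rewrite (submx_trans (submxMr _ vU)) // polymx_stable.
have : (x^f <= perp cK (normalizer c U)^f)%MS by rewrite -map_perp map_submx.
by move/perpP; apply.
Qed.

(** Maximality is asked only against nil [R] normalized by the normalizer of [U]. The result then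
    serves maximal nil subalgebras, and also those maximal among the nil subalgebras normalized by a
    Borel subalgebra or by a given [B]. *)
Theorem perp_normalizer U : kmx c \in unitmx -> nil_sub c U ->
  (forall R, nil_sub c R -> (U <= R)%MS -> (normalizer c U <= normalizer c R)%MS -> (R <= U)%MS) ->
  (perp c (normalizer c U) :=: U)%MS.
Proof.
move=> uK nU Umax; have eU := engel_of_nil Lc nU; have [sU _] := nU.
set q := normalizer c U; have Uq : (U <= q)%MS by exact: sub_normalizer.
have sq : subalg c q by exact: normalizer_subalg.
have Up := engel_perp_normalizer eU.
have qN : (q <= normalizer c (perp c q))%MS.
  apply/rV_subP => x xq; apply/normalizerP => y yp; apply: (perp_stable Lc _ yp).
  by apply: submx_trans xq _; exact: sub_normalizer.
have stR x y : (x <= q)%MS -> (y <= q :&: perp c q)%MS -> (br x y <= q :&: perp c q)%MS.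
  move=> xq; rewrite !sub_capmx => /andP [yq yp]; rewrite sq //=.
  by have /normalizerP := submx_trans xq qN; apply.
(* The radical of the Killing form on [q] is a nil ideal of [q] containing [U], hence an admissible
   [R]. *)
have RU : (q :&: perp c q <= U)%MS.
  apply: Umax; last first.
  - by apply/rV_subP => x xq; apply/normalizerP => y; exact: stR.
  - by rewrite sub_capmx Uq Up.
  split=> [x y|x]; rewrite sub_capmx => /andP [xq xp]; first exact: stR.
  exact: normalizer_radical_nilpotent xq xp.
apply/eqmxP; rewrite Up andbT; apply: contrapT => nPU.
have stP : stable c U (perp c q).
  by move=> x y xU; have /normalizerP := submx_trans (submx_trans xU Uq) qN; apply.
(* [U] sends [v] into [U], so [v] normalizes [U] and falls into the radical just bounded. *)
have [v [vP vU Hv]] := eU U (perp c q) sU stP Up nPU.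
apply: vU; apply: submx_trans RU; rewrite sub_capmx vP andbT.
by apply/normalizerP => y yU; rewrite (brC Lc) eqmx_opp Hv.
Qed.

End PerpNormalizer.

(** * Cartan's criterion *)

Section CartanCriterion.
Variables (F : fieldType) (K : closedFieldType) (iota : {rmorphism F -> K}) (n : nat).
Variable c : 'I_n -> 'I_n -> 'rV[F]_n.
Hypothesis charF : [pchar F] =i pred0.
Hypothesis Lc : is_lie c.
Local Notation br := (lie_bracket c).
Local Notation der := (fun I => brmx c I I).

Lemma nil_sub_nilpotent U : nil_sub c U -> exists m, (iter m (brmx c U) U <= (0 : 'M[F]_n))%MS.
Proof.
move=> nU; apply: engel_chain; first exact: engel_of_nil.
by move=> x y xU yU; case: nU => sU _; exact: sU.
Qed.

Lemma subalgP U : subalg c U <-> (brmx c U U <= U)%MS.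
Proof. by split=> [sU|/brmx_subP sU]; [apply/brmx_subP | move=> x y; exact: sU]. Qed.

Lemma iter_der_sub U k : subalg c U -> (iter k der U <= U)%MS.
Proof.
move=> /subalgP sU; elim: k => //= k IH; apply: submx_trans sU; exact: brmxS.
Qed.

Lemma iter_der_central U k : subalg c U -> (iter k der U <= iter k (brmx c U) U)%MS.
Proof.
move=> sU; elim: k => //= k IH; apply: brmxS => //; exact: iter_der_sub.
Qed.

Lemma solvable_subP U : solvable_sub c U <-> exists m, (iter m der U <= (0 : 'M[F]_n))%MS.
Proof. by split=> [[m Hm]|[m Hm]]; exists m; move: Hm; rewrite submx0 mxrank_eq0. Qed.

Lemma nil_sub_solvable U : nil_sub c U -> solvable_sub c U.
Proof.
move=> nU; have [m Hm] := nil_sub_nilpotent nU; apply/solvable_subP; exists m.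
by apply: submx_trans Hm; apply: iter_der_central; case: nU.
Qed.

(** The radical [J] of the Killing form is an ideal, and the trace argument with [J] in all three
    roles makes [[J, J]] nil. So [J] is solvable. *)
Theorem killing_nondegenerate : semisimple c -> kmx c \in unitmx.
Proof.
move=> ss; pose J := perp c (1%:M : 'M[F]_n).
have Jst x y : (y <= J)%MS -> (br x y <= J)%MS.
  move=> yJ; apply: perp_stable => //; apply/normalizerP => z _; exact: submx1.
have sJ : subalg c J by move=> x y _; exact: Jst.
have nJJ : nil_sub c (brmx c J J).
  split=> [x y xJ yJ|x xJ].
    by apply: brmx_mem; [apply: submx_trans xJ _ | apply: submx_trans yJ _]; apply/subalgP.
  apply: (commutator_nilpotent iota (k := 0) (N := J) charF Lc xJ) => [v||].
  - exact: Jst.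
  - by rewrite expr0 mulmx1.
  - by move=> y v /perpP yJ _; apply: yJ; exact: submx1.
have : \rank J == 0%N.
  apply: ss; first by split; [exact: submx1 | move=> x y _; exact: Jst].
  have /solvable_subP [m Hm] := nil_sub_solvable nJJ.
  by apply/solvable_subP; exists m.+1; rewrite iterSr.
rewrite mxrank_eq0 => /eqP J0.
by rewrite -row_free_unit -kermx_eq0 -J0 /J /perp trmx1 mulmx1.
Qed.

End CartanCriterion.

(** * Borel subalgebras *)

(** Apply the linear factors of the characteristic polynomial to a vector one at a time: the product
    ends in [W], and the last value outside [W] is an eigenvector modulo [W]. *)
Lemma relative_eigenvector (K : closedFieldType) n (A W V : 'M[K]_n) :
  stablemx V A -> ~ (V <= W)%MS ->
  exists a (v : 'rV_n), [/\ (v <= V)%MS, ~ (v <= W)%MS & (v *m (A - a%:M) <= W)%MS].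
Proof.
move=> sV /not_sub_rV [v vV vW].
have [rs Ers] := closed_field_poly_normal (char_poly A).
have lc : lead_coef (char_poly A) = 1 by apply/eqP; exact: char_poly_monic.
have : (v *m polymx A (\prod_(r <- rs) ('X - r%:P)) <= W)%MS.
  by rewrite -[\prod_(_ <- _) _]scale1r -lc -Ers polymx_char mulmx0 sub0mx.
elim: rs v vV vW {Ers} => [|r rs IH] v vV vW.
  by rewrite big_nil (polymxC A 1) mulmx1 => /vW.
rewrite big_cons polymxM mulmxA polymxB polymxX polymxC => H.
have [H2|H2] := pselect (v *m (A - r%:M) <= W)%MS; first by exists r, v.
apply: (IH (v *m (A - r%:M))) => //.
by rewrite (submx_trans (submxMr _ vV)) // stablemxD ?stablemxN ?stablemxC.
Qed.

Section Solvable.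
Variables (F : fieldType) (n : nat) (c : 'I_n -> 'I_n -> 'rV[F]_n).
Hypothesis Lc : is_lie c.
Local Notation br := (lie_bracket c).
Local Notation der := (fun I => brmx c I I).

Lemma iter_derS k A B : (A <= B)%MS -> (iter k der A <= iter k der B)%MS.
Proof. by move=> AB; elim: k => //= k IH; exact: brmxS. Qed.

Lemma solvable_of_der k A : solvable_sub c (iter k der A) -> solvable_sub c A.
Proof.
move=> /solvable_subP [m Hm]; apply/solvable_subP; exists (m + k)%N.
by rewrite iterD.
Qed.

Lemma solvable_subS A B : (A <= B)%MS -> solvable_sub c B -> solvable_sub c A.
Proof.
move=> AB /solvable_subP [m Hm]; apply/solvable_subP; exists m.
exact: submx_trans (iter_derS _ AB) Hm.
Qed.

Lemma iter_der_ideal b k x y : subalg c b ->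
  (x <= b)%MS -> (y <= iter k der b)%MS -> (br x y <= iter k der b)%MS.
Proof.
move=> sb xb; elim: k y => [|k IH] y /=; first exact: sb.
move: y; apply: brmx_ind.
- by rewrite br0r sub0mx.
- by move=> u v Hu Hv; rewrite brDr addmx_sub.
- by move=> a u Hu; rewrite brZr scalemx_sub.
by move=> u v ub vb; rewrite (jacobi Lc) addmx_sub ?brmx_mem ?IH.
Qed.

Lemma stable_brmx_add b N : stable c b N -> subalg c N -> forall A, (A <= b)%MS ->
  (brmx c (A + N)%MS (A + N)%MS <= brmx c A A + N)%MS.
Proof.
move=> bN sN A Ab; apply/brmx_subP => _ _ /sub_addsmxP [[u1 u2] /= ->] /sub_addsmxP [[w1 w2] /= ->].
set x := u1 *m A; set y := w1 *m A; set p := u2 *m N; set q := w2 *m N.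
have [xA yA pN qN] : [/\ (x <= A)%MS, (y <= A)%MS, (p <= N)%MS & (q <= N)%MS] by split; exact: submxMl.
have bxq : (br x q <= N)%MS by exact: bN (submx_trans xA Ab) qN.
have byp : (br p y <= N)%MS.
  by rewrite (brC Lc) eqmx_opp; exact: bN (submx_trans yA Ab) pN.
by rewrite brDl !brDr -addrA addmx_sub_adds ?brmx_mem // !addmx_sub ?bxq ?byp ?(sN _ _ pN qN).
Qed.

Lemma solvable_add_nil b N : subalg c b -> solvable_sub c b -> nil_sub c N -> stable c b N ->
  solvable_sub c (b + N)%MS.
Proof.
move=> sb /solvable_subP [m Hm] nN bN; have [sN _] := nN.
apply: (@solvable_of_der m); apply: (@solvable_subS _ N); last exact: nil_sub_solvable.
apply: (@submx_trans _ _ _ _ _ _ (iter m der b + N)%MS); last first.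
  by rewrite addsmx_sub submx_refl andbT (submx_trans Hm) ?sub0mx.
elim: m {Hm} => //= m IH; have H := brmxS c IH IH; apply: (submx_trans H).
by apply: (stable_brmx_add bN sN); exact: iter_der_sub.
Qed.

Lemma nil_sub_add N x : nil_sub c N -> ad_nilpotent c x -> (x <= normalizer c N)%MS ->
  nil_sub c (N + x)%MS.
Proof.
move=> nN nx xN; have [sN _] := nN; split; first exact: subalg_add_normalizing.
by move=> y; apply: nil_of_engel; apply: engel_step => //; exact: engel_of_nil.
Qed.

(** [R + N] is the union of the spaces [N + x] with [x] in [R], so extension by one vector suffices
    for nilpotency. *)
Lemma nil_sub_adds N R : nil_sub c N -> (forall x, (x <= R)%MS -> ad_nilpotent c x) ->
  (R <= normalizer c N)%MS -> (brmx c R R <= N)%MS -> nil_sub c (R + N)%MS.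
Proof.
move=> nN nR RN RR; have [sN _] := nN.
split=> [x y xRN yRN|_ /sub_addsmxP [[u1 u2] /= ->]].
  have /stable_normalizer RNs := RN.
  have := stable_brmx_add RNs sN (submx_refl R) => /brmx_subP H.
  by apply: submx_trans (H _ _ xRN yRN) _; rewrite addsmx_sub addsmxSr (submx_trans RR) ?addsmxSr.
have xR : (u1 *m R <= R)%MS by exact: submxMl.
have [_ H] := nil_sub_add nN (nR _ xR) (submx_trans xR RN).
apply: H; apply/addsmx_rVP; exists (u2 *m N), 1; split; first exact: submxMl.
by rewrite scale1r addrC.
Qed.

Lemma nil_sub0 : nil_sub c (0 : 'M[F]_n).
Proof.
split=> [x y|x]; rewrite submx0 => /eqP ->; first by rewrite br0l sub0mx.
by exists 1%N; rewrite adm0 expr1.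
Qed.

End Solvable.

Section Borel.
Variables (K : closedFieldType) (n : nat) (c : 'I_n -> 'I_n -> 'rV[K]_n).
Hypothesis charK : [pchar K] =i pred0.
Hypothesis Lc : is_lie c.
Hypothesis uK : kmx c \in unitmx.
Local Notation br := (lie_bracket c).
Local Notation der := (fun I => brmx c I I).
Let iota : {rmorphism K -> K} := idfun.

Variable b : 'M[K]_n.
Hypothesis borel_b : borel c b.

Let sb : subalg c b. Proof. by case: borel_b. Qed.

Section MaximalNil.
Variable N : 'M[K]_n.
Hypotheses (nN : nil_sub c N) (bN : (b <= normalizer c N)%MS).
Hypothesis Nmax : forall R, nil_sub c R -> (b <= normalizer c R)%MS -> (N <= R)%MS -> (R <= N)%MS.

Let sN : subalg c N. Proof. by case: nN. Qed.

Lemma borel_max_nil_sub : (N <= b)%MS.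
Proof.
have [_ [sol bmax]] := borel_b; apply: submx_trans (addsmxSr b N) _.
have /stable_normalizer bNs := bN.
apply: bmax; last exact: addsmxSl.
  move=> x y xS yS; have /brmx_subP H := stable_brmx_add Lc bNs sN (submx_refl b).
  by apply: submx_trans (H _ _ xS yS) _; apply: addsmxS => //; apply/subalgP.
exact: solvable_add_nil.
Qed.

Lemma borel_max_nil_perp : (perp c (normalizer c N) :=: N)%MS.
Proof.
apply: (perp_normalizer iota charK Lc uK nN) => R nR NR NNR.
exact: Nmax nR (submx_trans bN NNR) NR.
Qed.

Let kfbN y v : (y <= b)%MS -> (v <= N)%MS -> kf c y v = 0.
Proof.
move=> yb vN; rewrite kfC; move: vN; rewrite -borel_max_nil_perp => /perpP; apply.
exact: submx_trans yb bN.
Qed.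

Let add_ideal R : (forall x, (x <= R)%MS -> ad_nilpotent c x) -> (R <= b)%MS ->
  stable c b R -> (brmx c R R <= N)%MS -> (R <= N)%MS.
Proof.
move=> nR Rb bR RR; apply: submx_trans (addsmxSl R N) _; apply: Nmax; last exact: addsmxSr.
  by apply: nil_sub_adds => //; exact: submx_trans bN.
have /stable_normalizer bNs := bN.
apply/stable_normalizer => x _ xb /sub_addsmxP [[u1 u2] /= ->].
by rewrite brDr addmx_sub_adds ?bR ?bNs ?submxMl.
Qed.

(** A substitute for Lie's theorem, climbing the derived series up to [[b, b]]. Let [a] be a term
    with [[a, a]] in [N]. Elements of [[b, a]] send [a] into [N], so they are nilpotent and [[b, a]]
    is absorbed by [N]. Elements of [a] are sums of brackets and send [b] into [[b, a]], now inside
    [N]; so [a] is absorbed in turn. *)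
Lemma borel_max_nil_der : (brmx c b b <= N)%MS.
Proof.
have step k : (iter k.+2 der b <= N)%MS -> (iter k.+1 der b <= N)%MS.
  move=> H; set a := iter k.+1 der b in H *.
  have ab : (a <= b)%MS by exact: iter_der_sub.
  have ba : stable c b a by move=> x y; exact: iter_der_ideal.
  have Rb : (brmx c b a <= a)%MS by apply/brmx_subP.
  have RN : (brmx c b a <= N)%MS.
    apply: add_ideal.
    - move=> x xR; have xa := submx_trans xR Rb.
      apply: (commutator_nilpotent iota charK Lc (k := 1) xR _ _ kfbN).
        by have /normalizerP := submx_trans xa (submx_trans ab bN).
      rewrite expr1; apply/row_subP => i; rewrite row_mul mul_adm.
      by apply: submx_trans H; apply: brmx_mem => //; exact: row_sub.
    - exact: submx_trans Rb ab.
    - by move=> x y xb yR; apply: brmx_mem => //; exact: submx_trans Rb.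
    - by apply: submx_trans H; exact: brmxS.
  apply: add_ideal => //.
  move=> x xa.
  have xbb : (x <= brmx c b b)%MS.
    by apply: submx_trans xa _; apply: brmxS; exact: iter_der_sub.
  apply: (commutator_nilpotent iota charK Lc (k := 1) xbb _ _ kfbN).
    by have /normalizerP := submx_trans xa (submx_trans ab bN).
  rewrite expr1; apply/row_subP => i; rewrite row_mul mul_adm (brC Lc) eqmx_opp.
  by apply: submx_trans RN; apply: brmx_mem => //; exact: row_sub.
have [_ [/solvable_subP [m Hm] _]] := borel_b.
have : (iter m.+1 der b <= N)%MS.
  apply: submx_trans (sub0mx _ N).
  by apply: submx_trans Hm; rewrite iterS; apply/subalgP; elim: m {step} => //= m IH x y xb yb; apply: brmx_mem; apply: submx_trans; [exact: xb | apply/subalgP |exact: yb| apply/subalgP].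
by elim: m {Hm} => // m IH /step.
Qed.

Lemma borel_max_nil_mem x : (x <= b)%MS -> ad_nilpotent c x -> (x <= N)%MS.
Proof.
move=> xb nx; apply: submx_trans (addsmxSr N x) _; apply: Nmax; last exact: addsmxSl.
  by apply: nil_sub_add => //; exact: submx_trans xb bN.
have /stable_normalizer bNs := bN.
apply/stable_normalizer => y _ yb /addsmx_rVP [u [a [uN ->]]].
apply: submx_trans _ (addsmxSl N x); rewrite brDr brZr addmx_sub ?bNs // scalemx_sub //.
by apply: submx_trans borel_max_nil_der; exact: brmx_mem.
Qed.

(** Otherwise take a smallest [b]-submodule [V] of [q] containing [b] properly. There [b] acts on
    [V / b] by scalars, and a suitably corrected vector of [V] spans with [b] a solvable subalgebra,
    against the maximality of [b]. *)
Lemma borel_max_nil_normalizer : (normalizer c N <= b)%MS.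
Proof.
set q := normalizer c N; have bb := borel_max_nil_der.
have Nb := borel_max_nil_sub; have [_ [solb bmax]] := borel_b.
have sq : subalg c q by exact: normalizer_subalg.
have Nq x v : (x <= N)%MS -> (v <= q)%MS -> (br x v <= N)%MS.
  by move=> xN /normalizerP vq; rewrite (brC Lc) eqmx_opp vq.
apply: contrapT => nqb.
have [|V [[bV Vq] [sV nVb]] Vmin] := @ex_min_rank _ _ _
   (fun V => ((b <= V)%MS /\ (V <= q)%MS) /\ (stable c b V /\ ~ (V <= b)%MS)) q.
  by split; split=> // x y xb yq; apply: sq => //; exact: submx_trans bN.
have eig y : (y <= b)%MS -> exists a, forall v, (v <= V)%MS -> (br y v - a *: v <= b)%MS.
  move=> yb; have stV : stablemx V (adm c y).
    by apply/row_subP => i; rewrite row_mul mul_adm sV ?row_sub.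
  have [a [v [vV vb va]]] := relative_eigenvector stV nVb; exists a.
  (* The eigenspace of [y] modulo [b] is [b]-stable, because [[y, z]] lies in [N] and sends [V] into
     [b]; minimality makes it all of [V]. *)
  pose V' := (V :&: kermx ((adm c y - a%:M) *m cokermx b))%MS.
  have V'P w : (w <= V')%MS <-> (w <= V)%MS /\ (br y w - a *: w <= b)%MS.
    rewrite sub_capmx; have -> : (br y w - a *: w <= b)%MS =
        (w <= kermx ((adm c y - a%:M) *m cokermx b))%MS.
      rewrite submxE -mul_adm -mul_mx_scalar -mulmxBr -mulmxA.
      by apply/eqP/sub_kermxP.
    by split=> [/andP|[-> ->]].
  have V'V : (V <= V')%MS.
    apply: rank_sub_eq; first exact: capmxSl.
    apply: Vmin; split; split.
    - apply/rV_subP => w wb; apply/V'P; split; first exact: submx_trans bV.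
      by rewrite addmx_sub ?eqmx_opp ?scalemx_sub ?sb.
    - exact: submx_trans (capmxSl _ _) Vq.
    - move=> z w zb /V'P [wV wb]; apply/V'P; split; first exact: sV.
      have -> : br y (br z w) - a *: br z w = br (br y z) w + br z (br y w - a *: w).
        by rewrite (jacobi Lc) brBr brZr addrA.
      have yzN : (br y z <= N)%MS by apply: submx_trans bb; exact: brmx_mem.
      have h1 := submx_trans (Nq _ _ yzN (submx_trans wV Vq)) Nb.
      by rewrite addmx_sub ?h1 ?(sb zb wb).
    - move=> V'b; apply: vb; apply: submx_trans V'b; apply/V'P; split=> //.
      by rewrite -mul_adm -mul_mx_scalar -mulmxBr.
  by move=> w wV; have /V'P [] := submx_trans wV V'V.
have [x xV xb] := not_sub_rV nVb.
(* A one-dimensional extension of [b] inside [q] would be solvable. *)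
have extend z : (z <= V)%MS -> (forall y, (y <= b)%MS -> (br y z <= b + z)%MS) ->
    solvable_sub c (brmx c (b + z)%MS (b + z)%MS) -> (z <= b)%MS.
  move=> zV Hz solz; apply: submx_trans (addsmxSr b z) _; apply: bmax; last exact: addsmxSl.
    move=> _ _ /addsmx_rVP [u [a [ub ->]]] /addsmx_rVP [w [a' [wb ->]]].
    rewrite brDl !brDr !brZl !brZr (brxx Lc) !scaler0 addr0 (brC Lc z w) scalerN.
    have HS := addsmxSl b z.
    by rewrite !addmx_sub ?eqmx_opp ?scalemx_sub ?Hz ?(submx_trans _ HS) ?sb.
  exact: (@solvable_of_der _ _ c 1).
have der_ext z (T : 'M[K]_n) : (z <= V)%MS -> (forall y, (y <= b)%MS -> (br y z <= T)%MS) ->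
    (N <= T)%MS -> (brmx c (b + z)%MS (b + z)%MS <= T)%MS.
  move=> zV Hz NT; apply/brmx_subP => _ _ /addsmx_rVP [u [a [ub ->]]] /addsmx_rVP [w [a' [wb ->]]].
  rewrite brDl !brDr !brZl !brZr (brxx Lc) !scaler0 addr0 (brC Lc z w) scalerN.
  rewrite !addmx_sub ?eqmx_opp ?scalemx_sub ?Hz // (submx_trans _ NT) //.
  by apply: submx_trans bb; exact: brmx_mem.
have [H|H] := pselect (forall y, (y <= b)%MS -> (br y x <= b)%MS).
  apply: xb; apply: extend => // [y yb|]; first by apply: submx_trans (H y yb) (addsmxSl _ _).
  by apply: solvable_subS solb; exact: der_ext.
have [y0 [y0b y0x]] : exists y, (y <= b)%MS /\ ~ (br y x <= b)%MS.
  by apply: contrapT => H2; apply: H => y yb; apply: contrapT => H3; apply: H2; exists y.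
have [a Ha] := eig y0 y0b.
have a0 : a != 0.
  by apply/eqP => a0; apply: y0x; have := Ha x xV; rewrite a0 scale0r subr0.
pose r := br y0 x - a *: x; have rb : (r <= b)%MS by exact: Ha.
(* [y1] acts as the identity on [V / b]; replacing [x] by [x'] moves the error term of this relation
   from [b] into [N]. *)
pose x' := x + a^-1 *: r; pose y1 := a^-1 *: y0; pose v := a^-1 *: (a^-1 *: br y0 r).
have y1b : (y1 <= b)%MS by rewrite scalemx_sub.
have vN : (v <= N)%MS by rewrite !scalemx_sub // (submx_trans _ bb) // brmx_mem.
have y1x : br y1 x' = x' + v.
  rewrite /x' brDr brZr /y1 !brZl -/v -[br y0 x](subrK (a *: x)) -/r.
  by rewrite scalerDr scalerA mulVf // scale1r [_ + x]addrC.
have x'V : (x' <= V)%MS by rewrite addmx_sub ?scalemx_sub ?(submx_trans rb).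
have x'b : ~ (x' <= b)%MS.
  by move=> H2; apply: xb; rewrite -[x](addrK (a^-1 *: r)) addmx_sub ?eqmx_opp ?scalemx_sub.
have x'q := submx_trans x'V Vq.
(* With [m] the scalar by which [z] acts, [z'] acts as zero on [V / b]. As [x'] is [[y1, x']] up to
   [v], Jacobi expresses [[z', x']] by brackets that all lie in [N]. *)
have key z : (z <= b)%MS -> (br z x' <= N + x')%MS.
  move=> zb; have [m Hm] := eig z zb.
  pose z' := z - m *: y1; have z'b : (z' <= b)%MS by rewrite addmx_sub ?eqmx_opp ?scalemx_sub.
  have wb : (br z' x' <= b)%MS.
    rewrite brBl brZl y1x scalerDr opprD addrA addmx_sub ?Hm // eqmx_opp scalemx_sub //.
    exact: submx_trans vN Nb.
  have wN : (br z' x' <= N)%MS.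
    have -> : br z' x' = br (br z' y1) x' + br y1 (br z' x') - br z' v.
      by rewrite -(jacobi Lc) y1x brDr addrK.
    rewrite !addmx_sub ?eqmx_opp //.
    - by apply: Nq => //; apply: submx_trans bb; exact: brmx_mem.
    - by apply: submx_trans bb; exact: brmx_mem.
    - by have /normalizerP := submx_trans z'b bN; apply.
  have -> : br z x' = (br z' x' + m *: v) + m *: x'.
    have E (t u w : 'rV[K]_n) : t = t - (u + w) + w + u by rewrite -addrA [w + u]addrC subrK.
    by rewrite /z' brBl (brZl _ m y1) y1x (scalerDr m x' v) -E.
  by apply/addsmx_rVP; exists (br z' x' + m *: v), m; split; first exact: addmx_sub wN (scalemx_sub m vN).
apply: x'b; apply: extend => // [y yb|].
  by apply: submx_trans (key y yb) _; rewrite addsmxS.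
(* The derived algebra of [b + x'] lies in [N + x'], whose own derived algebra lies in [N]. *)
apply: (@solvable_subS _ _ _ _ (N + x')%MS); first by apply: der_ext => //; exact: addsmxSl.
apply: (@solvable_of_der _ _ c 1); apply: (@solvable_subS _ _ _ _ N); last exact: nil_sub_solvable.
apply/brmx_subP => _ _ /addsmx_rVP [u [a1 [ub ->]]] /addsmx_rVP [w [a2 [wb ->]]].
rewrite brDl !brDr !brZl !brZr (brxx Lc) !scaler0 addr0 (brC Lc x' w) scalerN.
by rewrite !addmx_sub ?eqmx_opp ?scalemx_sub ?eqmx_opp ?(sN ub wb) ?(Nq _ _ ub x'q) ?(Nq _ _ wb x'q).
Qed.

End MaximalNil.

Theorem borel_structure :
  exists N, [/\ nil_sub c N, (N <= b)%MS, (b :=: normalizer c N)%MS, (perp c b :=: N)%MS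
    & forall x, (x <= b)%MS -> ad_nilpotent c x -> (x <= N)%MS].
Proof.
have [|N [nN bN] Nm] := @ex_max_rank _ _ _ (fun N => nil_sub c N /\ (b <= normalizer c N)%MS) 0.
  split; first exact: nil_sub0.
  by apply/stable_normalizer => x v _; rewrite !submx0 => /eqP ->; rewrite br0r.
have Nmax R : nil_sub c R -> (b <= normalizer c R)%MS -> (N <= R)%MS -> (R <= N)%MS.
  by move=> nR bR NR; apply: rank_sub_eq => //; exact: Nm.
have bq : (b :=: normalizer c N)%MS.
  by apply/eqmxP; rewrite bN borel_max_nil_normalizer.
exists N; split=> //; first exact: borel_max_nil_sub.
  apply: eqmx_trans (borel_max_nil_perp nN bN Nmax).
  by apply/eqmxP/andP; split; apply: perpS; rewrite bq submx_refl.
exact: borel_max_nil_mem.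
Qed.

End Borel.

(** * Minimal parabolic subalgebras *)

Section MinimalParabolic.
Variables (F : fieldType) (K : closedFieldType) (iota : {rmorphism F -> K}) (n : nat).
Variable c : 'I_n -> 'I_n -> 'rV[F]_n.
Hypothesis charF : [pchar F] =i pred0.
Hypothesis Lc : is_lie c.
Hypothesis uK : kmx c \in unitmx.
Local Notation cK := (ext_consts iota c).
Local Notation "A ^f" := (map_mx iota A) : ring_scope.
Local Notation br := (lie_bracket c).

Let charK := pchar_ext iota charF.
Let LK := ext_lie iota charF Lc.
Let uKK : kmx cK \in unitmx. Proof. by rewrite -map_kmx map_unitmx. Qed.

Definition max_nil (U : 'M[F]_n) : Prop :=
  nil_sub c U /\ forall R, nil_sub c R -> (U <= R)%MS -> (R <= U)%MS.

Lemma map_subalg U : subalg c U -> subalg cK U^f.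
Proof.
move=> /sub_normalizer UN x y xU; have : (x <= normalizer cK U^f)%MS.
  by apply: submx_trans xU _; rewrite -map_normalizer map_submx.
by move/normalizerP; apply.
Qed.

Lemma map_brmx_sub A B : (brmx cK A^f B^f <= (brmx c A B)^f)%MS.
Proof.
apply/brmx_subP => _ _ /submxP [u ->] /submxP [w ->].
rewrite (mulmx_sum_row u) (mulmx_sum_row w) br_suml summx_sub // => i _.
rewrite br_sumr summx_sub // => j _.
rewrite brZl brZr !scalemx_sub // -!map_row -map_br map_submx.
by rewrite brmx_mem ?row_sub.
Qed.

Lemma map_solvable U : solvable_sub c U -> solvable_sub cK U^f.
Proof.
move=> /solvable_subP [m Hm]; apply/solvable_subP; exists m.
apply: (@submx_trans _ _ _ _ _ _ (iter m (fun I => brmx c I I) U)^f); last first.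
  by rewrite -(map_mx0 iota) map_submx.
elim: m {Hm} => //= m IH; exact: submx_trans (brmxS _ IH IH) (map_brmx_sub _ _).
Qed.

(** Nilpotency of single elements does not pass directly to [K]-combinations; the descending chain
    of Engel's theorem is a linear condition and does extend. *)
Lemma map_nil_sub U : nil_sub c U -> nil_sub cK U^f.
Proof.
move=> nU; have [sU _] := nU; split; first exact: map_subalg.
have [|m Hm] := engel_chain (engel_of_nil Lc nU) (V := 1%:M); first by move=> *; exact: submx1.
move=> x; apply: (nil_of_chain (m := m)).
apply: (@submx_trans _ _ _ _ _ _ (iter m (brmx c U) 1%:M)^f); last first.
  by rewrite -(map_mx0 iota) map_submx.
elim: m {Hm} => [|m IH] /=; first by rewrite map_mx1.
by apply: submx_trans (map_brmx_sub _ _); exact: brmxS.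
Qed.

Lemma borel_above S : subalg cK S -> solvable_sub cK S ->
  exists2 b, borel cK b & (S <= b)%MS.
Proof.
move=> sS solS; have [|b [[sb solb] Sb] bmax] := @ex_max_rank _ _ _
  (fun b => (subalg cK b /\ solvable_sub cK b) /\ (S <= b)%MS) S.
  by split; rewrite ?submx_refl.
exists b => //; split=> //; split=> // T sT solT bT.
by apply: rank_sub_eq => //; apply: bmax; split=> //; exact: submx_trans Sb bT.
Qed.

Lemma max_nil_perp U : max_nil U -> (perp c (normalizer c U) :=: U)%MS.
Proof.
by move=> [nU Umax]; apply: (perp_normalizer iota) => // R nR UR _; exact: Umax.
Qed.

Lemma max_nil_min_parabolic U : max_nil U -> min_parabolic iota c (normalizer c U).
Proof.
move=> mU; have [nU Umax] := mU; have [sU _] := nU; have Up := max_nil_perp mU.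
set q := normalizer c U in Up *.
split.
  split; first exact: normalizer_subalg.
  have [b bb Ub] := borel_above (map_subalg sU) (map_solvable (nil_sub_solvable Lc nU)).
  exists b; split=> //.
  have [N [nN Nb bq bp Nnil]] := borel_structure charK LK uKK bb.
  (* All nilpotent elements of [b] lie in [N]. Taking orthogonals then puts [b] inside the
     orthogonal of [U^f], which is [q] extended to [K]. *)
  have UN : (U^f <= N)%MS.
    apply/rV_subP => x xU; apply: Nnil; first exact: submx_trans Ub.
    by have [_] := map_nil_sub nU; apply.
  have NU : (perp cK N <= perp cK U^f)%MS by exact: perpS.
  have bN : (b <= perp cK N)%MS.
    by apply: submx_trans (sub_perpK _ _) _; apply: perpS; rewrite bp.
  apply: submx_trans bN (submx_trans NU _).
  rewrite -map_perp map_submx -[X in (_ <= X)%MS]/q -(perpK q uK).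
  by apply: perpS; rewrite Up.
(* Minimality by the same duality: the orthogonal of [Q] is nil, since over [K] it lies in [N], and
   it contains that of [q], which is [U]. Maximality makes them equal, and taking orthogonals again
   gives [q] inside [Q]. *)
move=> Q [sQ [b [bb bQ]]] Qq.
have [N [nN Nb bq bp Nnil]] := borel_structure charK LK uKK bb.
have QN : ((perp c Q)^f <= N)%MS by rewrite map_perp -bp perpS.
have QQ : (perp c Q <= Q)%MS.
  by rewrite -(map_submx iota); apply: submx_trans QN (submx_trans Nb bQ).
have nQ : nil_sub c (perp c Q).
  split=> [x y xP yP|x xP].
    have : (x <= normalizer c (perp c Q))%MS; last by move/normalizerP; apply.
    apply/normalizerP => z zP; apply: (perp_stable Lc _ zP).
    by apply: submx_trans (sub_normalizer sQ); exact: submx_trans xP QQ.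
  apply: (map_ad_nilpotent (iota := iota)); have [_] := nN; apply.
  by apply: submx_trans QN; rewrite map_submx.
have UQ : (U <= perp c Q)%MS by rewrite -Up perpS.
have QU := Umax _ nQ UQ.
have : (perp c U <= perp c (perp c Q))%MS by exact: perpS.
rewrite (perpK Q uK); apply: submx_trans.
by apply: submx_trans (sub_perpK _ _) _; apply: perpS; rewrite Up.
Qed.

(** If a maximal [M] misses [I], then [M + I] is [q], so [U] is [V + [U, U]] with [V] the part of
    [U] in [M]. Feeding this equality into itself replaces [[U, U]] by ever later terms of the lower
    central series; as [U] is nilpotent, it lies in [M]. *)
Lemma phi_free_nilradical_abelian U q : nil_sub c U -> subalg c q ->
  (U <= q)%MS -> (q <= normalizer c U)%MS -> phi_free c q -> abelian_sub c U.
Proof.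
move=> nU sq Uq qN phi_q; have [sU _] := nU; set I := brmx c U U.
have IU : (I <= U)%MS by apply/subalgP.
have qI : stable c q I.
  move=> x y xq; move: y; apply: brmx_ind.
  - by rewrite br0r sub0mx.
  - by move=> u v Hu Hv; rewrite brDr addmx_sub.
  - by move=> a u Hu; rewrite brZr scalemx_sub.
  have /normalizerP xN := submx_trans xq qN.
  by move=> u v uU vU; rewrite (jacobi Lc) addmx_sub ?brmx_mem ?xN.
have : (\rank I == 0)%N.
  apply: phi_q; first by split; [exact: submx_trans IU Uq | exact: qI].
  move=> M [sM [Mq Mmax]]; apply: contrapT => nIM.
  have /andP [Mq' _] := Mq.
  have MI : stable c M I := stableS Mq' qI.
  have sI : subalg c I.
    by move=> x y xI; apply: qI; exact: submx_trans xI (submx_trans IU Uq).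
  have sMI : subalg c (M + I)%MS.
    apply/subalgP; apply: submx_trans (stable_brmx_add Lc MI sI (submx_refl M)) _.
    by apply: addsmxS => //; apply/subalgP.
  have MIq : (M + I <= q)%MS by rewrite addsmx_sub Mq' (submx_trans IU Uq).
  have [E|E] := Mmax _ sMI (addsmxSl M I) MIq.
    by apply: nIM; apply: submx_trans (addsmxSr M I) _; rewrite (eqmxP E) submx_refl.
  have UMI : (U <= M + I)%MS by apply: submx_trans Uq _; rewrite (eqmxP E) submx_refl.
  pose V := (U :&: M)%MS.
  have sV : subalg c V.
    move=> x y; rewrite !sub_capmx => /andP [xU xM] /andP [yU yM].
    by rewrite (sU _ _ xU yU) (sM _ _ xM yM).
  pose Z k := iter k (brmx c U) U.
  have ZU k : (Z k <= U)%MS.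
    elim: k => [|k IH]; first exact: submx_refl.
    by apply: submx_trans IU; apply: brmxS.
  have UVI : (U <= V + I)%MS.
    apply/rV_subP => x xU; have /sub_addsmxP [[u1 u2] /= Ex] := submx_trans xU UMI.
    have Eu : u1 *m M = x - u2 *m I by rewrite Ex addrK.
    rewrite Ex addmx_sub_adds ?submxMl // sub_capmx submxMl andbT Eu.
    by rewrite addmx_sub ?eqmx_opp // (submx_trans (submxMl _ _) IU).
  have UVZ k : (U <= V + Z k)%MS.
    elim: k => [|k IH]; first exact: addsmxSr.
    apply: submx_trans UVI _; rewrite addsmx_sub addsmxSl /=.
    apply/brmx_subP => x y xU yU.
    have /sub_addsmxP [[u1 u2] /= Ex] := submx_trans xU IH.
    have /sub_addsmxP [[w1 w2] /= Ey] := submx_trans yU IH.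
    have yV : (w1 *m V <= V)%MS by exact: submxMl.
    have yZ : (w2 *m Z k <= Z k)%MS by exact: submxMl.
    have xV : (u1 *m V <= V)%MS by exact: submxMl.
    have xZ : (u2 *m Z k <= Z k)%MS by exact: submxMl.
    have yVU : (w1 *m V <= U)%MS := submx_trans yV (capmxSl _ _).
    rewrite Ey brDr {1}Ex brDl -addrA addmx_sub_adds ?(sV _ _ xV yV) //.
    rewrite addmx_sub //; last by apply: brmx_mem.
    by rewrite (brC Lc) eqmx_opp; apply: brmx_mem.
  have [m Hm] := nil_sub_nilpotent Lc nU.
  apply: nIM; apply: submx_trans IU _; apply: submx_trans (UVZ m) _.
  rewrite addsmx_sub capmxSr /=; apply: submx_trans Hm _; exact: sub0mx.
rewrite mxrank_eq0 => /eqP I0 x y xU yU.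
by apply/eqP; rewrite -submx0 -I0 brmx_mem.
Qed.

Lemma max_nil_above U : nil_sub c U -> exists2 V, max_nil V & (U <= V)%MS.
Proof.
move=> nU; have [|V [nV UV] Vmax] := @ex_max_rank _ _ _ (fun V => nil_sub c V /\ (U <= V)%MS) U.
  by rewrite submx_refl.
exists V => //; split=> // R nR VR; apply: rank_sub_eq => //; apply: Vmax; split=> //.
exact: submx_trans UV VR.
Qed.

Theorem nil_sub_abelian :
  (forall P, min_parabolic iota c P -> phi_free c P) ->
  forall U, nil_sub c U -> abelian_sub c U.
Proof.
move=> phiP U nU; have [V mV UV] := max_nil_above nU; have [nV _] := mV.
have [sV _] := nV.
have abV : abelian_sub c V.
  apply: (phi_free_nilradical_abelian nV (normalizer_subalg Lc (S := V))) => //.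
  - exact: sub_normalizer.
  - exact: phiP (max_nil_min_parabolic mV).
by move=> x y xU yU; apply: abV; [exact: submx_trans xU UV | exact: submx_trans yU UV].
Qed.

End MinimalParabolic.

(** * Jordan decomposition and nilpotent subalgebras *)

Lemma locally_nilpotent (K : closedFieldType) n (M : 'M[K]_n) :
  (forall v : 'rV_n, exists k, v *m M ^+ k = 0) -> M ^+ n = 0.
Proof.
move=> H; have [rs [rsr _ rsn]] := trace_polymx M; apply: rsn => r /rsr.
rewrite -eigenvalue_root_char => /eigenvalueP [v vM v0].
have [k vk] := H v; have E : v *m M ^+ k = r ^+ k *: v.
  elim: k {vk} => [|k IH]; first by rewrite !expr0 mulmx1 scale1r.
  by rewrite exprSr -mulmxE mulmxA IH -scalemxAl vM scalerA exprSr.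
move: E; rewrite vk => /esym/eqP; rewrite scaler_eq0 (negPf v0) orbF expf_eq0.
by case/andP => _ /eqP.
Qed.

(** On the generalized eigenspace for [a] the difference is [X - a], nilpotent there. *)
Lemma sub_replica_id_nilpotent (K : closedFieldType) n (X S : 'M[K]_n) :
  replica id X S -> (X - S) ^+ n = 0.
Proof.
move=> HS; apply: locally_nilpotent; apply: (gen_eig_span (A := X)).
- by exists 0%N; rewrite mul0mx.
- move=> u v [k uk] [l vl]; exists (k + l)%N; rewrite mulmxDl.
  by rewrite [in X in _ + X]addnC !exprD -!mulmxE !mulmxA uk vl !mul0mx addr0.
move=> a v av; have [k vk] := av; exists k; rewrite -[RHS]vk.
elim: k v av {vk} => [|k IH] v av; first by rewrite !expr0.
have E : v *m (X - S) = v *m (X - a%:M) by rewrite !mulmxBr (HS a v av) mul_mx_scalar.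
rewrite !exprS -!mulmxE !mulmxA E IH //; have [l vl] := av; exists l.
by rewrite -mulmxA mulmxE -exprS exprSr -mulmxE mulmxA vl mul0mx.
Qed.

Section Jordan.
Variables (F : fieldType) (K : closedFieldType) (iota : {rmorphism F -> K}) (n : nat).
Variable c : 'I_n -> 'I_n -> 'rV[F]_n.
Hypothesis charF : [pchar F] =i pred0.
Hypothesis Lc : is_lie c.
Hypothesis uK : kmx c \in unitmx.
Local Notation cK := (ext_consts iota c).
Local Notation "A ^f" := (map_mx iota A) : ring_scope.
Local Notation br := (lie_bracket c).
Local Notation adm := (adm c).

(** Divisibility by ['X^m] is for uses where [ad x ^+ m] kills a subspace: then [ad xs] kills it
    too. It results from 0 being a root of [P]. *)
Lemma jordan_decomposition x m :
  exists xs s, [/\ adm xs = polymx (adm x) s, 'X^m %| s,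
    replica id (adm x)^f (adm xs)^f & ad_nilpotent c (x - xs)].
Proof.
pose P := 'X * char_poly (adm x).
have P0 : P != 0 by rewrite mulf_neq0 ?polyX_eq0 // monic_neq0 // char_poly_monic.
have PX : polymx (adm x) P = 0 by rewrite polymxM polymx_char mulmx0.
have [s Hs] := jordan_poly iota (size P + m) charF P0.
set S := polymx (adm x) s.
have HS : replica id (adm x)^f S^f.
  rewrite map_polymx; apply: (replica_polymx (P := map_poly iota P) _ _ _ Hs).
  - by rewrite map_poly_eq0.
  - by rewrite -map_polymx PX map_mx0.
  - by rewrite size_map_poly leq_addr.
have dS : derivation c S.
  move=> u v; apply: (map_mx_inj (f := iota)); rewrite map_mxM map_mxD !map_br !map_mxM.
  by apply: (replica_derivation charF Lc (f := id) (x := x^f)) => //; rewrite -map_adm.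
have [xs Exs] := derivation_inner Lc uK dS.
exists xs, s; split=> //; last 1 first.
- apply: (map_ad_nilpotent (iota := iota)); exists n.
  by rewrite -map_adm admB Exs map_mxB; exact: sub_replica_id_nilpotent.
- have : root (map_poly iota P) 0 by rewrite rmorphM /= map_polyX rootM rootX eqxx.
  move/Hs; rewrite polyC0 !subr0 -(map_polyXn iota) dvdp_map; apply: dvdp_trans.
  by rewrite dvdp_exp2l // leq_addl.
- by rewrite Exs.
Qed.

Theorem nil_abelian_A_algebra :
  (forall U, nil_sub c U -> abelian_sub c U) -> A_algebra c.
Proof.
move=> nilab B sB [m0 Hm0] x0 y0 x0B y0B; apply/eqP; apply: contrapT => /negP nz0.
pose Z k := iter k (brmx c B) B.
have ex : exists m, (Z m <= (0 : 'M[F]_n))%MS by exists m0; rewrite submx0 -mxrank_eq0.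
case: (ex_minnP ex) => m Zm mmin.
have ZB k : (Z k <= B)%MS.
  elim: k => [|k IH]; first exact: submx_refl.
  by apply/brmx_subP => u v uB vZ; apply: sB => //; exact: submx_trans vZ IH.
have z0Z k : (Z k <= (0 : 'M[F]_n))%MS -> (1 < k)%N.
  case: k => [|[|k]] // Hk; case/negP: nz0; rewrite -submx0; apply: submx_trans Hk.
    exact: sB.
  exact: brmx_mem.
(* [Z 0] is [B] and [Z 1] is [[B, B]], both nonzero; so the last nonzero term is [Z j.+1], which is
   central in [B] and generated by brackets. *)
have [j Ej] : exists j, m = j.+2 by have := z0Z m Zm; case: m {Zm mmin} => [|[|j]] // _; exists j.
have [x [y [xB yZ z0]]] : exists x y, [/\ (x <= B)%MS, (y <= Z j)%MS & br x y <> 0].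
  apply: contrapT => H; have : (Z j.+1 <= (0 : 'M[F]_n))%MS.
    apply/brmx_subP => x y xB yZ; rewrite submx0; apply/eqP; apply: contrapT => z0.
    by apply: H; exists x, y.
  by move/mmin; rewrite Ej ltnn.
have yB : (y <= B)%MS := submx_trans yZ (ZB j).
set z := br x y in z0.
have zB : (z <= B)%MS by exact: sB.
have zc b : (b <= B)%MS -> br b z = 0.
  move=> bB; apply/eqP; rewrite -submx0; apply: submx_trans Zm; rewrite Ej.
  by apply: brmx_mem => //; exact: brmx_mem.
have BX u (b : 'rV[F]_n) : (u <= B)%MS -> (b <= B)%MS -> b *m adm u ^+ m = 0.
  move=> uB bB; apply/eqP; rewrite -submx0; apply: submx_trans Zm.
  elim: {mmin Ej}m => [|k IH]; first by rewrite expr0 mulmx1.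
  by rewrite exprSr -mulmxE mulmxA mul_adm; apply: brmx_mem.
have semis u : (u <= B)%MS -> exists us,
    [/\ ad_nilpotent c (u - us), forall b, (b <= B)%MS -> br us b = 0
      & forall w, br u w = 0 -> br us w = 0].
  move=> uB; have [us [s [Es /dvdpP [p Ep] _ nu]]] := jordan_decomposition u m.
  exists us; split=> // [b bB|w uw].
    by rewrite -mul_adm Es Ep mulrC polymxM polymxXn polymxX mulmxA BX ?mul0mx.
  rewrite -mul_adm Es Ep Ej exprSr mulrA mulrC polymxM polymxX mulmxA mul_adm uw.
  by rewrite mul0mx.
(* The semisimple parts commute with [B] and with each other, so passing to the nilpotent parts
   leaves the bracket [z] unchanged. *)
have [xs [nx xsB xsw]] := semis x xB; have [ys [ny ysB ysw]] := semis y yB.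
have ysxs : br ys xs = 0 by apply: ysw; rewrite (brC Lc) xsB // oppr0.
pose xn := x - xs; pose yn := y - ys.
have xnyn : br xn yn = z.
  rewrite /xn /yn brBl !brBr (xsB y yB) (brC Lc x ys) (brC Lc xs ys) (ysB x xB) ysxs.
  by rewrite !(oppr0, addr0, subr0).
have xnz : br xn z = 0 by rewrite brBl zc // xsB // subr0.
have ynz : br yn z = 0 by rewrite brBl zc // ysB // subr0.
have nz : ad_nilpotent c z.
  apply: (commutator_nilpotent iota charF Lc (s := B) (A := B) (N := 0) (k := 1)).
  - exact: brmx_mem.
  - by move=> v; rewrite submx0 => /eqP ->; rewrite br0r sub0mx.
  - rewrite expr1; apply/row_subP => i; rewrite row_mul mul_adm (brC Lc) zc ?row_sub //.
    by rewrite oppr0 sub0mx.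
  - by move=> u v _; rewrite submx0 => /eqP ->; rewrite kf0r.
(* The Heisenberg algebra is built by adjoining [z], [xn], [yn] in turn, each normalizing what
   precedes. *)
have n1 : nil_sub c ((0 : 'M[F]_n) + z)%MS.
  apply: nil_sub_add => //; first exact: nil_sub0.
  by apply/normalizerP => v; rewrite submx0 => /eqP ->; rewrite br0r sub0mx.
have z1 : (z <= (0 : 'M[F]_n) + z)%MS by exact: addsmxSr.
have n2 : nil_sub c ((0 : 'M[F]_n) + z + xn)%MS.
  apply: nil_sub_add => //; apply/normalizerP => _ /addsmx_rVP [u [a [u0 ->]]].
  move: u0; rewrite submx0 => /eqP ->; rewrite add0r brZr xnz scaler0 sub0mx //.
have n3 : nil_sub c ((0 : 'M[F]_n) + z + xn + yn)%MS.
  apply: nil_sub_add => //; apply/normalizerP => _ /addsmx_rVP [_ [a [/addsmx_rVP [u [b [u0 ->]]] ->]]].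
  move: u0; rewrite submx0 => /eqP ->; rewrite add0r brDr !brZr ynz scaler0 add0r.
  by rewrite (brC Lc) xnyn scalemx_sub // eqmx_opp (submx_trans z1) // addsmxSl.
case: z0; rewrite -xnyn; apply: (nilab _ n3); last exact: addsmxSr.
by apply: submx_trans (addsmxSl _ _); exact: addsmxSr.
Qed.

End Jordan.

(** * Complete reducibility *)

(* The operator [M |-> M A - A M], on matrices flattened to row vectors. *)
HB.lock Definition com_mx (F : fieldType) n (A : 'M[F]_n) : 'M[F]_(n * n) :=
  lin_mx (mulmxr A) - lin_mx (mulmx A).
Canonical com_mx_unlockable := Unlockable com_mx.unlock.

Section ComMx.
Variables (F : fieldType) (n : nat).
Implicit Types A B M : 'M[F]_n.

Lemma mul_com_mx (u : 'rV[F]_(n * n)) A :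
  u *m com_mx A = mxvec (vec_mx u *m A - A *m vec_mx u).
Proof.
rewrite unlock mulmxBr; have := mul_vec_lin (mulmxr A) (vec_mx u); rewrite vec_mxK => ->.
have := mul_vec_lin (mulmx A) (vec_mx u); rewrite vec_mxK => ->.
by rewrite -linearB.
Qed.

Lemma com_mx_ext A (T : 'M[F]_(n * n)) :
  (forall M, mxvec M *m T = mxvec (M *m A - A *m M)) -> T = com_mx A.
Proof.
move=> H; apply/row_matrixP => i; rewrite !rowE mul_com_mx -H vec_mxK //.
Qed.

Lemma com_mxD A B : com_mx (A + B) = com_mx A + com_mx B.
Proof.
apply/esym/com_mx_ext => M; rewrite mulmxDr !mul_com_mx !mxvecK -linearD /=.
by rewrite mulmxDr mulmxDl opprD addrACA.
Qed.

Lemma com_mxZ a A : com_mx (a *: A) = a *: com_mx A.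
Proof.
apply/esym/com_mx_ext => M; rewrite -scalemxAr !mul_com_mx !mxvecK -linearZ /=.
by rewrite -scalemxAr -scalemxAl scalerBr.
Qed.

Lemma com_mx0 : com_mx (0 : 'M[F]_n) = 0.
Proof. by have := com_mxZ 0 0; rewrite !scale0r. Qed.

Lemma com_mx_comm A B :
  com_mx (A *m B - B *m A) = com_mx A *m com_mx B - com_mx B *m com_mx A.
Proof.
apply/esym/com_mx_ext => M; rewrite mulmxBr !mulmxA !mul_com_mx !mxvecK -linearB /=.
congr mxvec; rewrite !(mulmxBl, mulmxBr) !mulmxA.
move: (M *m A *m B) (A *m M *m B) (B *m M *m A) (B *m A *m M) (M *m B *m A) (A *m B *m M).
by move=> a b d e f g; apply/matrixP => i j; rewrite !mxE; ring.
Qed.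

End ComMx.

Lemma map_com_mx (F K : fieldType) (iota : {rmorphism F -> K}) n (A : 'M[F]_n) :
  map_mx iota (com_mx A) = com_mx (map_mx iota A).
Proof.
apply/row_matrixP => i; rewrite -map_row [row i (com_mx A)]rowE [RHS]rowE !mul_com_mx.
by rewrite map_mxvec map_mxB !map_mxM map_vec_mx map_delta_mx.
Qed.

(** The product [u M] obeys the Leibniz rule for [X] on vectors and [com_mx X] on matrices, so
    replicas of the two correspond. *)
Lemma replica_com_mx (K : closedFieldType) (f : K -> K) n (X R : 'M[K]_n) C :
  (forall a b, f (a + b) = f a + f b) ->
  replica f X R -> replica f (com_mx X) C -> C = com_mx R.
Proof.
move=> fD HR HC; apply: com_mx_ext => M; apply: (canRL (@vec_mxK _ _ _)).
have L (u : 'rV[K]_n) (w : 'rV[K]_(n * n)) :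
    u *m vec_mx w *m R = u *m R *m vec_mx w + u *m vec_mx (w *m C).
  apply: (replica_leibniz (B := fun (u : 'rV[K]_n) (w : 'rV[K]_(n * n)) => u *m vec_mx w)
            (T1 := X) (T2 := com_mx X) (T3 := X) _ _ _ _ _ fD HR HC HR) => /=.
  - by move=> *; rewrite mulmxDl.
  - by move=> *; rewrite linearD mulmxDr.
  - by move=> *; rewrite scalemxAl.
  - by move=> *; rewrite linearZ scalemxAr.
  - by move=> v x; rewrite mul_com_mx mxvecK mulmxBr !mulmxA addrC subrK.
apply/row_matrixP => i; rewrite !rowE.
have := L (delta_mx 0 i) (mxvec M); rewrite mxvecK => E.
by rewrite mulmxBr !mulmxA E addrC addKr.
Qed.

(* [D] lifts and [E] projects the quotient of the row space of [V2] by that of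
   [V1], identified with row vectors of length [q]. *)
Definition is_quotient (F : fieldType) N q (V1 V2 : 'M[F]_N) (D : 'M[F]_(q, N)) (E : 'M[F]_(N, q)) :=
  [/\ (D <= V2)%MS, D *m E = 1%:M, V1 *m E = 0 & (V2 - V2 *m E *m D <= V1)%MS].

Lemma quotient_exists (F : fieldType) N (V1 V2 : 'M[F]_N) : (V1 <= V2)%MS ->
  exists q (D : 'M[F]_(q, N)) (E : 'M[F]_(N, q)), is_quotient V1 V2 D E.
Proof.
move=> V12; pose C := (V2 :\: V1)%MS; pose D := row_base C.
have CV1 : (C :&: V1 = 0)%MS by exact: capmx_diff.
exists (\rank C), D, (proj_mx C V1 *m pinvmx D); split.
- by rewrite eq_row_base diffmxSl.
- by rewrite mulmxA proj_mx_id ?eq_row_base // mulmxVp // row_base_free.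
- by rewrite mulmxA proj_mx_0 ?mul0mx.
have : (V2 <= C + V1)%MS by rewrite -{1}(addsmx_diff_cap_eq V2 V1) addsmxS ?capmxSr.
case/sub_addsmxP => [[a b] /= Eu].
have -> : V2 *m (proj_mx C V1 *m pinvmx D) *m D = a *m C.
  rewrite Eu mulmxA mulmxDl [X in X + _]proj_mx_id ?submxMl // proj_mx_0 ?submxMl // addr0.
  by rewrite mulmxKpV // eq_row_base submxMl.
by rewrite [X in X - _]Eu addrC addKr submxMl.
Qed.

Lemma map_is_quotient (F K : fieldType) (iota : {rmorphism F -> K}) N q V1 V2 (D : 'M[F]_(q, N)) E :
  is_quotient V1 V2 D E ->
  is_quotient (map_mx iota V1) (map_mx iota V2) (map_mx iota D) (map_mx iota E).
Proof.
move=> [H1 H2 H3 H4]; split; rewrite -?map_mxM ?map_submx // ?H2 ?H3 ?map_mx1 ?map_mx0 //.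
by rewrite -map_mxB map_submx.
Qed.

Section Quotient.
Variables (F : fieldType) (N q : nat) (V1 V2 : 'M[F]_N) (D : 'M[F]_(q, N)) (E : 'M[F]_(N, q)).
Hypothesis HQ : is_quotient V1 V2 D E.

Lemma quotient_sub m (u : 'M[F]_(m, N)) : (u <= V2)%MS -> (u - u *m E *m D <= V1)%MS.
Proof.
case: HQ => _ _ _ H /submxP [w ->]; rewrite -!mulmxA -mulmxBr !mulmxA.
by rewrite (submx_trans (submxMl _ _)).
Qed.

Lemma quotient_eq0 m (u : 'M[F]_(m, N)) : (u <= V2)%MS -> u *m E = 0 -> (u <= V1)%MS.
Proof. by move=> uV u0; have := quotient_sub uV; rewrite u0 mul0mx subr0. Qed.

Lemma quotient_kill m (u : 'M[F]_(m, N)) : (u <= V1)%MS -> u *m E = 0.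
Proof. by case: HQ => _ _ H _ /submxP [w ->]; rewrite -mulmxA H mulmx0. Qed.

Lemma quotient_mul G H : stablemx V2 G -> stablemx V1 H ->
  D *m (G *m H) *m E = D *m G *m E *m (D *m H *m E).
Proof.
move=> sG sH; have [DV _ _ _] := HQ.
have /quotient_sub DG : (D *m G <= V2)%MS by rewrite (submx_trans (submxMr _ DV)).
have : (D *m G - D *m G *m E *m D) *m H *m E = 0.
  by rewrite quotient_kill // (submx_trans (submxMr _ DG)).
by rewrite !mulmxBl => /eqP; rewrite subr_eq0 => /eqP; rewrite !mulmxA => ->.
Qed.

Lemma quotient_poly G p : stablemx V1 G -> stablemx V2 G ->
  D *m polymx G p *m E = polymx (D *m G *m E) p.
Proof.
move=> s1 s2; have [_ DE _ _] := HQ; elim/poly_ind: p => [|p a IH].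
  by rewrite !polymx0 mulmx0 mul0mx.
rewrite !polymxD !polymxM !polymxX !polymxC mulmxDr mulmxDl quotient_mul //.
  by rewrite IH mul_mx_scalar -scalemxAl DE scalemx1.
exact: polymx_stable.
Qed.

Lemma quotient_act (u : 'rV[F]_N) G : (u <= V2)%MS -> stablemx V1 G ->
  u *m G *m E = u *m E *m (D *m G *m E).
Proof.
move=> uV sG; have : (u - u *m E *m D) *m G *m E = 0.
  by rewrite quotient_kill // (submx_trans (submxMr _ (quotient_sub uV))).
by rewrite !mulmxBl => /eqP; rewrite subr_eq0 => /eqP ->; rewrite !mulmxA.
Qed.

End Quotient.

Lemma map_span_ind (F K : fieldType) (iota : {rmorphism F -> K}) n (S : 'M[F]_n) (Q : 'rV[K]_n -> Prop) :
  Q 0 -> (forall u v, Q u -> Q v -> Q (u + v)) -> (forall a u, Q u -> Q (a *: u)) ->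
  (forall x, (x <= S)%MS -> Q (map_mx iota x)) -> forall w, (w <= map_mx iota S)%MS -> Q w.
Proof.
move=> Q0 QD QZ QS w /submxP [u ->]; rewrite mulmx_sum_row.
by apply: (big_ind Q) => // i _; apply: QZ; rewrite -map_row; apply: QS; exact: row_sub.
Qed.

Lemma mxtrace_invariant (F : fieldType) q (X Y Z : 'M[F]_q) :
  \tr ((X *m Y - Y *m X) *m Z) + \tr (X *m (Z *m Y - Y *m Z)) = 0.
Proof.
rewrite mulmxBl mulmxBr !raddfB /= !mulmxA (mxtrace_mulC (X *m Z)) mulmxA.
by rewrite addrA subrK subrr.
Qed.

Lemma mxtrace_commutator (F : fieldType) q (A Y C : 'M[F]_q) :
  \tr ((A *m Y - Y *m A) *m C) = \tr (Y *m (C *m A - A *m C)).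
Proof.
by rewrite mulmxBl mulmxBr !raddfB /= -!mulmxA (mxtrace_mulC A) !mulmxA.
Qed.

(** Invariance of a Casimir element in coordinates: [A] records an action on the basis, and the
    hypothesis says that the tensor with coefficients [H] is invariant. *)
Lemma invariant_tensor_sum (F : fieldType) N d (T : 'I_d -> 'M[F]_N) (H A : 'M[F]_d) :
  H *m A + A^T *m H = 0 ->
  \sum_i \sum_j H i j *: (T i *m (\sum_k A j k *: T k) + (\sum_k A i k *: T k) *m T j) = 0.
Proof.
move=> HA.
have E1 : \sum_i \sum_j H i j *: (T i *m (\sum_k A j k *: T k)) =
    \sum_i \sum_k (H *m A) i k *: (T i *m T k).
  apply: eq_bigr => i _; under eq_bigr do rewrite mulmx_sumr scaler_sumr.
  rewrite exchange_big /=; apply: eq_bigr => k _; rewrite mxE scaler_suml.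
  by apply: eq_bigr => j _; rewrite -scalemxAr scalerA.
have E2 : \sum_i \sum_j H i j *: ((\sum_k A i k *: T k) *m T j) =
    \sum_i \sum_k (A^T *m H) i k *: (T i *m T k).
  rewrite exchange_big /= [RHS]exchange_big /=; apply: eq_bigr => j _.
  under eq_bigr do rewrite mulmx_suml scaler_sumr.
  rewrite exchange_big /=; apply: eq_bigr => k _; rewrite mxE scaler_suml.
  by apply: eq_bigr => i _; rewrite -scalemxAl scalerA mxE mulrC.
under eq_bigr do under eq_bigr do rewrite scalerDr.
under eq_bigr do rewrite big_split.
rewrite big_split /= E1 E2 -big_split big1 //= => i _; rewrite -big_split big1 //= => k _.
by rewrite -scalerDl; have /matrixP /(_ i k) := HA; rewrite !mxE => ->; rewrite scale0r.
Qed.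

(** * Weyl's theorem for a subalgebra acting semisimply *)

Section Weyl.
Variables (F : fieldType) (K : closedFieldType) (iota : {rmorphism F -> K}) (n : nat).
Variable c : 'I_n -> 'I_n -> 'rV[F]_n.
Hypothesis charF : [pchar F] =i pred0.
Hypothesis Lc : is_lie c.
Local Notation cK := (ext_consts iota c).
Local Notation "A ^f" := (map_mx iota A) : ring_scope.
Local Notation br := (lie_bracket c).
Variable B : 'M[F]_n.
Hypothesis sB : subalg c B.
Local Notation T x := (com_mx (adm c x)).

Definition com_stable (V : 'M[F]_(n * n)) : Prop :=
  forall x, (x <= B)%MS -> stablemx V (T x).

Let TD x y : T (x + y) = T x + T y. Proof. by rewrite admD com_mxD. Qed.
Let TZ a x : T (a *: x) = a *: T x. Proof. by rewrite admZ com_mxZ. Qed.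
Let T_br x y : T (br x y) = T y *m T x - T x *m T y.
Proof. by rewrite (adm_br Lc) com_mx_comm. Qed.

Section Irreducible.
Variables (V1 V2 : 'M[F]_(n * n)) (v : 'rV[F]_(n * n)).
Hypothesis V12 : (V1 <= V2)%MS.
Hypotheses (sV1 : com_stable V1) (sV2 : com_stable V2).
Hypothesis irr : forall W, com_stable W -> (V1 <= W)%MS -> (W <= V2)%MS ->
  ~ (V2 <= W)%MS -> (W <= V1)%MS.
Hypothesis vT : forall x, (x <= B)%MS -> (v *m T x <= V2)%MS.
Hypothesis ss : forall x (u : 'rV[F]_(n * n)), (x <= B)%MS -> (u <= V2 + v)%MS ->
  (u *m T x *m T x <= V1)%MS -> (u *m T x <= V1)%MS.

Variables (q : nat) (D : 'M[F]_(q, n * n)) (E : 'M[F]_(n * n, q)).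
Hypothesis HQ : is_quotient V1 V2 D E.

Let V2v : (V2 <= V2 + v)%MS := addsmxSl V2 v.
Let vV2v : (v <= V2 + v)%MS := addsmxSr V2 v.

Let uT (u : 'rV[F]_(n * n)) x : (x <= B)%MS -> (u <= V2 + v)%MS -> (u *m T x <= V2)%MS.
Proof.
move=> xB /addsmx_rVP [w [a [wV ->]]]; rewrite mulmxDl -scalemxAl.
by rewrite addmx_sub ?scalemx_sub ?vT // (submx_trans (submxMr _ wV)) // sV2.
Qed.

(* An operator commuting with [B] modulo [V1] and not zero on [V2 / V1] is
   bijective there, which lets one correct [v]. *)
Lemma schur_correction (Th : 'M[F]_(n * n)) :
  stablemx V1 Th -> stablemx V2 Th -> (v *m Th <= V2)%MS ->
  (forall x (u : 'rV[F]_(n * n)), (x <= B)%MS -> (u <= V2 + v)%MS -> (u *m (Th *m T x - T x *m Th) <= V1)%MS) ->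
  ~ (V2 *m Th <= V1)%MS ->
  exists v', (v - v' <= V2)%MS /\ forall x, (x <= B)%MS -> (v' *m T x <= V1)%MS.
Proof.
move=> s1 s2 vTh comm nTh; have [DV DE V1E VED] := HQ.
pose W := (V2 :&: kermx (Th *m cokermx V1))%MS.
have WP (u : 'rV_(n * n)) : (u <= W)%MS = (u <= V2)%MS && (u *m Th <= V1)%MS.
  by rewrite sub_capmx; congr (_ && _); rewrite (submxE (u *m Th)) -mulmxA; apply/sub_kermxP/eqP.
have WV1 : (W <= V1)%MS.
  apply: irr.
  - move=> x xB; apply/row_subP => i; rewrite row_mul.
    have := row_sub i W; move: (row i W) => u; rewrite !WP => /andP [uV uTh].
    rewrite (submx_trans (submxMr _ uV)) ?sV2 //=.
    have := comm x u xB (submx_trans uV V2v); rewrite mulmxBr !mulmxA => H.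
    have H2 : (u *m Th *m T x <= V1)%MS by rewrite (submx_trans (submxMr _ uTh)) ?sV1.
    have H3 : (- (u *m Th *m T x - u *m T x *m Th) <= V1)%MS by rewrite eqmx_opp.
    by have := addmx_sub H2 H3; rewrite opprB addrC subrK.
  - by apply/rV_subP => u uV; rewrite WP (submx_trans uV V12) (submx_trans (submxMr _ uV)).
  - exact: capmxSl.
  - move=> VW; apply: nTh; apply/row_subP => i; rewrite row_mul.
    by have := submx_trans (row_sub i V2) VW; rewrite WP => /andP [].
pose Q := D *m Th *m E.
have uQ : Q \in unitmx.
  rewrite -row_free_unit -kermx_eq0; apply/eqP/row_matrixP => i; rewrite row0.
  set a := row i _; have aQ : a *m Q = 0 by apply/sub_kermxP; exact: row_sub.
  have aDV : (a *m D <= V2)%MS by rewrite (submx_trans (submxMl _ _)).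
  have : (a *m D <= W)%MS.
    rewrite WP aDV (quotient_eq0 HQ) ?(submx_trans (submxMr _ aDV)) //.
    by rewrite -!mulmxA (mulmxA D).
  move=> /submx_trans /(_ WV1) /(quotient_kill HQ); rewrite -mulmxA DE mulmx1 //.
pose w := v *m Th *m E *m invmx Q *m D.
have wV : (w <= V2)%MS by rewrite (submx_trans (submxMl _ _)).
have wTh : ((v - w) *m Th <= V1)%MS.
  rewrite mulmxBl; apply: (quotient_eq0 HQ).
    by rewrite addmx_sub ?eqmx_opp // (submx_trans (submxMr _ wV)).
  rewrite mulmxBl /w.
  have -> : v *m Th *m E *m invmx Q *m D *m Th *m E = v *m Th *m E *m invmx Q *m Q by rewrite /Q !mulmxA.
  by rewrite mulmxKV // subrr.
exists (v - w); split; first by rewrite opprB addrC subrK.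
have vw : (v - w <= V2 + v)%MS by rewrite addmx_sub // eqmx_opp (submx_trans wV).
move=> x xB; apply: submx_trans WV1; rewrite WP uT //=.
have := comm x _ xB vw; rewrite mulmxBr !mulmxA => H.
have H2 : ((v - w) *m Th *m T x <= V1)%MS by rewrite (submx_trans (submxMr _ wTh)) ?sV1.
have H3 : (- ((v - w) *m Th *m T x - (v - w) *m T x *m Th) <= V1)%MS by rewrite eqmx_opp.
by have := addmx_sub H2 H3; rewrite opprB addrC subrK.
Qed.

Definition quotient_rep x : 'M[F]_q := D *m T x *m E.
Local Notation rho := quotient_rep.

Let rhoD x y : rho (x + y) = rho x + rho y.
Proof. by rewrite /rho TD mulmxDr mulmxDl. Qed.
Let rhoZ a x : rho (a *: x) = a *: rho x.
Proof. by rewrite /rho TZ -scalemxAr -scalemxAl. Qed.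
Let rho0 : rho 0 = 0. Proof. by have := rhoZ 0 0; rewrite !scale0r. Qed.
Let rho_br x y : (x <= B)%MS -> (y <= B)%MS -> rho (br x y) = rho y *m rho x - rho x *m rho y.
Proof.
move=> xB yB; rewrite /rho T_br mulmxBr mulmxBl.
by rewrite !(quotient_mul HQ) ?sV1 ?sV2.
Qed.

Definition trace_form x y := \tr (rho x *m rho y).
Local Notation beta := trace_form.

Let betaDl x y z : beta (x + y) z = beta x z + beta y z.
Proof. by rewrite /beta rhoD mulmxDl mxtraceD. Qed.
Let betaZl a x z : beta (a *: x) z = a * beta x z.
Proof. by rewrite /beta rhoZ -scalemxAl mxtraceZ. Qed.
Let betaC x y : beta x y = beta y x. Proof. exact: mxtrace_mulC. Qed.
Let beta0 z : beta 0 z = 0. Proof. by rewrite /beta rho0 mul0mx mxtrace0. Qed.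

Let beta_inv x y z : (x <= B)%MS -> (y <= B)%MS -> (z <= B)%MS ->
  beta (br y x) z + beta x (br y z) = 0.
Proof.
by move=> xB yB zB; rewrite /beta !rho_br //; exact: mxtrace_invariant.
Qed.

Definition form_radical : 'M[F]_n :=
  (B :&: kermx (\matrix_(i < n, j < n) beta (delta_mx 0 i) (row j B)))%MS.
Local Notation r := form_radical.

Lemma form_radicalP x : (x <= r)%MS <-> (x <= B)%MS /\ forall y, (y <= B)%MS -> beta x y = 0.
Proof.
have E1 j : (x *m (\matrix_(i < n, j < n) beta (delta_mx 0 i) (row j B))) 0 j = beta x (row j B).
  rewrite {2}(row_sum_delta x) (big_morph (beta^~ _) (fun a b => betaDl a b _) (beta0 _)) mxE.
  by apply: eq_bigr => i _; rewrite betaZl mxE.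
rewrite sub_capmx; split=> [/andP [xB /sub_kermxP x0]|[xB H]].
  split=> // y /submxP [w ->]; rewrite betaC mulmx_sum_row.
  rewrite (big_morph (beta^~ _) (fun a b => betaDl a b _) (beta0 _)) big1 // => j _.
  by rewrite betaZl betaC -E1 x0 mxE mulr0.
rewrite xB; apply/sub_kermxP/rowP => j; rewrite E1 H ?row_sub //.
by rewrite mxE.
Qed.

Lemma form_radical_ideal x y : (x <= B)%MS -> (y <= r)%MS -> (br x y <= r)%MS.
Proof.
move=> xB /form_radicalP [yB H]; apply/form_radicalP; split; first exact: sB.
move=> z zB; have := beta_inv yB xB zB; rewrite (H _ (sB xB zB)) addr0; exact.
Qed.

Let rhoK (w : 'rV[K]_n) := D^f *m com_mx (adm cK w) *m E^f.

Let rhoKD u w : rhoK (u + w) = rhoK u + rhoK w.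
Proof. by rewrite /rhoK admD com_mxD (mulmxDr D^f (com_mx (adm cK u))) mulmxDl. Qed.

Let map_rho x : (rho x)^f = rhoK x^f.
Proof. by rewrite /rho !map_mxM map_com_mx map_adm. Qed.

Let beta_radical_ext y w : (y <= B)%MS -> (w <= r^f)%MS -> \tr ((rho y)^f *m rhoK w) = 0.
Proof.
move=> yB; move: w; apply: map_span_ind.
- by rewrite /rhoK adm0 com_mx0 mulmx0 mul0mx mulmx0 mxtrace0.
- by move=> u w Hu Hw; rewrite rhoKD mulmxDr mxtraceD Hu Hw addr0.
- by move=> a u; rewrite /rhoK admZ com_mxZ -scalemxAr -scalemxAl -scalemxAr mxtraceZ => ->; rewrite mulr0.
by move=> x /form_radicalP [xB H]; rewrite -map_rho -map_mxM trace_map_mx -/(beta y x) betaC H // rmorph0.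
Qed.

(** The trace argument of [commutator_nilpotent], with the trace form of [rho] in place of the
    Killing form. *)
Lemma radical_commutator_nilpotent x : (x <= brmx c B r)%MS -> rho x ^+ q = 0.
Proof.
move=> xBr; apply/eqP; rewrite -(map_mx_eq0 iota) map_mx_exp; apply/eqP.
have LK := ext_lie iota charF Lc.
have rB : (r <= B)%MS by exact: capmxSl.
have xr : (x <= r)%MS by apply: submx_trans xBr _; apply/brmx_subP => y z; exact: form_radical_ideal.
have xB := submx_trans xr rB.
(* One [P] kills both [ad x] and its commutation operator, so a single [p] gives replicas of both
   and the replica of [rho x] is induced by a derivation [R]. *)
set X := adm cK x^f; pose P := char_poly X * char_poly (com_mx X).
have P0 : P != 0 by rewrite mulf_neq0 // monic_neq0 // char_poly_monic.
have PX : polymx X P = 0 by rewrite polymxM polymx_char mul0mx.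
have PT : polymx (com_mx X) P = 0 by rewrite polymxM polymx_char mulmx0.
have Tf y : (T y)^f = com_mx (adm cK y^f) by rewrite map_com_mx map_adm.
have sV1K y : (y <= B)%MS -> stablemx V1^f (com_mx (adm cK y^f)).
  by move=> yB; rewrite -Tf -map_mxM map_submx; exact: sV1.
have sV2K y : (y <= B)%MS -> stablemx V2^f (com_mx (adm cK y^f)).
  by move=> yB; rewrite -Tf -map_mxM map_submx; exact: sV2.
have HQK := map_is_quotient iota HQ.
have PA : polymx (rho x)^f P = 0.
  rewrite map_rho -(quotient_poly HQK) ?sV1K ?sV2K //.
  by rewrite PT mulmx0 mul0mx.
apply: (replica_nilpotent (m := size P) (pchar_ext iota charF) PA) => // f fD p Hp.
have HR : replica f X (polymx X p) by apply: replica_polymx PX _ Hp.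
have HC : replica f (com_mx X) (polymx (com_mx X) p) by apply: replica_polymx PT _ Hp.
have EC := replica_com_mx fD HR HC.
have dR : derivation cK (polymx X p) by exact: replica_derivation HR.
set R := polymx X p in HR EC dR.
have -> : polymx (rho x)^f p = D^f *m com_mx R *m E^f.
  by rewrite map_rho -EC (quotient_poly HQK) ?sV1K ?sV2K.
have sC1 : stablemx V1^f (com_mx R) by rewrite -EC; apply: polymx_stable; exact: sV1K.
have sC2 : stablemx V2^f (com_mx R) by rewrite -EC; apply: polymx_stable; exact: sV2K.
set C := D^f *m com_mx R *m E^f.
suff : forall z, (z <= brmx c B r)%MS -> \tr ((rho z)^f *m C) = 0 by move=> /(_ x xBr).
apply: brmx_ind.
- by rewrite rho0 map_mx0 mul0mx mxtrace0.
- by move=> u w Hu Hw; rewrite rhoD map_mxD mulmxDl mxtraceD Hu Hw addr0.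
- by move=> a u Hu; rewrite rhoZ map_mxZ -scalemxAl mxtraceZ Hu mulr0.
move=> y a yB ar; have aB := submx_trans ar rB.
rewrite rho_br // map_mxB (map_mxM iota (rho a)) (map_mxM iota (rho y)).
(* [R] is a polynomial in [ad x], so [a R] stays in the radical and the trace form kills it. *)
have E1 : C *m (rho a)^f - (rho a)^f *m C = - rhoK (a^f *m R).
  rewrite !map_rho /C /rhoK -!(quotient_mul HQK) ?sV1K ?sV2K //.
  rewrite -mulmxBl -mulmxBr -com_mx_comm.
  have -> : R *m adm cK a^f - adm cK a^f *m R = - adm cK (a^f *m R).
    by rewrite (derivation_adm a^f dR) opprD addrCA subrr addr0.
  by rewrite -scaleN1r com_mxZ scaleN1r mulmxN mulNmx.
rewrite mxtrace_commutator E1 mulmxN raddfN /= beta_radical_ext ?oppr0 //.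
have st : stablemx r^f X.
  rewrite /X -map_adm -map_mxM map_submx; apply/row_subP => i.
  by rewrite row_mul mul_adm form_radical_ideal ?row_sub.
have af : (a^f <= r^f)%MS by rewrite map_submx.
by rewrite (submx_trans (submxMr _ af)) // polymx_stable.
Qed.

(** By [ss], [T x] and its square have the same kernel modulo [V1], so a nilpotent action on
    [V2 / V1] is zero; [v] follows because [T x] carries it into [V2]. *)
Lemma quotient_trivial x : (x <= B)%MS -> rho x ^+ q = 0 ->
  (V2 *m T x <= V1)%MS /\ (v *m T x <= V1)%MS.
Proof.
move=> xB nx.
have H (u : 'rV_(n * n)) : (u <= V2)%MS -> (u *m T x <= V1)%MS.
  move=> uV; pose w j := u *m T x ^+ j.
  have wS j : w j.+1 = w j *m T x by rewrite /w exprSr -mulmxE mulmxA.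
  have wV j : (w j <= V2)%MS.
    elim: j => [|j IH]; first by rewrite /w expr0 mulmx1.
    by rewrite wS; exact: submx_trans (submxMr _ IH) (sV2 xB).
  have wE j : w j *m E = u *m E *m rho x ^+ j.
    elim: j => [|j IH]; first by rewrite /w !expr0 !mulmx1.
    by rewrite wS (quotient_act HQ (wV j) (sV1 xB)) IH -/(rho x) exprSr -mulmxE mulmxA.
  have wq : (w q.+1 <= V1)%MS.
    rewrite wS; apply: submx_trans (sV1 xB); apply: submxMr.
    by apply: (quotient_eq0 HQ); rewrite // wE nx mulmx0.
  have : (w 1%N <= V1)%MS.
    elim: (q) wq => // j IH wj; apply: IH; rewrite wS; apply: ss => //.
      exact: submx_trans (wV j) V2v.
    by rewrite -!wS.
  by rewrite wS /w expr0 mulmx1.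
split; first by apply/row_subP => i; rewrite row_mul H ?row_sub.
by apply: ss => //; apply: H; exact: vT.
Qed.

(** An operator for [schur_correction] is needed. If some [x] in the radical of the trace form acts
    nontrivially on [V2 / V1], then [T x] will do, because [[B, r]] acts as zero. Otherwise the
    radical acts trivially and the Casimir operator of [B] modulo the radical will do. *)
Lemma irreducible_correction :
  exists v', (v - v' <= V2)%MS /\ forall x, (x <= B)%MS -> (v' *m T x <= V1)%MS.
Proof.
have rB : (r <= B)%MS by exact: capmxSl.
have triv2 x (u : 'rV_(n * n)) : (x <= B)%MS -> (V2 *m T x <= V1)%MS ->
    (u <= V2 + v)%MS -> (u *m T x <= V1)%MS.
  move=> xB VT /addsmx_rVP [w [a [wV ->]]]; rewrite mulmxDl -scalemxAl.
  rewrite addmx_sub ?scalemx_sub ?(submx_trans (submxMr _ wV)) //.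
  by apply: ss => //; rewrite (submx_trans (submxMr _ (vT xB))).
have [[x [xr nx]]|H] := pselect (exists x, (x <= r)%MS /\ ~ (V2 *m T x <= V1)%MS).
  have xB := submx_trans xr rB.
  apply: (@schur_correction (T x)); rewrite ?sV1 ?sV2 ?vT // => y u yB uV.
  rewrite -T_br; have yxB := sB yB xB; apply: triv2 => //.
  by have [] := quotient_trivial yxB (radical_commutator_nilpotent (brmx_mem c yB xr)).
have rT x (u : 'rV_(n * n)) : (x <= r)%MS -> (u <= V2 + v)%MS -> (u *m T x <= V1)%MS.
  move=> xr; apply: triv2; first exact: submx_trans xr rB.
  by apply: contrapT => nx; apply: H; exists x.
have [Br|nBr] := pselect (B <= r)%MS.
  exists v; split; first by rewrite subrr sub0mx.
  by move=> x xB; apply: rT => //; exact: submx_trans xB Br.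
pose C := (B :\: r)%MS; pose d : nat := \rank C; pose xs : 'M[F]_(d, n) := row_base C.
pose X i := row i xs.
have XB i : (X i <= B)%MS.
  by rewrite (submx_trans (row_sub _ _)) // eq_row_base diffmxSl.
have BCr (w : 'rV_n) : (w <= B)%MS -> exists (a : 'rV[F]_d) (z : 'rV[F]_n), (z <= r)%MS /\ w = \sum_i a 0 i *: X i + z.
  move=> wB; have : (w <= xs + r)%MS.
    apply: submx_trans wB _; rewrite -{1}(addsmx_diff_cap_eq B r) addsmxS ?capmxSr //.
    by rewrite eq_row_base.
  case/sub_addsmxP => [[a b] /= ->]; exists a, (b *m r); rewrite submxMl; split=> //.
  by rewrite mulmx_sum_row.
have betar x z : (x <= B)%MS -> (z <= r)%MS -> beta z x = 0.
  by move=> xB /form_radicalP [_ Hz]; exact: Hz.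
have beta_sum (a : 'rV_d) z : beta (\sum_i a 0 i *: X i) z = \sum_i a 0 i * beta (X i) z.
  rewrite (big_morph (beta^~ _) (fun a b => betaDl a b _) (beta0 _)).
  by apply: eq_bigr => i _; rewrite betaZl.
pose G : 'M_d := \matrix_(i, j) beta (X i) (X j).
have GT : G^T = G by apply/matrixP => i j; rewrite !mxE betaC.
have uG : G \in unitmx.
  rewrite -row_free_unit -kermx_eq0; apply/eqP/row_matrixP => k; rewrite row0.
  set a := row k _; have aG : a *m G = 0 by apply/sub_kermxP; exact: row_sub.
  have Ea : a *m xs = \sum_i a 0 i *: X i by rewrite mulmx_sum_row.
  have bX j : beta (a *m xs) (X j) = 0.
    rewrite Ea beta_sum; move/rowP: aG => /(_ j); rewrite mxE [RHS]mxE => E0; rewrite -[RHS]E0.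
    by apply: eq_bigr => i _; rewrite [G i j]mxE.
  have axC : (a *m xs <= C)%MS by rewrite (submx_trans (submxMl _ _)) // eq_row_base.
  have axB : (a *m xs <= B)%MS by rewrite (submx_trans axC) // diffmxSl.
  have axr : (a *m xs <= r)%MS.
    apply/form_radicalP; split=> // w /BCr [b [z [zr ->]]].
    rewrite betaC betaDl (betar _ _ axB zr) addr0 beta_sum big1 // => i _.
    by rewrite betaC bX mulr0.
  have : (a *m xs <= C :&: r)%MS by rewrite sub_capmx axC axr.
  rewrite capmx_diff submx0 => /eqP a0.
  by rewrite -[a](mulmxKp (row_base_free C)) a0 mul0mx.
pose Hm := invmx G.
have HT : Hm^T = Hm by rewrite /Hm trmx_inv GT.
pose Om := \sum_i \sum_j Hm i j *: (T (X i) *m T (X j)).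
have stOm (V : 'M_(n * n)) : com_stable V -> stablemx V Om.
  move=> sV; rewrite /Om mulmx_sumr summx_sub // => i _; rewrite mulmx_sumr summx_sub // => j _.
  rewrite -scalemxAr scalemx_sub // mulmxA (submx_trans (submxMr _ (sV _ (XB i)))) //.
  exact: sV.
apply: (@schur_correction Om); [exact: stOm | exact: stOm | | | ].
- rewrite /Om mulmx_sumr summx_sub // => i _; rewrite mulmx_sumr summx_sub // => j _.
  rewrite -scalemxAr scalemx_sub // mulmxA (submx_trans (submxMr _ (vT (XB i)))) //.
  exact: sV2.
- move=> y u yB uV.
  have /choice [f Hf] : forall i, exists az : 'rV_d * 'rV_n, (az.2 <= r)%MS /\
      br y (X i) = \sum_k az.1 0 k *: X k + az.2.
    by move=> i; have [a [z Hz]] := BCr _ (sB yB (XB i)); exists (a, z).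
  pose A : 'M_d := \matrix_(i, k) (f i).1 0 k; pose z i := (f i).2.
  have zr i : (z i <= r)%MS by case: (Hf i).
  have Ebr i : br y (X i) = \sum_k A i k *: X k + z i.
    by case: (Hf i) => _ ->; congr (_ + _); apply: eq_bigr => k _; rewrite mxE.
  have ET i : T (br y (X i)) = \sum_k A i k *: T (X k) + T (z i).
    rewrite Ebr TD; congr (_ + _).
    rewrite (big_morph (fun w => T w) TD (etrans (congr1 _ (adm0 c)) (com_mx0 _ _))).
    by apply: eq_bigr => k _; rewrite TZ.
  have AG : A *m G + G *m A^T = 0.
    have E1 i j : (A *m G) i j = beta (br y (X i)) (X j).
      rewrite Ebr betaDl (betar _ _ (XB j) (zr i)) addr0.
      rewrite (big_morph (beta^~ _) (fun a b => betaDl a b _) (beta0 _)) mxE.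
      by apply: eq_bigr => k _; rewrite betaZl [G k j]mxE.
    apply/matrixP => i j; rewrite mxE -{2}GT -trmx_mul [(_^T) i j]mxE !E1 mxE.
    by rewrite (betaC (br y (X j))); apply: beta_inv.
  have HA : Hm *m A + A^T *m Hm = 0.
    have := congr1 (fun M => Hm *m M *m Hm) AG; rewrite mulmx0 mul0mx mulmxDr mulmxDl.
    by rewrite !mulmxA mulmxK // mulVmx // mul1mx.
  have -> : Om *m T y - T y *m Om = \sum_i \sum_j Hm i j *:
      (T (X i) *m T (br y (X j)) + T (br y (X i)) *m T (X j)).
    rewrite /Om mulmx_suml mulmx_sumr -sumrB; apply: eq_bigr => i _.
    rewrite mulmx_suml mulmx_sumr -sumrB; apply: eq_bigr => j _.
    rewrite -scalemxAl -scalemxAr -scalerBr !T_br mulmxBr mulmxBl !mulmxA.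
    by rewrite addrA subrK.
  have -> : \sum_i \sum_j Hm i j *: (T (X i) *m T (br y (X j)) + T (br y (X i)) *m T (X j)) =
      \sum_i \sum_j Hm i j *: (T (X i) *m T (z j) + T (z i) *m T (X j)).
    rewrite -[RHS]add0r -[X in X + _](invariant_tensor_sum (fun i => T (X i)) HA).
    rewrite -big_split /=; apply: eq_bigr => i _; rewrite -big_split /=; apply: eq_bigr => j _.
    by rewrite -scalerDr !ET mulmxDr mulmxDl addrACA.
  rewrite mulmx_sumr summx_sub // => i _; rewrite mulmx_sumr summx_sub // => j _.
  rewrite -scalemxAr scalemx_sub // mulmxDr !mulmxA addmx_sub //.
    by apply: rT => //; apply: submx_trans V2v; exact: uT.
  by apply: submx_trans (sV1 (XB j)); apply: submxMr; exact: rT.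
(* On [V2 / V1] the Casimir operator has trace [d], the dimension of [B] modulo the radical, nonzero
   here by characteristic zero. *)
move=> VOm.
have [DV _ _ _] := HQ.
have : D *m Om *m E = 0.
  by apply: (quotient_kill HQ); apply: submx_trans VOm; exact: submxMr.
rewrite /Om mulmx_sumr mulmx_suml => /(congr1 mxtrace); rewrite mxtrace0 raddf_sum /=.
have Etr i : \tr (D *m (\sum_j Hm i j *: (T (X i) *m T (X j))) *m E) = (Hm *m G) i i.
  rewrite mulmx_sumr mulmx_suml raddf_sum mxE; apply: eq_bigr => j _ /=.
  rewrite -scalemxAr -scalemxAl mxtraceZ (quotient_mul HQ) ?sV1 ?sV2 //.
  by rewrite -[G j i]/(G j i) -{1}GT mxE [G i j]mxE.
rewrite (eq_bigr _ (fun i _ => Etr i)) -[\sum_(i < d) _]/(\tr (Hm *m G)) mulVmx // mxtrace1.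
move/eqP; have /pcharf0P -> := charF; rewrite mxrank_eq0 => /eqP C0.
apply: nBr; rewrite -(addsmx_diff_cap_eq B r) -/C C0 adds0mx capmxSr //.
Qed.

End Irreducible.
(** Take [W] smallest among the submodules into which [B] sends some [v] of [U] outside [U0]. If [W]
    exceeded [V0], a largest proper submodule [W1] would give an irreducible [W / W1], and the
    corrected vector would contradict minimality. *)
Lemma weyl_codim_one (V0 U0 U : 'M[F]_(n * n)) :
  com_stable V0 -> com_stable U0 -> (V0 <= U0)%MS -> (U0 <= U)%MS -> ~ (U <= U0)%MS ->
  (forall x, (x <= B)%MS -> (U *m T x <= U0)%MS) ->
  (forall x V (u : 'rV_(n * n)), (x <= B)%MS -> com_stable V -> (V0 <= V)%MS -> (u <= U)%MS ->
     (u *m T x *m T x <= V)%MS -> (u *m T x <= V)%MS) ->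
  exists v : 'rV_(n * n), [/\ (v <= U)%MS, ~ (v <= U0)%MS
    & forall x, (x <= B)%MS -> (v *m T x <= V0)%MS].
Proof.
move=> sV0 sU0 VU0 U0U nU UT ss.
have [|W [[sW V0W WU0] [v [vU vU0 vW]]] Wmin] := @ex_min_rank _ _ _ (fun W =>
    [/\ com_stable W, (V0 <= W)%MS & (W <= U0)%MS] /\
    exists v : 'rV_(n * n), [/\ (v <= U)%MS, ~ (v <= U0)%MS
      & forall x, (x <= B)%MS -> (v *m T x <= W)%MS]) U0.
  split=> //; have [v vU vU0] := not_sub_rV nU; exists v; split=> // x xB.
  exact: submx_trans (submxMr _ vU) (UT x xB).
have [WV0|nWV0] := pselect (W <= V0)%MS.
  by exists v; split=> // x xB; exact: submx_trans (vW x xB) WV0.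
have [|W1 [[sW1 V0W1] [W1W nWW1]] W1max] := @ex_max_rank _ _ _ (fun W1 =>
    (com_stable W1 /\ (V0 <= W1)%MS) /\ ((W1 <= W)%MS /\ ~ (W <= W1)%MS)) V0.
  by split.
have [q [D [E HQ]]] := quotient_exists W1W.
have WvU : (W + v <= U)%MS by rewrite addsmx_sub vU (submx_trans WU0).
have [||v' [vv' v'W1]] := irreducible_correction W1W sW1 sW _ vW _ HQ.
- move=> W' sW' W1W' W'W nWW'; apply: (rank_sub_eq W1W'); apply: W1max.
  by split; split=> //; exact: submx_trans W1W'.
- move=> x u xB uWv; apply: ss => //; exact: submx_trans uWv WvU.
case: nWW1; apply: (rank_sub_eq W1W); apply: Wmin; split.
  by split=> //; exact: submx_trans W1W WU0.
exists v'; split=> //.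
  have -> : v' = v - (v - v') by rewrite opprB addrC subrK.
  by rewrite addmx_sub // eqmx_opp (submx_trans vv') // (submx_trans WU0).
move=> H; apply: vU0; rewrite -[v](subrK v') addmx_sub //.
exact: submx_trans vv' WU0.
Qed.

(** [com_mx S] is, over [K], a polynomial in [com_mx X] divisible by the square of the variable; the
    exponent [(size P).+2] in the interpolation secures the square. *)
Lemma semisimple_sub_com (X S : 'M[F]_n) (V : 'M[F]_(n * n)) (u : 'rV_(n * n)) :
  replica id X^f S^f -> stablemx V (com_mx X) -> (u *m com_mx X *m com_mx X <= V)%MS ->
  (u *m com_mx S <= V)%MS.
Proof.
move=> HS sV uXX; pose P := 'X * (char_poly X^f * char_poly (com_mx X^f)).
have P0 : P != 0 by rewrite !mulf_neq0 ?polyX_eq0 // monic_neq0 // char_poly_monic.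
have PX : polymx X^f P = 0 by rewrite !polymxM polymx_char mul0mx mulmx0.
have PT : polymx (com_mx X^f) P = 0 by rewrite !polymxM polymx_char !mulmx0.
have [p Hp] := interpolates_exists id (size P).+2 P0.
have Pm : (size P <= (size P).+2)%N by rewrite ltnW.
have HC := replica_com_mx (fun _ _ => erefl) HS (replica_polymx P0 PT Pm Hp).
have [q0 Eq] : exists q0, p = 'X * 'X * q0.
  have : root P 0 by rewrite rootM rootX eqxx.
  move=> /Hp; rewrite polyC0 !subr0 !exprS => /dvdpP [w ->].
  by exists (w * 'X ^+ size P); rewrite [RHS]mulrC -!mulrA; congr (_ * _); rewrite [RHS]mulrC mulrA.
rewrite -(map_submx iota) map_mxM map_com_mx -HC Eq !polymxM !polymxX !mulmxA.
have uK : (u^f *m com_mx X^f *m com_mx X^f <= V^f)%MS.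
  by rewrite -map_com_mx -!map_mxM map_submx.
apply: submx_trans (submxMr _ uK) _; apply: polymx_stable.
by rewrite -map_com_mx -map_mxM map_submx.
Qed.

(** Reduction to codimension one: [U] consists of maps carrying [nn] into [I] and acting on [I] as a
    scalar, [U0] of those with scalar zero, and [B] sends [U] into [U0]. Matrices act on all of [L]
    while only their restriction to [nn] matters, so those vanishing on [nn] form [V0]. *)
Theorem invariant_projection (nn I : 'M[F]_n) :
  (I <= nn)%MS -> stable c B nn -> stable c B I ->
  (forall x, (x <= B)%MS -> exists S : 'M[F]_n,
     replica id (adm c x)^f S^f /\ nn *m (adm c x - S) = 0) ->
  exists phi : 'M[F]_n, [/\ (nn *m phi <= I)%MS, I *m phi = I
    & forall x (u : 'rV_n), (x <= B)%MS -> (u <= nn)%MS ->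
      u *m phi *m adm c x = u *m adm c x *m phi].
Proof.
move=> Inn snn sI semis.
have [I0|nI0] := pselect (I = 0).
  exists 0; rewrite I0 !mulmx0; split; [exact: sub0mx | by [] | move=> x u _ _].
  by rewrite !mulmx0 mul0mx.
pose V0 := kermx (lin_mx (mulmx nn)) : 'M[F]_(n * n).
pose U0 := (kermx (lin_mx (mulmx I)) :&:
  kermx (lin_mx (mulmx nn) *m lin_mx (mulmxr (cokermx I))))%MS : 'M[F]_(n * n).
have V0P (u : 'rV_(n * n)) : (u <= V0)%MS <-> nn *m vec_mx u = 0.
  have E : u *m lin_mx (mulmx nn) = mxvec (nn *m vec_mx u) by rewrite -mul_vec_lin vec_mxK.
  split=> [/sub_kermxP|H]; last by apply/sub_kermxP; rewrite E H linear0.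
  by rewrite E => /(canRL mxvecK); rewrite linear0.
have U0P (u : 'rV_(n * n)) : (u <= U0)%MS <-> (nn *m vec_mx u <= I)%MS /\ I *m vec_mx u = 0.
  have E1 : u *m lin_mx (mulmx I) = mxvec (I *m vec_mx u) by rewrite -mul_vec_lin vec_mxK.
  have E2 : u *m (lin_mx (mulmx nn) *m lin_mx (mulmxr (cokermx I))) =
      mxvec (nn *m vec_mx u *m cokermx I).
    by rewrite mulmxA -{1}[u]vec_mxK !mul_vec_lin.
  rewrite sub_capmx (submxE (nn *m vec_mx u)); split=> [/andP [/sub_kermxP H1 /sub_kermxP H2]|[/eqP H1 H2]].
    move: H1 H2; rewrite E1 E2 => /(canRL mxvecK) H1 /(canRL mxvecK) H2.
    by rewrite H1 H2 !linear0.
  by apply/andP; split; apply/sub_kermxP; rewrite ?E1 ?E2 ?H1 ?H2 linear0.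
have vT (u : 'rV_(n * n)) A : vec_mx (u *m com_mx A) = vec_mx u *m A - A *m vec_mx u.
  by rewrite mul_com_mx mxvecK.
have nnX x : (x <= B)%MS -> (nn *m adm c x <= nn)%MS.
  by move=> xB; apply/row_subP => i; rewrite row_mul mul_adm snn ?row_sub.
have IX x : (x <= B)%MS -> (I *m adm c x <= I)%MS.
  by move=> xB; apply/row_subP => i; rewrite row_mul mul_adm sI ?row_sub.
have sV0 : com_stable V0.
  move=> x xB; apply/row_subP => i; rewrite row_mul; apply/V0P; rewrite vT.
  have /V0P H := row_sub i V0; rewrite mulmxBr !mulmxA H mul0mx sub0r.
  by have /submxP [w ->] := nnX x xB; rewrite -mulmxA H mulmx0 oppr0.
have sub_U0 x (u : 'rV_(n * n)) : (x <= B)%MS -> (nn *m vec_mx u <= I)%MS ->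
    (exists a, I *m vec_mx u = a *: I) -> (u *m T x <= U0)%MS.
  move=> xB H1 [a H2]; apply/U0P; rewrite vT !mulmxBr !mulmxA; split.
    rewrite addmx_sub ?eqmx_opp ?(submx_trans (submxMr _ H1)) ?IX //.
    exact: submx_trans (submxMr _ (nnX x xB)) H1.
  rewrite H2 -scalemxAl; have /submxP [w Ew] := IX x xB.
  by rewrite [in X in _ - X]Ew -mulmxA H2 -scalemxAr -Ew subrr.
have sU0 : com_stable U0.
  move=> x xB; apply/row_subP => i; rewrite row_mul.
  have /U0P [H1 H2] := row_sub i U0; apply: sub_U0 => //; exists 0.
  by rewrite H2 scale0r.
pose phi0 := pinvmx I *m I; pose U := (U0 + mxvec phi0)%MS.
have phi0I : I *m phi0 = I by rewrite mulmxA mulmxKpV.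
have UP (u : 'rV_(n * n)) : (u <= U)%MS -> (nn *m vec_mx u <= I)%MS /\ exists a, I *m vec_mx u = a *: I.
  move=> /addsmx_rVP [w [a [/U0P [H1 H2] ->]]]; rewrite linearD linearZ /= mxvecK !mulmxDr.
  rewrite -!scalemxAr H2 add0r phi0I; split; last by exists a.
  by rewrite addmx_sub // scalemx_sub // mulmxA submxMl.
have V0U0 : (V0 <= U0)%MS.
  apply/rV_subP => u /V0P H; apply/U0P; rewrite H sub0mx; split=> //.
  by have /submxP [w ->] := Inn; rewrite -mulmxA H mulmx0.
have nU : ~ (U <= U0)%MS.
  move=> /(submx_trans (addsmxSr U0 (mxvec phi0))) /U0P [_].
  by rewrite mxvecK phi0I.
have UT x : (x <= B)%MS -> (U *m T x <= U0)%MS.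
  move=> xB; apply/row_subP => i; rewrite row_mul.
  by have [H1 H2] := UP _ (row_sub i U); exact: sub_U0.
have [|v [vU vU0 vTx]] := weyl_codim_one sV0 sU0 V0U0 (addsmxSl _ _) nU UT.
  move=> x V u xB sV V0V uU uTT; have [S [HS nS]] := semis x xB.
  have -> : u *m T x = u *m com_mx S + u *m com_mx (adm c x - S).
    by rewrite -mulmxDr -com_mxD addrC subrK.
  rewrite addmx_sub ?(semisimple_sub_com HS (sV x xB) uTT) // (submx_trans _ V0V) //.
  apply/V0P; rewrite vT mulmxBr !mulmxA nS mul0mx subr0; have [H1 _] := UP u uU.
  by have /submxP [w ->] := submx_trans H1 Inn; rewrite -mulmxA nS mulmx0.
have [H1 [a H2]] := UP v vU.
have a0 : a != 0.
  by apply/eqP => a0; apply: vU0; apply/U0P; rewrite H1 H2 a0 scale0r.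
exists (a^-1 *: vec_mx v); split.
- by rewrite -scalemxAr scalemx_sub.
- by rewrite -scalemxAr H2 scalerA mulVf // scale1r.
move=> x u xB unn; rewrite -!scalemxAr -scalemxAl; congr (_ *: _).
have /V0P := vTx x xB; rewrite vT mulmxBr !mulmxA => /eqP; rewrite subr_eq0 => /eqP H.
have /submxP [w ->] := unn; rewrite -!(mulmxA w); congr (_ *m _).
exact: H.
Qed.

End Weyl.

(** * Frattini ideals of subalgebras *)

Section Elementary.
Variables (F : fieldType) (K : closedFieldType) (iota : {rmorphism F -> K}) (n : nat).
Variable c : 'I_n -> 'I_n -> 'rV[F]_n.
Hypothesis charF : [pchar F] =i pred0.
Hypothesis Lc : is_lie c.
Hypothesis uK : kmx c \in unitmx.
Local Notation cK := (ext_consts iota c).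
Local Notation "A ^f" := (map_mx iota A) : ring_scope.
Local Notation br := (lie_bracket c).
Local Notation kf := (kf c).

Lemma sub_max_subalgs_supplement (B I C : 'M[F]_n) :
  (forall M, max_subalg c B M -> (I <= M)%MS) ->
  subalg c C -> (C <= B)%MS -> (B <= C + I)%MS -> (B <= C)%MS.
Proof.
move=> Imax sC CB BCI; apply: contrapT => nBC.
have [|M [[sM CM] [MB nBM]] Mmax] := @ex_max_rank _ _ _ (fun M =>
    (subalg c M /\ (C <= M)%MS) /\ ((M <= B)%MS /\ ~ (B <= M)%MS)) C.
  by rewrite submx_refl.
have IM : (I <= M)%MS.
  apply: Imax; split=> //; split; first by rewrite /ltmx MB; apply/negP.
  move=> S sS MS SB; have [BS|nBS] := pselect (B <= S)%MS.
    by right; rewrite SB BS.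
  left; rewrite MS andbT; apply: (rank_sub_eq MS); apply: Mmax.
  by split; split=> //; exact: submx_trans CM MS.
by apply: nBM; apply: submx_trans BCI _; rewrite addsmx_sub CM IM.
Qed.

Lemma kernel_stabilizes m (X : 'M[F]_m) :
  exists k, forall j (u : 'rV_m), u *m X ^+ j = 0 -> u *m X ^+ k.+1 = 0.
Proof.
have [|A [k ->] Amax] := @ex_max_rank _ _ _ (fun A => exists k, A = kermx (X ^+ k)) (kermx (X ^+ 0)).
  by exists 0%N.
exists k => j u uj; rewrite exprSr -mulmxE mulmxA; suff -> : u *m X ^+ k = 0 by rewrite mul0mx.
apply/sub_kermxP; have kj : (kermx (X ^+ k) <= kermx (X ^+ (k + j)))%MS.
  by apply/sub_kermxP; rewrite exprD -mulmxE mulmxA mulmx_ker mul0mx.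
have := rank_sub_eq kj (Amax _ (ex_intro _ (k + j)%N erefl)); apply: submx_trans.
by apply/sub_kermxP; rewrite addnC exprD -mulmxE mulmxA uj mul0mx.
Qed.

Section Frattini.
Variables B I : 'M[F]_n.
Hypothesis sB : subalg c B.
Hypothesis IB : ideal_of c B I.
Hypothesis Imax : forall M, max_subalg c B M -> (I <= M)%MS.

Let IsB : (I <= B)%MS. Proof. by case: IB. Qed.
Let Iid x y : (x <= B)%MS -> (y <= I)%MS -> (br x y <= I)%MS.
Proof. by case: IB => _ H; exact: H. Qed.

(** Fitting's decomposition of [B] under [ad x]: the null component [N0] is a subalgebra, since
    generalized eigenvalues add and 0 + 0 = 0, and the other component lies in the ideal [I]. So
    [N0] supplements [I] and must be all of [B]. *)
Lemma frattini_ad_nilpotent_on x : (x <= I)%MS -> exists k, B *m adm c x ^+ k = 0.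
Proof.
move=> xI; set X := adm c x; have [k Hk] := kernel_stabilizes X.
exists k.+1; have xB := submx_trans xI IsB.
have BX : (B *m X <= I)%MS.
  by apply/row_subP => i; rewrite row_mul mul_adm (brC Lc) eqmx_opp Iid ?row_sub.
pose N0 := (B :&: kermx (X ^+ k.+1))%MS.
have sN0 : subalg c N0.
  move=> u v; rewrite !sub_capmx => /andP [uB /sub_kermxP uX] /andP [vB /sub_kermxP vX].
  rewrite sB //=; apply/sub_kermxP.
  have LK := ext_lie iota charF Lc.
  have g (w : 'rV[F]_n) : w *m X ^+ k.+1 = 0 -> gen_eig (adm cK x^f) 0 w^f.
    by move=> wX; exists k.+1; rewrite raddf0 subr0 -map_adm -map_mx_exp -map_mxM wX map_mx0.
  have [j Hj] : gen_eig (adm cK x^f) (0 + 0) (lie_bracket cK u^f v^f).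
    apply: gen_eig_leibniz (g _ uX) (g _ vX).
    - by move=> *; rewrite brDl.
    - by move=> *; rewrite brDr.
    - by move=> *; rewrite brZl.
    - by move=> *; rewrite brZr.
    - exact: adm_derivation.
  apply: (Hk j); apply: (map_mx_inj (f := iota)).
  by rewrite map_mxM map_mx_exp map_br map_adm map_mx0 -Hj addr0 raddf0 subr0.
have BXk j : (B *m X ^+ j.+1 <= I)%MS.
  elim: j => [|j IH]; first by rewrite expr1.
  rewrite exprSr -mulmxE mulmxA; apply: submx_trans (submxMr _ IH) _.
  by apply: submx_trans (submxMr _ IsB) BX.
have cap0 : (N0 :&: B *m X ^+ k.+1 = 0)%MS.
  apply/eqP/rowV0P => v; rewrite !sub_capmx => /andP [/andP [_ /sub_kermxP vX] /submxP [w Ew]].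
  rewrite Ew mulmxA; apply: (Hk (k.+1 + k.+1)%N).
  by rewrite exprD -mulmxE mulmxA -(mulmxA w) -Ew.
have BN0I : (B <= N0 + I)%MS.
  apply: (@submx_trans _ _ _ _ _ _ (N0 + B *m X ^+ k.+1)%MS); last by rewrite addsmxS.
  apply: rank_sub_eq.
    by rewrite addsmx_sub capmxSl (submx_trans (BXk k)).
  by rewrite mxrank_disjoint_sum // addnC mxrank_mul_ker.
have := sub_max_subalgs_supplement Imax sN0 (capmxSl _ _) BN0I.
by move=> /submx_trans /(_ (capmxSr _ _)) /sub_kermxP.
Qed.

(** Every subspace between [[B, B]] and [B] is a subalgebra. For [x] in [I] outside [[B, B]], a
    hyperplane of [B] containing [[B, B]] and missing [x] would supplement [I]. *)
Lemma frattini_sub_derived : (I <= brmx c B B)%MS.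
Proof.
apply: contrapT => /not_sub_rV [x xI xD]; set D := brmx c B B in xD.
have DB : (D <= B)%MS by apply/subalgP.
pose C := (D + (B :\: (D + x)))%MS.
have CB : (C <= B)%MS by rewrite addsmx_sub DB diffmxSl.
have sC : subalg c C.
  move=> u v uC vC; apply: submx_trans (addsmxSl _ _).
  by apply: brmx_mem; [exact: submx_trans uC CB | exact: submx_trans vC CB].
have BCI : (B <= C + I)%MS.
  rewrite -{1}(addsmx_diff_cap_eq B (D + x)%MS) addsmx_sub.
  rewrite (submx_trans (addsmxSr D _) (addsmxSl _ _)) /=.
  apply: submx_trans (capmxSr _ _) _; rewrite addsmx_sub.
  by rewrite (submx_trans (addsmxSl D _) (addsmxSl _ _)) (submx_trans xI) ?addsmxSr.
have BC := sub_max_subalgs_supplement Imax sC CB BCI.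
have /sub_addsmxP [[a b] /= Ex] := submx_trans xI (submx_trans IsB BC).
apply: xD; rewrite Ex addmx_sub ?submxMl //.
have -> : b *m (B :\: (D + x))%MS = 0; last exact: sub0mx.
apply/eqP; rewrite -submx0 -(capmx_diff B (D + x)%MS) sub_capmx submxMl /=.
have -> : b *m (B :\: (D + x))%MS = x - a *m D by rewrite [in RHS]Ex addrC addKr.
by rewrite addmx_sub ?addsmxSr // eqmx_opp (submx_trans (submxMl _ _)) ?addsmxSl.
Qed.

(** Lying in [[B, B]] is what turns nilpotency on [B] into nilpotency on all of [L], by the trace
    argument with [N = 0]. *)
Lemma frattini_nil : nil_sub c I.
Proof.
split=> [x y xI yI|x xI]; first by apply: Iid => //; exact: submx_trans xI IsB.
have [k Hk] := frattini_ad_nilpotent_on xI.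
apply: (commutator_nilpotent iota charF Lc (s := B) (A := B) (N := 0) (k := k)).
- exact: submx_trans xI frattini_sub_derived.
- by move=> v; rewrite submx0 => /eqP ->; rewrite br0r sub0mx.
- by rewrite Hk sub0mx.
- by move=> u v _; rewrite submx0 => /eqP ->; rewrite kf0r.
Qed.

End Frattini.

(** * The element acting as the identity on an abelian nilradical *)

Section GradingElement.
Variable nn : 'M[F]_n.
Hypothesis abn : abelian_sub c nn.
Hypothesis perp_nn : (perp c (normalizer c nn) :=: nn)%MS.
Local Notation q := (normalizer c nn).

Let perp_q : (perp c nn :=: q)%MS.
Proof.
apply: eqmx_trans (perpK q uK); apply/eqmxP/andP.
by split; apply: perpS; rewrite perp_nn submx_refl.
Qed.

Section Projection.
Variable P : 'M[F]_n.
Hypothesis Pnn : (P <= nn)%MS.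
Hypothesis Pid : nn *m P = nn.

Let PidS m (u : 'M[F]_(m, n)) : (u <= nn)%MS -> u *m P = u.
Proof. by move=> /submxP [w ->]; rewrite -mulmxA Pid. Qed.

(* The adjoint of [P] for the Killing form. *)
Let R : 'M[F]_n := kmx c *m P^T *m invmx (kmx c).

Let kmxT : (kmx c)^T = kmx c.
Proof. by apply/matrixP => i j; rewrite !mxE kfC. Qed.

Let kf_adj u v : kf (u *m P) v = kf u (v *m R).
Proof.
suff : (kf (u *m P) v)%:M = (kf u (v *m R))%:M :> 'M_1.
  by move=> /matrixP /(_ 0 0); rewrite !mxE eqxx !mulr1n.
rewrite -!kf_kmx (trmx_mul v R) (trmx_mul _ (invmx _)) trmx_mul trmxK trmx_inv kmxT.
by rewrite !mulmxA mulmxK.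
Qed.

(** Together with [Rq] this makes [R] a projection with kernel [q]: its image is a copy of [L / q],
    dual to [nn]. *)
Let qR (v : 'rV_n) : (v <= q)%MS -> v *m R = 0.
Proof.
move=> vq; apply: (kf_nondeg uK) => u; rewrite kfC -kf_adj.
have : (u *m P <= perp c q)%MS by rewrite perp_nn (submx_trans (submxMl _ _)).
by move=> /perpP; apply.
Qed.

Let Rq (v : 'rV_n) : (v - v *m R <= q)%MS.
Proof.
rewrite -perp_q; apply/perpP => u unn.
by rewrite kfC kfBr -kf_adj PidS // subrr.
Qed.

Let br_nn_q z v : (z <= nn)%MS -> (v <= q)%MS -> (br z v <= nn)%MS.
Proof. by move=> znn /normalizerP vq; rewrite (brC Lc) eqmx_opp vq. Qed.

Let br_nn z y : (z <= nn)%MS -> (br z y <= q)%MS.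
Proof.
move=> znn; rewrite -perp_q; apply/perpP => u unn.
by rewrite (brC Lc) kfNl (kf_inv Lc) abn // kf0r oppr0.
Qed.

Let skew x : adm c x *m kmx c = - (kmx c *m (adm c x)^T).
Proof.
have E (u v : 'rV[F]_n) : u *m (adm c x *m kmx c) *m v^T = u *m (- (kmx c *m (adm c x)^T)) *m v^T.
  rewrite mulmxN mulNmx !mulmxA mul_adm kf_kmx -[X in _ = - X]mulmxA -trmx_mul mul_adm kf_kmx.
  by rewrite (brC Lc x u) kfNl (kf_inv Lc) raddfN.
apply/matrixP => i j; have := E (delta_mx 0 i) (delta_mx 0 j).
by rewrite -!rowE !trmx_delta -!colE => /matrixP /(_ 0 0); rewrite !mxE.
Qed.

(* [ad z] maps [L] into [q], [q] into [nn] and [nn] to [0]; the traces of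
   [ad y ad z] on [nn] and on its dual [L / q] agree. *)
Lemma killing_abelian_nilradical z y :
  (z <= nn)%MS -> kf z y = \tr (P *m adm c y *m adm c z) *+ 2.
Proof.
move=> znn; set Y := adm c y; set Z := adm c z.
have e1 : P *m Y *m R = 0.
  apply/row_matrixP => i; rewrite row0 !row_mul mul_adm qR //.
  by rewrite (brC Lc) eqmx_opp br_nn // (submx_trans (row_sub _ _)).
have e2 : (1%:M - R) *m Z *m (1%:M - P) = 0.
  apply/row_matrixP => i; rewrite row0 !row_mul mul_adm mulmxBr mulmx1.
  have rq : (row i (1%:M - R) <= q)%MS.
    by rewrite rowE mulmxBr mulmx1 Rq.
  by rewrite PidS ?subrr // br_nn_q.
have tR : \tr (R *m Z *m Y) = \tr (P *m Y *m Z).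
  have -> : R *m Z *m Y = kmx c *m (P^T *m Z^T *m Y^T) *m invmx (kmx c).
    have A w : invmx (kmx c) *m adm c w = - ((adm c w)^T *m invmx (kmx c)).
      have := congr1 (fun M => invmx (kmx c) *m M *m invmx (kmx c)) (skew w).
      by rewrite mulmxN mulNmx !mulmxA mulmxK // mulVmx // mul1mx.
    rewrite /R -!mulmxA (mulmxA _ Z) A mulNmx !mulmxN -!mulmxA A !mulmxN opprK.
    by rewrite !mulmxA.
  rewrite mxtrace_mulC !mulmxA mulVmx // mul1mx -!trmx_mul mxtrace_tr.
  by rewrite mulmxA mxtrace_mulC mulmxA.
have e3 : Z *m (1%:M - P) = R *m (Z *m (1%:M - P)).
  by apply/eqP; rewrite -subr_eq0 -{1}[Z *m _]mul1mx -mulmxBl mulmxA e2.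
have -> : kf z y = \tr (P *m Y *m Z) + \tr (Z *m (1%:M - P) *m Y).
  rewrite /kf -/Z -/Y mulmxBr mulmx1 mulmxBl raddfB /= -[Z *m P *m Y]mulmxA.
  by rewrite (mxtrace_mulC Z (P *m Y)) addrC subrK.
rewrite e3 -[R *m _ *m Y]mulmxA (mxtrace_mulC R).
have -> : Z *m (1%:M - P) *m Y *m R = Z *m Y *m R.
  rewrite mulmxBr mulmx1 !mulmxBl -!mulmxA (mulmxA P) e1 !mulmx0 subr0 //.
by rewrite (mxtrace_mulC (Z *m Y) R) mulmxA tR mulr2n.
Qed.

(** [h] is twice the vector representing the trace of [ad w] compressed to [nn]; the 2 counts [nn]
    and its dual [L / q]. The second property holds because commutators have trace zero on [nn],
    which makes [[h, w]] orthogonal to [q]. *)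
Lemma grading_element_projection : exists h, (forall z, (z <= nn)%MS -> br h z = z) /\
  forall w, (w <= q)%MS -> (br h w <= nn)%MS.
Proof.
have [h0 Hh0] := kf_repr (\col_i \tr (P *m adm c (delta_mx 0 i))) uK.
have {}Hh0 w : kf h0 w = \tr (P *m adm c w).
  rewrite Hh0 (adm_sum_delta _ w) mulmx_sumr raddf_sum mxE.
  by apply: eq_bigr => i _; rewrite mxE -scalemxAr /= mxtraceZ.
have PZ z : (z <= nn)%MS -> P *m adm c z = 0.
  move=> znn; apply/row_matrixP => i; rewrite row0 row_mul mul_adm abn //.
  exact: submx_trans (row_sub _ _) Pnn.
have two : 2%:R != 0 :> F by have /pcharf0P -> := charF.
exists (2%:R *: h0); split=> [z znn|w wq].
  apply/eqP; rewrite -subr_eq0; apply/eqP; apply: (kf_nondeg uK) => y.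
  rewrite kfBl brZl kfZl (kf_inv Lc) Hh0 killing_abelian_nilradical // (adm_br Lc).
  by rewrite mulmxBr [P *m (adm c z *m _)]mulmxA PZ // mul0mx subr0 mulmxA mulr_natl subrr.
rewrite brZl scalemx_sub // -perp_nn; apply/perpP => w' w'q.
have st v : (v <= q)%MS -> P *m adm c v *m P = P *m adm c v.
  move=> /normalizerP vq; apply: PidS; apply/row_subP => i; rewrite row_mul mul_adm vq //.
  exact: submx_trans (row_sub _ _) Pnn.
rewrite (kf_inv Lc) Hh0 (adm_br Lc) mulmxBr raddfB /= !mulmxA.
have -> : \tr (P *m adm c w' *m adm c w) = \tr (P *m adm c w' *m (P *m adm c w)).
  by rewrite mulmxA st.
by rewrite mxtrace_mulC mulmxA st // subrr.
Qed.

End Projection.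

Lemma grading_element : exists h, (forall z, (z <= nn)%MS -> br h z = z) /\
  forall w, (w <= q)%MS -> (br h w <= nn)%MS.
Proof.
apply: (@grading_element_projection (pinvmx nn *m nn)); first exact: submxMl.
by rewrite mulmxA mulmxKpV.
Qed.

End GradingElement.

Theorem nil_abelian_elementary :
  (forall U, nil_sub c U -> abelian_sub c U) -> elementary c.
Proof.
move=> nilab B sB _ I IB Imax; apply: contrapT => /negP; rewrite mxrank_eq0 => /negP nI0.
have [IsB Iid] := IB; have nI := frattini_nil sB IB Imax.
have [|nn [[nnn Bn] Inn] Nm] := @ex_max_rank _ _ _ (fun N =>
    (nil_sub c N /\ (B <= normalizer c N)%MS) /\ (I <= N)%MS) I.
  by split; rewrite ?submx_refl //; split=> //; apply/stable_normalizer.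
have pn : (perp c (normalizer c nn) :=: nn)%MS.
  apply: (perp_normalizer iota charF Lc uK nnn) => R nR nnR qR.
  apply: (rank_sub_eq nnR); apply: Nm; split; last exact: submx_trans Inn nnR.
  by split; [exact: nR | exact: submx_trans Bn qR].
have [h [hnn hq]] := grading_element (nilab _ nnn) pn.
have [|phi [nphi Iphi cphi]] := invariant_projection (iota := iota) charF Lc sB Inn
    (proj2 (stable_normalizer c B nn) Bn) Iid.
  move=> x xB; have [xs [s [Exs _ Hr nx]]] := jordan_decomposition iota charF Lc uK x 0.
  exists (adm c xs); split=> //; have xq := submx_trans xB Bn.
  have xsq : (xs <= normalizer c nn)%MS.
    apply/normalizerP => y ynn; rewrite -mul_adm Exs.
    have st : stablemx nn (adm c x).
      apply/row_subP => i; rewrite row_mul mul_adm; have /normalizerP := xq; apply.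
      exact: row_sub.
    by rewrite (submx_trans (submxMr _ ynn)) // polymx_stable.
  have xnq : (x - xs <= normalizer c nn)%MS by rewrite addmx_sub // eqmx_opp.
  apply/row_matrixP => i; rewrite row0 row_mul -admB mul_adm.
  (* [nn] together with the nilpotent part of [x] is a nil subalgebra, hence abelian, so the
     nilpotent part kills [nn]. *)
  apply: (nilab _ (nil_sub_add Lc nnn nx xnq)); first exact: addsmxSr.
  by apply: submx_trans (row_sub _ _) (addsmxSl _ _).
pose C := (B :&: kermx (adm c h *m phi))%MS.
have CP b : (b <= C)%MS <-> (b <= B)%MS /\ br h b *m phi = 0.
  rewrite sub_capmx -mul_adm -mulmxA.
  by split=> [/andP [-> /sub_kermxP]|[-> H]] //; apply/sub_kermxP.
have Iphi1 i : (i <= I)%MS -> i *m phi = i.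
  by move=> /submxP [w ->]; rewrite -mulmxA Iphi.
have hB b : (b <= B)%MS -> (br h b <= nn)%MS by move=> bB; apply: hq; exact: submx_trans bB Bn.
(* Equivariance moves [phi] inside the bracket with [b], where [[h, b'] phi] vanishes. *)
have key b b' : (b <= C)%MS -> (b' <= C)%MS -> br b (br h b') *m phi = 0.
  move=> /CP [bB _] /CP [b'B Hb']; rewrite -mul_adm -cphi ?hB // Hb' mul0mx //.
have sC : subalg c C.
  move=> b b' bC b'C; have [bB _] := proj1 (CP b) bC; have [b'B _] := proj1 (CP b') b'C.
  apply/CP; split; first exact: sB.
  rewrite (jacobi Lc) mulmxDl (key b b' bC b'C) addr0 (brC Lc) mulNmx.
  by rewrite (key b' b b'C bC) oppr0.
have BC : (B <= C)%MS.
  apply: (sub_max_subalgs_supplement Imax sC (capmxSl _ _)).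
  apply/rV_subP => b bB; pose i := br h b *m phi.
  have iI : (i <= I)%MS by rewrite /i (submx_trans (submxMr _ (hB b bB))).
  rewrite -[b](subrK i) addmx_sub_adds //; apply/CP; split.
    by rewrite addmx_sub // eqmx_opp (submx_trans iI).
  by rewrite brBr mulmxBl (hnn i (submx_trans iI Inn)) (Iphi1 _ i iI) subrr.
apply: nI0; apply/eqP/row_matrixP => k; rewrite row0.
have /CP [_] := submx_trans (row_sub k I) (submx_trans IsB BC).
rewrite hnn ?(submx_trans _ Inn) ?row_sub // Iphi1 ?row_sub //.
Qed.

End Elementary.

Theorem theorem3p9 (F : fieldType) (K : closedFieldType)
  (iota : {rmorphism F -> K}) (n : nat) (c : 'I_n -> 'I_n -> 'rV[F]_n) :
  [pchar F] =i pred0 ->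
  alg_closure iota ->
  is_lie c ->
  semisimple c ->
  (forall P : 'M[F]_n, min_parabolic iota c P -> phi_free c P) ->
  A_algebra c /\ elementary c.
Proof.
move=> cF _ Lc ss phiP; have uK := killing_nondegenerate iota cF Lc ss.
have nilab := nil_sub_abelian cF Lc uK phiP.
split; first exact: (nil_abelian_A_algebra iota cF Lc uK nilab).
exact: (nil_abelian_elementary iota cF Lc uK nilab).
Qed.
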